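(* Assume the network assumption, the stochastic gradient assumption, the unbiased compressor assumption (with parameter $C>0$), the $\mu$-strong convexity assumption on $f$ and the smoothness assumption (with constant $L$) stated in the context, and let $x^*$ be the minimizer of $f$ and $\kappa=L/\mu$. Run CEDAS with initialization $h_{i,0}=x_{i,-1}$ for all $i$ (i.e. $H_0=\mathbf{x}_{-1}$) and stepsizes $\eta_k=\frac{\theta}{\mu(k+m)}$, where $\theta\ge20$, $m\ge\frac{48\theta\kappa}{\gamma(1-\lambda_2)}$, the condition $\gamma\le\min\{\frac12,\frac{\alpha^2(1-\lambda_2)}{15876\,C},\frac\alpha2\}$ holds, and $$\alpha=\frac{1}{4(C+1)},\qquad\gamma=\frac{\alpha^2(1-\lambda_2)}{\beta_0C},\qquad\beta_0=15876.$$ Assume further that for some $q>0$, $$\sum_{i=1}^n\|\nabla f_i(x^* )\|^2=\mathcal{O}(n^3),\qquad\|\mathbf{x}_{-1}\|^2=\mathcal{O}(n^2),\qquad\frac{1}{1-\lambda_2}=\mathcal{O}(n^q).$$ Then the transient time of CEDAS (defined in the context) satisfies $$K_T^{(scvx)}=\mathcal{O}\left(\frac{nC^3}{(1-\lambda_2)^2}\right).$$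
   Context: Notation. There are $n$ agents; $f_i:\mathbb{R}^p\to\mathbb{R}$ is the local cost function of agent $i$ and $f=\frac1n\sum_{i=1}^nf_i$. $\mathbf{1}\in\mathbb{R}^n$ is the all-ones vector. $\|\cdot\|$ is the Euclidean norm of vectors and the Frobenius norm of matrices. $\mathcal{O}(\cdot)$ hides constants independent of $n$, $1-\lambda_2$ and $C$. Transient time. $K_T^{(scvx)}=\inf_K\{\frac1n\sum_{i=1}^n\mathbb{E}[\|x_{i,k}-x^*\|^2]\le\mathcal{O}(\frac{1}{nk}),\ \forall k\ge K\}$. Network assumption. The communication graph on the agents is undirected and strongly connected; the mixing matrix $W=(w_{ij})\in\mathbb{R}^{n\times n}$ is positive semidefinite, nonnegative, symmetric and stochastic ($W\mathbf{1}=\mathbf{1}$), and for $i\ne j$ one has $w_{ij},w_{ji}>0$ if and only if $i,j$ are linked, and $w_{ij}=w_{ji}=0$ otherwise. Its eigenvalues $\lambda_1\ge\lambda_2\ge\cdots\ge\lambda_n$ lie in $[0,1]$. CEDAS. Given stepsizes $\eta_k$ ($k\ge-1$), parameters $\alpha,\gamma>0$, a compression operator $\mathcal{C}:\mathbb{R}^p\to\mathbb{R}^p$ applied row by row, and initial values $\mathbf{x}_{-1},H_0\in\mathbb{R}^{n\times p}$ (with rows $x_{i,-1}^\top$, $h_{i,0}^\top$), set $D_0=0$, $\mathbf{x}_0=\mathbf{x}_{-1}-\eta_{-1}G_{-1}$, and for $k\ge0$: $\mathbf{y}_k=\mathbf{x}_k-\eta_kG_k-D_k$; $Q_k=\mathcal{C}(\mathbf{y}_k-H_k)$;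 $D_{k+1}=D_k+\frac\gamma2(I-W)(H_k+Q_k)$; $H_{k+1}=H_k+\alpha Q_k$; $\mathbf{x}_{k+1}=\mathbf{x}_k-\eta_kG_k-D_{k+1}$. Here $G_k$ has rows $g_{i,k}^\top$ with $g_{i,k}=\nabla f_i(x_{i,k};\xi_{i,k})$ the stochastic gradient of agent $i$, and $x_{i,k}^\top$ is the $i$-th row of $\mathbf{x}_k$. Stochastic gradient assumption. For all iterations $k\ge0$, each agent $i$ can obtain a noisy gradient $\nabla f_i(x_{i,k};\xi_{i,k})$ given $x_{i,k}$, where the random vectors $\xi_{i,k}$ are independent across agents $i$, and for some $\sigma>0$, $\mathbb{E}[\nabla f_i(x_{i,k};\xi_{i,k})\mid x_{i,k}]=\nabla f_i(x_{i,k})$ and $\mathbb{E}[\|\nabla f_i(x_{i,k};\xi_{i,k})-\nabla f_i(x_{i,k})\|^2\mid x_{i,k}]\le\sigma^2$. Unbiased compressor assumption. $\mathbb{E}[\mathcal{C}(x)\mid x]=x$ and $\mathbb{E}[\|\mathcal{C}(x)-x\|^2\mid x]\le C\|x\|^2$ for all $x\in\mathbb{R}^p$, with $C>0$. Strong convexity assumption. $\langle\nabla f(x)-\nabla f(x'),x-x'\rangle\ge\mu\|x-x'\|^2$ for all $x,x'\in\mathbb{R}^p$, with $\mu>0$. Smoothness assumption. Each $f_i$ has $L$-Lipschitz continuous gradient: $\|\nabla f_i(x)-\nabla f_i(x')\|\le L\|x-x'\|$ for all $x,x'\in\mathbb{R}^p$.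
   Formalization: Added to mend false cases: m at most a constant times its lower bound; ‖x*‖² at most a constant; C ≥ C_min > 0, constants depending on C_min; the bound is for n ≥ N(C); q + 3/2 < θ. Samples are also independent over iterations and of the compression; noise assumption also at k = −1. *)

(* Defs.v *)
From HB Require Import structures.
From mathcomp Require Import all_boot all_order all_algebra.
From mathcomp Require Import all_classical all_reals all_analysis.

Set Implicit Arguments.
Unset Strict Implicit.
Unset Printing Implicit Defensive.

Import Order.TTheory GRing.Theory Num.Theory.
Import numFieldNormedType.Exports.

Local Open Scope classical_set_scope.
Local Open Scope ring_scope.

Section Euclidean.
Context {R : realType}.

(* Squared Frobenius norm, which is the squared Euclidean norm on row vectors;
   the norm that the library puts on matrices is the max norm. *)
Definition sqnorm m n (A : 'M[R]_(m, n)) : R := \sum_i \sum_j A i j ^+ 2.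

Definition enorm m n (A : 'M[R]_(m, n)) : R := Num.sqrt (sqnorm A).

Definition dotp p (u v : 'rV[R]_p) : R := \sum_j u 0 j * v 0 j.

(* Used only for differentiable [f]. *)
Definition grad p (f : 'rV[R]_p -> R) (x : 'rV[R]_p) : 'rV[R]_p :=
  \row_j 'D_(delta_mx 0 j) f x.

Definition smooth p (L : R) (f : 'rV[R]_p -> R) : Prop :=
  (forall x, differentiable f x) /\
  (forall x x', enorm (grad f x - grad f x') <= L * enorm (x - x')).

Definition strongly_convex p (mu : R) (f : 'rV[R]_p -> R) : Prop :=
  forall x x', mu * enorm (x - x') ^+ 2 <= dotp (grad f x - grad f x') (x - x').

Definition is_minimizer p (f : 'rV[R]_p -> R) (x : 'rV[R]_p) : Prop :=
  forall z, f x <= f z.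

Definition average_cost n p (f : 'I_n -> 'rV[R]_p -> R) (x : 'rV[R]_p) : R :=
  n%:R^-1 * \sum_i f i x.

End Euclidean.

Section Network.
Context {R : realType}.

Record mixing_matrix n (e : rel 'I_n) (W : 'M[R]_n) : Prop := MixingMatrix {
  mixing_undirected : symmetric e;
  mixing_connected : forall i j, connect e i j;
  mixing_psd : forall v : 'cV[R]_n, 0 <= (v^T *m W *m v) 0 0;
  mixing_ge0 : forall i j, 0 <= W i j;
  mixing_symmetric : W^T = W;
  mixing_stochastic : W *m (const_mx 1 : 'cV[R]_n) = const_mx 1;
  mixing_link : forall i j, i != j -> (0 < W i j) = e i j;
  mixing_nolink : forall i j, i != j -> ~~ e i j -> W i j = 0 }.

(* [lam] lists lambda_1 >= lambda_2 >= ... with algebraic multiplicity and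
   counting from 0, so that lambda_2 is [lam`_1]. *)
Definition ordered_spectrum n (W : 'M[R]_n) (lam : seq R) : Prop :=
  sorted >=%R lam /\ char_poly W = \prod_(l <- lam) ('X - l%:P).

End Network.

Section Probability.
Context {R : realType}.

(* [vecm R p] is 'rV[R]_p with the product sigma-algebra of R^p, transported
   from p-tuples; it coincides with the Borel sigma-algebra. *)
Definition tuple_of_row p (v : 'rV[R]_p) : p.-tuple (measurableTypeR R) :=
  [tuple v 0 j | j < p].

Definition vecm p := g_sigma_algebra_preimageType (@tuple_of_row p).

Context {d : measure_display} {Omega : measurableType d}.
Variable P : probability Omega R.

Definition generated_sigma d' (T : measurableType d') (X : Omega -> T) :
  set (set Omega) := preimage_set_system setT X measurable.

Definition mutually_independent (I : eqType) (G : I -> set (set Omega)) :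
  Prop :=
  forall (s : seq I) (A : I -> set Omega), uniq s ->
  (forall i, i \in s -> G i (A i)) ->
  P (\bigcap_(i in [set` s]) A i) = (\prod_(i <- s) fine (P (A i)))%:E.

(* [Z] is a version of E[X | Y] for a random vector [Y]. *)
Definition is_cond_expectation p (X : Omega -> R) (Y : Omega -> 'rV[R]_p)
    (Z : Omega -> R) : Prop :=
  let sigmaY := generated_sigma (Y : Omega -> vecm p) in
  [/\ P.-integrable setT (EFin \o X),
      P.-integrable setT (EFin \o Z),
      (forall B : set (measurableTypeR R), measurable B -> sigmaY (Z @^-1` B))
    & forall A, sigmaY A ->
        (\int[P]_(w in A) (X w)%:E = \int[P]_(w in A) (Z w)%:E)%E].

(* E[X | Y] <= c almost surely *)
Definition cond_expectation_le p (X : Omega -> R) (Y : Omega -> 'rV[R]_p)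
    (c : R) : Prop :=
  exists2 Z, is_cond_expectation X Y Z & {ae P, forall w, Z w <= c}.

(* A random operator is a map [comp x z] fed with a random seed [zeta]. *)
Definition unbiased_compressor p (Z : Type) (C : R)
    (comp : 'rV[R]_p -> Z -> 'rV[R]_p) (zeta : Omega -> Z) : Prop :=
  forall x : 'rV[R]_p,
    (forall j, 'E_P[fun w => comp x (zeta w) 0%R j] = (x 0%R j)%:E)%E /\
    ('E_P[fun w => (enorm (comp x (zeta w) - x) ^+ 2)%R]
       <= (C * enorm x ^+ 2)%:E)%E.

Definition stochastic_gradient p (Xi : Type) (sigma : R)
    (gradf : 'rV[R]_p -> 'rV[R]_p) (g : 'rV[R]_p -> Xi -> 'rV[R]_p)
    (x : Omega -> 'rV[R]_p) (xi : Omega -> Xi) : Prop :=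
  (forall j, is_cond_expectation
     (fun w => g (x w) (xi w) 0 j) x (fun w => gradf (x w) 0 j)) /\
  cond_expectation_le
     (fun w => enorm (g (x w) (xi w) - gradf (x w)) ^+ 2) x (sigma ^+ 2).

End Probability.

Section Cedas.
Context {R : realType} {n p : nat} {Xi Z : Type}.

Record cedas_params := CedasParams {
  cp_W : 'M[R]_n;
  cp_alpha : R;
  cp_gamma : R;
  (* The iteration counter starts at -1: [cp_eta t] is eta_{t-1}. *)
  cp_eta : nat -> R;
  cp_grad : 'I_n -> 'rV[R]_p -> Xi -> 'rV[R]_p;
  cp_comp : 'rV[R]_p -> Z -> 'rV[R]_p;
  cp_x : 'M[R]_(n, p);
  cp_H : 'M[R]_(n, p) }.

Variable c : cedas_params.

Record cedas_state := CedasState {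
  st_x : 'M[R]_(n, p); st_D : 'M[R]_(n, p); st_H : 'M[R]_(n, p) }.

Definition grad_matrix (x : 'M[R]_(n, p)) (xi : 'I_n -> Xi) : 'M[R]_(n, p) :=
  \matrix_i cp_grad c i (row i x) (xi i).

Definition compress_rows (y : 'M[R]_(n, p)) (zeta : 'I_n -> Z) :
  'M[R]_(n, p) := \matrix_i cp_comp c (row i y) (zeta i).

Definition cedas_init (xi : 'I_n -> Xi) : cedas_state :=
  CedasState (cp_x c - cp_eta c 0 *: grad_matrix (cp_x c) xi) 0 (cp_H c).

Definition cedas_step (eta : R) (xi : 'I_n -> Xi) (zeta : 'I_n -> Z)
    (s : cedas_state) : cedas_state :=
  let: CedasState x D H := s in
  let G := grad_matrix x xi in
  let y := x - eta *: G - D in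
  let Q := compress_rows (y - H) zeta in
  let D' := D + (cp_gamma c / 2) *: ((1%:M - cp_W c) *m (H + Q)) in
  CedasState (x - eta *: G - D') D' (H + cp_alpha c *: Q).

(* [xi i t] is the sample xi_{i,t-1}; [zeta i k] is the randomness of the
   compressor of agent i at iteration k >= 0. *)
Fixpoint cedas (xi : 'I_n -> nat -> Xi) (zeta : 'I_n -> nat -> Z) (k : nat) :
  cedas_state :=
  if k is k'.+1 then
    cedas_step (cp_eta c k) (fun i => xi i k) (fun i => zeta i k')
      (cedas xi zeta k')
  else cedas_init (fun i => xi i 0%N).

(* The vector x_{i,t-1} of agent i, so that t = 0 is the initial value. *)
Definition cedas_iterate (xi : 'I_n -> nat -> Xi) (zeta : 'I_n -> nat -> Z)
    (i : 'I_n) (t : nat) : 'rV[R]_p :=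
  row i (if t is k.+1 then st_x (cedas xi zeta k) else cp_x c).

End Cedas.

Arguments cedas_params : clear implicits.

Section CedasProcess.
Context {R : realType} {n p : nat} {d dXi dZ : measure_display}
  {Omega : measurableType d} {Xi : measurableType dXi} {Z : measurableType dZ}.
Variables (P : probability Omega R) (c : cedas_params R n p Xi Z).
Variables (xi : 'I_n -> nat -> Omega -> Xi) (zeta : 'I_n -> nat -> Omega -> Z).

Definition iterate (i : 'I_n) (t : nat) (w : Omega) : 'rV[R]_p :=
  cedas_iterate c (fun j k => xi j k w) (fun j k => zeta j k w) i t.

(* The gradient samples are independent across agents and iterations, and the
   compression at an iteration is independent of all other randomness; the
   seeds of different agents at the same iteration may be dependent. *)
Record cedas_randomness : Prop := CedasRandomness {
  sample_measurable : forall i t, measurable_fun setT (xi i t);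
  seed_measurable : forall i k, measurable_fun setT (zeta i k);
  oracle_measurable : forall i, measurable_fun setT
    (fun z : vecm p * Xi => cp_grad c i z.1 z.2 : vecm p);
  compressor_measurable : measurable_fun setT
    (fun z : vecm p * Z => cp_comp c z.1 z.2 : vecm p);
  randomness_independent : mutually_independent P
    (fun a : ('I_n * nat) + nat =>
       match a with
       | inl (i, t) => generated_sigma (xi i t)
       | inr k => <<s \bigcup_i generated_sigma (zeta i k) >>
       end) }.

Definition mean_square_error (xstar : 'rV[R]_p) (k : nat) : \bar R :=
  ((n%:R^-1)%:E *
     \sum_i 'E_P[fun w => (enorm (iterate i k.+1 w - xstar) ^+ 2)%R])%E.

(* [c0] is the constant hidden in O(1 / (n k)). The bound is only meaningful
   from k = 1 on. If no K qualifies, the value is +oo. *)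
Definition transient_time (xstar : 'rV[R]_p) (c0 : R) : \bar R :=
  ereal_inf [set (K%:R%:E : \bar R) | K in [set K : nat | (0 < K)%N /\
    forall k, (K <= k)%N ->
      (mean_square_error xstar k <= (c0 / (n%:R * k%:R))%:E)%E]].

End CedasProcess.

(* Main.v *)
Require Import Defs.
From HB Require Import structures.
From mathcomp Require Import all_boot all_order all_algebra.
From mathcomp Require Import all_classical all_reals all_analysis.
From mathcomp Require Import complex spectral sesquilinear measurable_realfun.
From mathcomp Require Import ring lra.

Set Implicit Arguments.
Unset Strict Implicit.
Unset Printing Implicit Defensive.

Import Order.TTheory GRing.Theory Num.Theory.
Import numFieldNormedType.Exports.

Local Open Scope classical_set_scope.
Local Open Scope ring_scope.

(** Each iterate is compared with the fixed point of the noiseless iteration.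
    Write e for the errors x - 1 xstar, J for the averaging projector, Pi = I - J,
    B = (gamma / 2) (I - W), F for the gradients of the agents, Fs for their
    values at xstar, and b = gamma (1 - lambda_2) / 2 for the smallest nonzero
    eigenvalue of B. At the fixed point D = - eta Fs, and D always stays in the
    range of B, so that D + eta Fs = B q for some q. In these coordinates one
    iteration reads
      y = e - B q - eta (F(x) - Fs + S),    e' = y - B (y + T),
      q' = q + y + T + (eta' - eta) s  up to constants,
    where S and T are the noises of the gradients and of the compressor and
    B s = Fs.

    Two quantities describe the state: a = E |J e|^2, and
      V = E (|Pi e|^2 + <q, B q> + omega |x - H|^2),
    which measures the disagreement, the error of the dual variable and the error
    of the compressed copies. With omega proportional to gamma C / alpha, the
    compression noise that enters V is paid for by the contraction of x - H;
    this gives V' <= (1 - b/64) V up to a gradient term proportional to a and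
    source terms [lyapunov_descent]. The average follows a stochastic gradient
    descent disturbed by V [mean_descent]. Both estimates are pointwise and
    affine in cross terms with S and T. These cross terms have expectation zero
    because a fresh sample is independent of the past
    [gradient_noise_orthogonal, compressor_noise_orthogonal], and J divides the
    variance of S by the number of agents because the agents sample
    independently [Ex_avg_noise_sq].

    With tau = k + m, the two recursions for a and V are solved by comparison
    with an explicit envelope [coupled_recursion_bound], which gives
      a + V <= Gam (1 / tau + (n m)^3 / tau^4 + E0 (m / tau)^r1)
    for any exponent 4 <= r1 < 2 theta, where E0 bounds the initial errors and Gam
    is independent of n, the gap and C. For k >= n m the first two terms are at
    most 1 / k. The orders of magnitude give E0 = O(n^2 + n^3 / m) and, since m is of
    order C^3 / (1 - lambda_2)^2, also m = O(n^(2 q)) for fixed C; as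
    theta > q + 3/2 leaves room for r1 > max (2 q + 3, 4), the third term is at
    most 1 / k once n is large. Hence the transient time is at most about n m,
    which is of the announced order. *)

(** * The Frobenius inner product *)

Section InnerProduct.
Variable R : realType.

Definition mdot m n (A B : 'M[R]_(m, n)) : R := \tr (A^T *m B).

Lemma mdotE m n (A B : 'M[R]_(m, n)) :
  mdot A B = \sum_i \sum_j A i j * B i j.
Proof.
rewrite /mdot /mxtrace exchange_big; apply: eq_bigr => j _.
by rewrite mxE; apply: eq_bigr => i _; rewrite mxE.
Qed.

Lemma mdotC m n (A B : 'M[R]_(m, n)) : mdot A B = mdot B A.
Proof. by rewrite /mdot -mxtrace_tr trmx_mul trmxK. Qed.

Lemma mdotDr m n (A B C : 'M[R]_(m, n)) : mdot A (B + C) = mdot A B + mdot A C.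
Proof. by rewrite /mdot mulmxDr mxtraceD. Qed.

Lemma mdotNr m n (A B : 'M[R]_(m, n)) : mdot A (- B) = - mdot A B.
Proof. by rewrite /mdot mulmxN linearN. Qed.

Lemma mdotZr m n (A B : 'M[R]_(m, n)) c : mdot A (c *: B) = c * mdot A B.
Proof. by rewrite /mdot -scalemxAr mxtraceZ. Qed.

Lemma mdotDl m n (A B C : 'M[R]_(m, n)) : mdot (B + C) A = mdot B A + mdot C A.
Proof. by rewrite mdotC mdotDr !(mdotC A). Qed.

Lemma mdotNl m n (A B : 'M[R]_(m, n)) : mdot (- B) A = - mdot B A.
Proof. by rewrite mdotC mdotNr mdotC. Qed.

Lemma mdotZl m n (A B : 'M[R]_(m, n)) c : mdot (c *: B) A = c * mdot B A.
Proof. by rewrite mdotC mdotZr mdotC. Qed.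

Lemma mdot0r m n (A : 'M[R]_(m, n)) : mdot A 0 = 0.
Proof. by rewrite -(scale0r 0) mdotZr mul0r. Qed.

Definition mdot_lin := (mdotDl, mdotDr, mdotNl, mdotNr, mdotZl, mdotZr).

Lemma mdot_mulmx m n p (M : 'M[R]_(m, n)) (A : 'M[R]_(n, p)) (B : 'M[R]_(m, p)) :
  mdot (M *m A) B = mdot A (M^T *m B).
Proof. by rewrite /mdot trmx_mul mulmxA. Qed.

Lemma mdot_sym n p (M : 'M[R]_n) (A B : 'M[R]_(n, p)) : M^T = M ->
  mdot (M *m A) B = mdot A (M *m B).
Proof. by move=> sM; rewrite mdot_mulmx sM. Qed.

Lemma sqnormE m n (A : 'M[R]_(m, n)) : sqnorm A = mdot A A.
Proof. by rewrite mdotE. Qed.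

Lemma mdot_ge0 m n (A : 'M[R]_(m, n)) : 0 <= mdot A A.
Proof.
by rewrite mdotE; do 2!apply: sumr_ge0 => ? _; rewrite -expr2 sqr_ge0.
Qed.

Lemma sqnorm_ge0 m n (A : 'M[R]_(m, n)) : 0 <= sqnorm A.
Proof. by rewrite sqnormE mdot_ge0. Qed.

Lemma enorm_sq m n (A : 'M[R]_(m, n)) : enorm A ^+ 2 = sqnorm A.
Proof. by rewrite sqr_sqrtr ?sqnorm_ge0. Qed.

Lemma mdot_eq0 m n (A : 'M[R]_(m, n)) : mdot A A = 0 -> A = 0.
Proof.
rewrite mdotE => A0; apply/matrixP => i j; rewrite mxE; apply/eqP.
have Aij k l : 0 <= A k l * A k l by rewrite -expr2 sqr_ge0.
have A0i : \sum_j A i j * A i j = 0.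
  by apply: (psumr_eq0P _ A0) => // k _; apply: sumr_ge0 => l _.
have /eqP : A i j * A i j = 0 by apply: (psumr_eq0P _ A0i).
by rewrite mulf_eq0 orbb.
Qed.

Lemma mdot_young m n (c : R) (A B : 'M[R]_(m, n)) : 0 < c ->
  2 * mdot A B <= c * mdot A A + c^-1 * mdot B B.
Proof.
move=> c0; have := mdot_ge0 (c *: A - B); rewrite !mdot_lin (mdotC B A) => h.
rewrite -(ler_pM2l c0); rewrite mulrDr !mulrA mulfV ?gt_eqF// mul1r.
nra.
Qed.

Lemma sqnorm_rows m n (A : 'M[R]_(m, n)) : sqnorm A = \sum_i sqnorm (row i A).
Proof.
apply: eq_bigr => i _; rewrite /sqnorm big_ord1.
by apply: eq_bigr => j _; rewrite mxE.
Qed.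

End InnerProduct.

(** * Quadratic forms and eigenvalues *)

Section Rayleigh.
Variable R : realType.

Local Notation toC := (real_complex R).
Local Notation "A ^*t" := (map_mx Num.conj A^T) (at level 2).

(** The spectral theorem is applied over R[i], where a real symmetric matrix is
    Hermitian; its eigenvalues are real, which lets d be a real vector. *)
Lemma symmetric_unitary_diag n (A : 'M[R]_n) : A^T = A ->
  exists (U : 'M[R[i]]_n) (d : 'rV[R]_n),
    U *m U^*t = 1%:M /\ map_mx toC A = U^*t *m diag_mx (map_mx toC d) *m U.
Proof.
move=> sA; pose Ac := map_mx toC A.
have Ah : Ac \is hermsymmx.
  apply: realsym_hermsym.
    by apply/is_hermitianmxP; rewrite expr0 scale1r /= map_trmx sA map_mx_id.
  apply/mxOverP => i j; rewrite mxE.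
  apply/CrealP. by rewrite /Num.conj /= oppr0.
have /orthomx_spectralP Ae := hermitian_normalmx Ah.
have dr := hermitian_spectral_diag_real Ah.
have Uu := spectral_unitarymx Ac.
move: (spectralmx Ac) (spectral_diag Ac) Ae dr Uu => P sp Ae dr Uu.
exists P, (map_mx (@complex.Re R) sp); split; first exact/unitarymxP.
have <- : sp = map_mx toC (map_mx (@complex.Re R) sp).
  apply/matrixP => i j; rewrite !mxE.
  have /mxOverP/(_ i j) := dr; case: (sp i j) => x y /CrealP[] /eqP.
  by rewrite eq_sym -subr_eq0 opprK -mulr2n mulrn_eq0 /= => /eqP ->.
by rewrite -invmx_unitary.
Qed.

(** A symmetric matrix is diagonal in an orthonormal basis, so that its
    quadratic form is a weighted average of its eigenvalues. *)
Lemma rayleigh_le n p (A : 'M[R]_n) (l : R) (M : 'M[R]_(n, p)) :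
  A^T = A -> (forall x, eigenvalue A x -> x <= l) ->
  mdot M (A *m M) <= l * mdot M M.
Proof.
move=> sA Al; have [U [d [UU Ad]]] := symmetric_unitary_diag sA.
have dl i : d 0 i <= l.
  apply: Al; rewrite -(eigenvalue_map toC); apply/eigenvalueP.
  exists (row i U).
    rewrite -row_mul Ad !mulmxA UU mul1mx; apply/rowP => j.
    rewrite !mxE (bigD1 i) //= big1 ?addr0 => [|k ki]; last first.
      by rewrite !mxE eq_sym (negPf ki) mulr0n mul0r.
    by rewrite !mxE eqxx mulr1n.
  apply/eqP => U0; have := congr1 (fun B => row i B) UU.
  rewrite row_mul U0 mul0mx => /rowP/(_ i)/eqP; rewrite !mxE eqxx.
  by rewrite eq_sym oner_eq0.
pose Z := U *m map_mx toC M.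
have trZ (D : 'M[R[i]]_n) :
    \tr (map_mx toC M^T *m (U^*t *m D *m U) *m map_mx toC M) =
    \tr (Z^*t *m D *m Z).
  have -> : Z^*t = map_mx toC M^T *m U^*t.
    rewrite trmx_mul map_mxM; congr (_ *m _).
    apply/matrixP => i j; rewrite !mxE.
    by exact: conjc_real.
  by rewrite /Z !mulmxA.
have mdotZ (w : 'rV[R]_n) :
    \tr (Z^*t *m diag_mx (map_mx toC w) *m Z) =
    \sum_j \sum_i toC (w 0 i) * `|Z i j| ^+ 2.
  apply: eq_bigr => j _; rewrite mxE; apply: eq_bigr => i _.
  rewrite mul_mx_diag !mxE normCK mulrAC mulrC; congr (_ * _).
  by rewrite mulrC.
have UU' : U^*t *m U = 1%:M by apply: mulmx1C.
rewrite -lecR rmorphM /=.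
have -> : toC (mdot M (A *m M)) = \sum_j \sum_i toC (d 0 i) * `|Z i j| ^+ 2.
  by rewrite -mdotZ -trZ -Ad /mdot -map_mxM -map_mxM trace_map_mx mulmxA.
have -> : toC (mdot M M) = \sum_j \sum_i `|Z i j| ^+ 2.
  transitivity (\sum_j \sum_i toC ((const_mx 1 : 'rV[R]_n) 0 i) * `|Z i j| ^+ 2).
    rewrite -mdotZ -trZ map_const_mx rmorph1 diag_const_mx mulmx1 UU' mulmx1.
    by rewrite /mdot -map_mxM trace_map_mx.
  by do 2!apply: eq_bigr => ? _; rewrite mxE rmorph1 mul1r.
rewrite mulr_sumr; apply: ler_sum => j _; rewrite mulr_sumr.
by apply: ler_sum => i _; rewrite ler_wpM2r ?exprn_ge0// lecR.
Qed.
End Rayleigh.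

(** * Averaging and centring *)

Section Averaging.
Variables (R : realType) (n : nat).

(** The orthogonal projectors onto the constants and onto their complement. *)
Definition avg : 'M[R]_n := const_mx n%:R^-1.
Definition cen : 'M[R]_n := 1%:M - avg.

Lemma avg_sym : avg^T = avg.
Proof. by apply/matrixP => i j; rewrite !mxE. Qed.

Lemma cen_sym : cen^T = cen.
Proof. by rewrite linearB /= trmx1 avg_sym. Qed.

Hypothesis n0 : (0 < n)%N.

Lemma avg_idem : avg *m avg = avg.
Proof.
apply/matrixP => i j; rewrite !mxE; under eq_bigr do rewrite !mxE.
by rewrite sumr_const card_ord -(mulr_natr (_ * _)) -mulrA mulVf ?mulr1 // pnatr_eq0 -lt0n.
Qed.

Lemma avg_cen : avg *m cen = 0.
Proof. by rewrite mulmxBr mulmx1 avg_idem subrr. Qed.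

Lemma avg_cenD p (M : 'M[R]_(n, p)) : M = avg *m M + cen *m M.
Proof. by rewrite -mulmxDl addrC subrK mul1mx. Qed.

Lemma mdot_avg_cen p (M N : 'M[R]_(n, p)) : mdot (avg *m M) (cen *m N) = 0.
Proof. by rewrite mdot_sym ?avg_sym// mulmxA avg_cen mul0mx mdot0r. Qed.

Lemma mdot_pythagoras p (M : 'M[R]_(n, p)) :
  mdot M M = mdot (avg *m M) (avg *m M) + mdot (cen *m M) (cen *m M).
Proof.
rewrite {1 2}(avg_cenD M) !mdot_lin mdot_avg_cen (mdotC (cen *m M)) mdot_avg_cen.
by rewrite addr0 add0r.
Qed.

End Averaging.

(** * The spectral gap of the mixing matrix *)

Section Gap.
Variable R : realType.
Local Notation toC := (real_complex R).
Local Notation "A ^*t" := (map_mx Num.conj A^T) (at level 2).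
Context {n : nat} {e : rel 'I_n} {W : 'M[R]_n}.
Hypothesis We : mixing_matrix e W.

Lemma mixing_row_sum i : \sum_j W i j = 1.
Proof.
have /matrixP/(_ i 0) := mixing_stochastic We; rewrite !mxE => <-.
by apply: eq_bigr => j _; rewrite mxE mulr1.
Qed.

Lemma mixing_symE i j : W i j = W j i.
Proof. by rewrite -[in LHS](mixing_symmetric We) mxE. Qed.

(** The maximum principle: at a maximal entry an eigenvector for an eigenvalue
    at least 1 is an average of its neighbouring entries, so the maximum spreads
    along the links of the connected graph. *)
Lemma mixing_eigen_max (v : 'rV[R]_n) (x : R) (i : 'I_n) :
  v *m W = x *: v -> 1 <= x -> 0 <= v 0 i -> (forall j, v 0 j <= v 0 i) ->
  v = const_mx (v 0 i).
Proof.
move=> vW x1 vi0 vmax.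
have vWE k : \sum_j W k j * v 0 j = x * v 0 k.
  have /rowP/(_ k) := vW; rewrite !mxE => <-.
  by apply: eq_bigr => j _; rewrite mixing_symE mulrC.
have spread k l : v 0 k = v 0 i -> e k l -> v 0 l = v 0 i.
  move=> vk ekl; have [<- //|kl] := eqVneq k l.
  have Wkl : 0 < W k l by rewrite (mixing_link We).
  have s0 : \sum_j W k j * (v 0 i - v 0 j) = 0.
    apply/eqP; rewrite eq_le; apply/andP; split; last first.
      by apply: sumr_ge0 => j _; rewrite mulr_ge0 ?(mixing_ge0 We) ?subr_ge0.
    under eq_bigr do rewrite mulrBr.
    rewrite sumrB vWE -mulr_suml mixing_row_sum mul1r vk subr_le0.
    by rewrite -[leLHS]mul1r ler_wpM2r.
  have /eqP : W k l * (v 0 i - v 0 l) = 0.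
    apply: (psumr_eq0P _ s0) => // j _.
    by rewrite mulr_ge0 ?(mixing_ge0 We) ?subr_ge0.
  by rewrite mulf_eq0 (gt_eqF Wkl) subr_eq0 => /eqP.
have clo : fingraph.closed e [pred k | v 0 k == v 0 i].
  apply: intro_closed; first by apply: sym_connect_sym => k l; rewrite (mixing_undirected We).
  by move=> k l ekl; rewrite !inE => /eqP vk; rewrite (spread k l).
apply/rowP => k; rewrite mxE; apply/eqP.
have := closed_connect clo (mixing_connected We i k).
by rewrite !inE eqxx => <-.
Qed.

Lemma mixing_eigen_const (v : 'rV[R]_n) (x : R) :
  v *m W = x *: v -> 1 <= x -> exists c, v = const_mx c.
Proof.
move=> vW x1; case: (posnP n) => [n0|n0].
  by exists 0; apply/rowP => k; have := ltn_ord k; rewrite {2}n0.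
have max (u : 'rV[R]_n) : exists i, forall j, u 0 j <= u 0 i.
  by case: (@Order.TotalTheory.arg_maxP _ _ _ (Ordinal n0) xpredT (fun j => u 0 j) isT)
     => i _ ui; exists i => j; exact: ui.
have [i vi] := max v; have [vi0|vi0] := leP 0 (v 0 i).
  by exists (v 0 i); exact: mixing_eigen_max vW x1 vi0 vi.
have [j vj] := max (- v).
have vj0 : 0 <= (- v) 0 j by rewrite mxE oppr_ge0 (le_trans (vi j)) ?ltW.
exists (v 0 j); rewrite -[v]opprK (@mixing_eigen_max (- v) x j) //.
  by apply/rowP => k; rewrite !mxE.
by rewrite mulNmx vW scalerN.
Qed.

Lemma mixing_eigen_le1 (x : R) : eigenvalue W x -> x <= 1.
Proof.
move=> /eigenvalueP[v vW v0]; rewrite leNgt; apply/negP => x1.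
have [c vc] := mixing_eigen_const vW (ltW x1); move: vW v0; rewrite vc => vW.
case: (eqVneq c 0) => [->|c0].
  by move=> /eqP[]; apply/rowP => j; rewrite !mxE.
case: (posnP n) => [n0|n0 _].
  by move/eqP; case; apply/rowP => k; have := ltn_ord k; rewrite {2}n0.
have /rowP/(_ (Ordinal n0)) := vW; rewrite !mxE.
under eq_bigr do rewrite mxE mixing_symE.
rewrite -mulr_sumr mixing_row_sum mulrC => /(mulIf c0) x1'.
by rewrite -x1' ltxx in x1.
Qed.

Lemma mixing_eigen_ge0 (x : R) : eigenvalue W x -> 0 <= x.
Proof.
move=> /eigenvalueP[v vW v0].
have := mixing_psd We v^T; rewrite trmxK vW -scalemxAl mxE.
have vv : 0 < (v *m v^T) 0 0.
  rewrite lt_neqAle; apply/andP; split.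
    apply: contra v0 => /eqP vv.
    rewrite -trmx_eq0 (@mdot_eq0 _ _ _ v^T)// /mdot trmxK /mxtrace.
    by rewrite big_ord1 -vv.
  rewrite mxE; apply: sumr_ge0 => j _; by rewrite mxE -expr2 sqr_ge0.
by rewrite pmulr_lge0.
Qed.

Section Spectrum.
Variable lam : seq R.
Hypotheses (lamW : ordered_spectrum W lam) (n2 : (2 <= n)%N).

Lemma spectrum_root x : (x \in lam) = eigenvalue W x.
Proof.
by rewrite eigenvalue_root_char (proj2 lamW) root_prod_XsubC.
Qed.

Lemma size_spectrum : size lam = n.
Proof.
have := size_char_poly W; rewrite (proj2 lamW) size_prod_XsubC => -[].
by [].
Qed.

Lemma lambda2_mem : lam`_1 \in lam.
Proof. by rewrite mem_nth ?size_spectrum. Qed.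

Lemma lambda2_ge0 : 0 <= lam`_1.
Proof. by apply: mixing_eigen_ge0; rewrite -spectrum_root lambda2_mem. Qed.

(** Two orthogonal unit eigenvectors for the eigenvalue 1 cannot both be
    constant, so the eigenvalue 1 is simple. *)
Lemma lambda2_lt1 : lam`_1 < 1.
Proof.
rewrite ltNge; apply/negP => l1.
have lam1 x : x \in lam -> 1 <= x -> x = 1.
  by rewrite spectrum_root => /mixing_eigen_le1 x1 x1'; apply/eqP; rewrite eq_le x1.
have [U [d [UU Wd]]] := symmetric_unitary_diag (mixing_symmetric We).
have UU' : U^*t *m U = 1%:M by apply: mulmx1C.
have pd : perm_eq lam [seq d 0 i | i <- enum 'I_n].
  apply: prod_XsubC_eq; rewrite -(proj2 lamW).
  apply: (map_poly_inj toC); rewrite map_char_poly Wd /char_poly.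
  have -> : char_poly_mx (U^*t *m diag_mx (map_mx toC d) *m U) =
      map_mx polyC U^*t *m char_poly_mx (diag_mx (map_mx toC d)) *m map_mx polyC U.
    rewrite /char_poly_mx !map_mxM mulmxBr mulmxBl; congr (_ - _).
    by rewrite scalar_mxC -mulmxA -map_mxM UU' map_mx1 mulmx1.
  rewrite !det_mulmx mulrAC -det_mulmx -map_mxM UU' map_mx1 det1 mul1r.
  have := char_poly_trig (diag_mx_is_trig (map_mx toC d)).
  rewrite /char_poly => ->.
  rewrite big_map rmorph_prod big_enum /=; apply: eq_bigr => i _.
  by rewrite map_polyXsubC !mxE eqxx.
have eigU i : d 0 i = 1 -> exists c : R[i], row i U = c *: const_mx 1.
  move=> di; have : (row i U <= kermx (map_mx toC (W - 1%:M)))%MS.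
    apply/sub_kermxP; rewrite map_mxB map_mx1 mulmxBr mulmx1 -row_mul Wd !mulmxA UU mul1mx.
    apply/rowP => j; rewrite !mxE (bigD1 i) //= big1 ?addr0 => [|k ki]; last first.
      by rewrite !mxE eq_sym (negPf ki) mulr0n mul0r.
    by rewrite !mxE eqxx mulr1n di rmorph1 mul1r subrr.
  rewrite -map_kermx => /submx_trans; move/(_ _ (map_mx toC (const_mx 1 : 'rV_n))).
  rewrite map_submx => h; have : (row i U <= map_mx toC (const_mx 1 : 'rV_n))%MS.
    apply: h; apply/row_subP => k.
    have : row k (kermx (W - 1%:M)) *m (W - 1%:M) = 0.
      by rewrite -row_mul mulmx_ker row0.
    rewrite mulmxBr mulmx1 => /eqP; rewrite subr_eq0 => /eqP kW.
    have [||c ->] := @mixing_eigen_const (row k (kermx (W - 1%:M))) 1 => //.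
      by rewrite kW scale1r.
    by apply/sub_rVP; exists c; apply/rowP => j; rewrite !mxE mulr1.
  by move=> /sub_rVP[c ->]; exists c; rewrite map_const_mx rmorph1.
have cnt : (1 < count (pred1 1%R) lam)%N.
  have sz := size_spectrum; case: lam l1 lam1 sz (proj1 lamW) n2 => [|a [|b s]] //=.
  - by move=> _ _ <-.
  - by move=> _ _ <-.
  move=> b1 lam1 _ /andP[ba _] _.
  have -> : a = 1 by rewrite (lam1 a) ?inE ?eqxx// (le_trans b1).
  by have -> : b = 1 by [rewrite (lam1 b) ?inE ?eqxx ?orbT]; rewrite eqxx.
move: cnt; rewrite (permP pd) count_map -size_filter.
set s := seq.filter _ _.
have us : uniq s by rewrite filter_uniq ?enum_uniq.
have sd i : i \in s -> d 0 i = 1 by rewrite mem_filter => /andP[/eqP].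
case: s us sd => [|i [|j s]] //= /andP[ijs _] sd _.
have ij : i != j by apply: contra ijs => /eqP ->; rewrite inE eqxx.
have [c Uc] := eigU i (sd i (mem_head _ _)).
have [c' Uc'] : exists c', row j U = c' *: const_mx 1.
  by apply: eigU; apply: sd; rewrite !inE eqxx orbT.
have n0 : (n%:R : R[i]) != 0 by rewrite pnatr_eq0 -lt0n ltnW.
have rowUU k l a b : row k U = a *: const_mx 1 -> row l U = b *: const_mx 1 ->
    (k == l)%:R = a * b^* * n%:R.
  move=> Uk Ul; have /matrixP/(_ k l) := UU; rewrite !mxE => <-.
  have Ua x : U k x = a by have /rowP/(_ x) := Uk; rewrite !mxE mulr1.
  have Ub x : U l x = b by have /rowP/(_ x) := Ul; rewrite !mxE mulr1.
  under eq_bigr do rewrite !mxE Ua Ub.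
  by rewrite sumr_const card_ord mulr_natr.
have := rowUU i j c c' Uc Uc'; rewrite (negPf ij) => /esym/eqP.
rewrite !mulf_eq0 (negPf n0) orbF conjC_eq0 => /orP[] /eqP c0.
  by have /eqP := rowUU i i c c Uc Uc; rewrite eqxx c0 !mul0r oner_eq0.
by have /eqP := rowUU j j c' c' Uc' Uc'; rewrite eqxx c0 !mul0r oner_eq0.
Qed.

Lemma mixing_quad_le m (M : 'M[R]_(n, m)) : mdot M (W *m M) <= mdot M M.
Proof.
rewrite -[leRHS]mul1r; apply: rayleigh_le (mixing_symmetric We) _.
exact: mixing_eigen_le1.
Qed.

Lemma mixing_quad_ge0 m (M : 'M[R]_(n, m)) : 0 <= mdot M (W *m M).
Proof.
rewrite -oppr_le0 -mdotNr -mulNmx -(mul0r (mdot M M)).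
apply: rayleigh_le => [|x]; first by rewrite linearN /= (mixing_symmetric We).
move=> /eigenvalueP[v vW v0]; rewrite -oppr_ge0; apply: mixing_eigen_ge0.
by apply/eigenvalueP; exists v; rewrite // -[W]opprK mulmxN vW scaleNr.
Qed.

Let n0 : (n%:R : R) != 0. Proof. by rewrite pnatr_eq0 -lt0n ltnW. Qed.

Lemma mixing_avg : W *m avg R n = avg R n.
Proof.
apply/matrixP => i j; rewrite !mxE; under eq_bigr do rewrite mxE.
by rewrite -mulr_suml mixing_row_sum mul1r.
Qed.

Lemma avg_mixing : avg R n *m W = avg R n.
Proof.
by rewrite -[W](mixing_symmetric We) -{1}[avg _ _]avg_sym -trmx_mul mixing_avg avg_sym.
Qed.

(** Subtracting the averaging projector moves the eigenvalue 1 to 0 and keeps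
    the others, all at most the second one. *)
Lemma mixing_gap m (M : 'M[R]_(n, m)) :
  (1 - lam`_1) * mdot (cen R n *m M) (cen R n *m M) <= mdot M (M - W *m M).
Proof.
have cW : cen R n *m (1%:M - W) = 1%:M - W.
  rewrite mulmxBr mulmx1 /cen mulmxBl mul1mx avg_mixing.
  by rewrite opprB addrA subrK.
have Wc : (1%:M - W) *m cen R n = 1%:M - W.
  rewrite mulmxBl mul1mx /cen mulmxBr mulmx1 mixing_avg.
  by rewrite opprB addrA subrK.
set M' := cen R n *m M.
have -> : mdot M (M - W *m M) = mdot M' (M' - W *m M').
  have -> (K : 'M[R]_(n, m)) : K - W *m K = (1%:M - W) *m K by rewrite mulmxBl mul1mx.
  have -> (K : 'M[R]_(n, m)) : K - W *m K = (1%:M - W) *m K by rewrite mulmxBl mul1mx.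
  by rewrite mdot_sym ?cen_sym// !mulmxA cW Wc.
have aM' : avg R n *m M' = 0.
  by rewrite mulmxA /cen mulmxBr mulmx1 avg_idem ?subrr ?mul0mx // ltnW.
rewrite mdotDr mdotNr mulrBl mul1r lerD2l lerN2.
have -> : W *m M' = (W - avg R n) *m M' by rewrite mulmxBl aM' subr0.
apply: rayleigh_le => [|x]; first by rewrite linearB /= (mixing_symmetric We) avg_sym.
move=> /eigenvalueP[v vW v0].
have [->|x0] := eqVneq x 0; first exact: lambda2_ge0.
have va : v *m avg R n = 0.
  have := congr1 (fun K => K *m avg R n) vW.
  rewrite -mulmxA mulmxBl mixing_avg avg_idem ?(ltnW n2)// subrr mulmx0 -scalemxAl.
  by move=> /esym/eqP; rewrite scaler_eq0 (negPf x0) => /eqP.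
have {}vW : v *m W = x *: v by rewrite -vW mulmxBr va subr0.
have xlam : x \in lam by rewrite spectrum_root; apply/eigenvalueP; exists v.
have x1 : x < 1.
  rewrite lt_neqAle mixing_eigen_le1 ?andbT -?spectrum_root//.
  apply: contra v0 => /eqP x1.
  have [|c vc] := @mixing_eigen_const v x vW; first by rewrite x1.
  move: va; rewrite vc => /rowP/(_ (Ordinal (ltnW n2))).
  rewrite !mxE; under eq_bigr do rewrite !mxE.
  rewrite sumr_const card_ord -(mulr_natr (_ * _)) -mulrA mulVf// mulr1 => ->.
  by apply/eqP/rowP => k; rewrite !mxE.
have x1lam : 1 \in lam.
  rewrite spectrum_root; apply/eigenvalueP; exists (const_mx 1).
    apply/rowP => k; rewrite !mxE mulr1 -[RHS](mixing_row_sum k).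
    by apply: eq_bigr => j _; rewrite mxE mul1r mixing_symE.
  by apply/eqP => /rowP/(_ (Ordinal (ltnW n2)))/eqP; rewrite !mxE oner_eq0.
case: lam (proj1 lamW) xlam x1lam => [|a [|b s]] //=.
  by rewrite !inE => _ /eqP xa /eqP ax; move: x1; rewrite xa -ax ltxx.
move=> /andP[ba sb]; rewrite !inE => /orP[/eqP xa|/orP[/eqP-> //|xs]]; last first.
  move=> _; have := sb; rewrite (path_sortedE (rev_trans le_trans)).
  by move=> /andP[/allP/(_ _ xs)].
move=> h; apply: le_trans (ltW x1) _.
case/orP: h => [/eqP a1|/orP[/eqP-> //|xs]].
  by move: x1; rewrite xa -a1 ltxx.
by have := sb; rewrite (path_sortedE (rev_trans le_trans)) => /andP[/allP/(_ _ xs)].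
Qed.

End Spectrum.
End Gap.

(** * The gossip operator *)

(** What the analysis needs from B = (gamma / 2) (I - W): its eigenvalues are 0 on
    the constants and lie between b and g elsewhere. *)
Record gossip (R : realType) n (g b : R) (B : 'M[R]_n) : Prop := Gossip {
  gossip_sym : B^T = B;
  gossip_avg : B *m avg R n = 0;
  gossip_sqr_le : forall p (M : 'M[R]_(n, p)),
    mdot (B *m M) (B *m M) <= g * mdot M (B *m M);
  gossip_le : forall p (M : 'M[R]_(n, p)), mdot M (B *m M) <= g * mdot M M;
  gossip_gap : forall p (M : 'M[R]_(n, p)),
    b * mdot (cen R n *m M) (cen R n *m M) <= mdot M (B *m M) }.

Section MixingGossip.
Variable R : realType.
Context {n : nat} {e : rel 'I_n} {W : 'M[R]_n} {lam : seq R} (g : R).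
Hypotheses (We : mixing_matrix e W) (lamW : ordered_spectrum W lam).
Hypotheses (n2 : (2 <= n)%N) (g0 : 0 < g).

(** From 0 <= W <= I, both A and I - A are nonnegative for A = I - W, hence so is
    A (I - A) = A (I - A) A + (I - A) A (I - A). *)
Lemma mixing_gossip : gossip g (g * (1 - lam`_1)) (g *: (1%:M - W)).
Proof.
have AE p (M : 'M[R]_(n, p)) : (1%:M - W) *m M = M - W *m M.
  by rewrite mulmxBl mul1mx.
have sA : (1%:M - W)^T = 1%:M - W by rewrite linearB /= trmx1 (mixing_symmetric We).
split.
- by rewrite linearZ /= sA.
- by rewrite -scalemxAl AE (mixing_avg We) subrr scaler0.
- move=> p M; rewrite -!scalemxAl !mdot_lin mulrA mulrA ler_pM2l ?mulr_gt0//.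
  set AM := (1%:M - W) *m M.
  have h1 := mixing_quad_ge0 We (AM).
  have h2 := mixing_quad_le We (M - AM).
  have sAM : mdot M ((1%:M - W) *m AM) = mdot AM AM by rewrite -mdot_sym.
  have AAM : mdot AM ((1%:M - W) *m M) = mdot AM AM by [].
  have h3 : 0 <= mdot (M - AM) ((1%:M - W) *m (M - AM)).
    by rewrite AE mdotDr mdotNr subr_ge0.
  move: h1; have -> : W *m AM = AM - (1%:M - W) *m AM by rewrite AE subKr.
  rewrite mdotDr mdotNr; move: h3; rewrite mulmxBr -/AM !mdot_lin sAM; lra.
- move=> p M; rewrite -scalemxAl mdotZr ler_pM2l// AE mdotDr mdotNr.
  by rewrite gerBl (mixing_quad_ge0 We).
- move=> p M; rewrite -scalemxAl mdotZr -mulrA ler_pM2l// AE.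
  exact: (mixing_gap We lamW n2).
Qed.

End MixingGossip.

Section GossipTheory.
Context {R : realType} {n : nat} {g b : R} {B : 'M[R]_n}.
Hypotheses (Bg : gossip g b B) (b0 : 0 < b) (n0 : (0 < n)%N).
Implicit Types p : nat.

Lemma avg_gossip : avg R n *m B = 0.
Proof.
by rewrite -[B](gossip_sym Bg) -[avg _ _]avg_sym -trmx_mul (gossip_avg Bg) trmx0.
Qed.

Lemma gossip_cen : B *m cen R n = B.
Proof. by rewrite mulmxBr mulmx1 (gossip_avg Bg) subr0. Qed.

Lemma cen_gossip : cen R n *m B = B.
Proof. by rewrite mulmxBl mul1mx avg_gossip subr0. Qed.

Lemma cen_gossipM p (M : 'M[R]_(n, p)) : cen R n *m (B *m M) = B *m M.
Proof. by rewrite mulmxA cen_gossip. Qed.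

Lemma gossip_cenM p (M : 'M[R]_(n, p)) : B *m (cen R n *m M) = B *m M.
Proof. by rewrite mulmxA gossip_cen. Qed.

Lemma mdot_gossip p (M N : 'M[R]_(n, p)) : mdot (B *m M) N = mdot M (B *m N).
Proof. by rewrite mdot_sym// (gossip_sym Bg). Qed.

Lemma gossip_ge0 p (M : 'M[R]_(n, p)) : 0 <= mdot M (B *m M).
Proof.
by apply: le_trans (gossip_gap Bg M); rewrite mulr_ge0 ?mdot_ge0 ?ltW.
Qed.

(** Cauchy-Schwarz gives <M, B M>^2 <= |Pi M|^2 |B M|^2, and the gap bounds
    |Pi M|^2 by <M, B M> / b. *)
Lemma gossip_sqr_ge p (M : 'M[R]_(n, p)) :
  b * mdot M (B *m M) <= mdot (B *m M) (B *m M).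
Proof.
have := mdot_young (cen R n *m M) (B *m M) b0.
rewrite mdot_sym ?cen_sym// cen_gossipM => h.
have h2 := gossip_gap Bg M.
rewrite -(ler_pM2l (_ : 0 < b^-1)) ?invr_gt0//.
rewrite mulrA mulVf ?gt_eqF// mul1r; lra.
Qed.

(** On the range of the gossip operator, the pseudo-inverse is the inverse of the
    positive definite matrix that acts as the identity on constants. *)
Definition gossip_pinv : 'M[R]_n := invmx (B + avg R n).

Lemma gossip_unit : B + avg R n \in unitmx.
Proof.
rewrite -row_free_unit -kermx_eq0; apply/eqP/row_matrixP => i.
rewrite row0; set v := row i _.
have vB : (B + avg R n) *m v^T = 0.
  have : v *m (B + avg R n) = 0 by rewrite -row_mul mulmx_ker row0.
  move/(congr1 trmx); rewrite trmx_mul trmx0 linearD /= (gossip_sym Bg).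
  by rewrite avg_sym.
have av : avg R n *m v^T = 0.
  have := congr1 (mulmx (avg R n)) vB.
  by rewrite mulmxDl mulmxDr !mulmxA avg_gossip mul0mx add0r avg_idem// mulmx0.
have Bv : B *m v^T = 0 by move: vB; rewrite mulmxDl av addr0.
apply: trmx_inj; rewrite trmx0; apply: mdot_eq0.
rewrite (mdot_pythagoras n0) av mdot0r add0r; apply/eqP.
rewrite eq_le mdot_ge0 andbT.
have := gossip_gap Bg v^T; rewrite Bv mdot0r.
by rewrite pmulr_rle0.
Qed.

Lemma gossip_pinv_avg : gossip_pinv *m avg R n = avg R n.
Proof.
have -> : avg R n = (B + avg R n) *m avg R n.
  by rewrite mulmxDl (gossip_avg Bg) avg_idem// add0r.
by rewrite mulmxA mulVmx ?gossip_unit// mul1mx mulmxDl (gossip_avg Bg) avg_idem// add0r.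
Qed.

Lemma gossip_pinvK : gossip_pinv *m B = cen R n.
Proof.
by rewrite -[B](addrK (avg R n)) mulmxBr mulVmx ?gossip_unit// gossip_pinv_avg.
Qed.

Lemma gossipK : B *m gossip_pinv = cen R n.
Proof.
have sN : gossip_pinv^T = gossip_pinv.
  by rewrite /gossip_pinv trmx_inv linearD /= (gossip_sym Bg) avg_sym.
by rewrite -[LHS]trmxK trmx_mul sN (gossip_sym Bg) gossip_pinvK cen_sym.
Qed.

(** With v = pinv M, the left-hand side is <v, B v> and M = B v, so this is
    b <v, B v> <= |B v|^2. *)
Lemma gossip_pinv_le p (M : 'M[R]_(n, p)) : avg R n *m M = 0 ->
  mdot (gossip_pinv *m M) (B *m (gossip_pinv *m M)) <= b^-1 * mdot M M.
Proof.
move=> aM; have BM : B *m (gossip_pinv *m M) = M.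
  by rewrite mulmxA gossipK mulmxBl mul1mx aM subr0.
have := gossip_sqr_ge (gossip_pinv *m M); rewrite BM => h.
by rewrite -(ler_pM2l b0) mulrA mulfV ?gt_eqF// mul1r.
Qed.

End GossipTheory.

(** * Elementary inequalities *)

Section Young.
Variable R : realType.

Lemma mdot_sum_le m n (c : R) (A B : 'M[R]_(m, n)) : 0 < c ->
  mdot (A + B) (A + B) <= (1 + c) * mdot A A + (1 + c^-1) * mdot B B.
Proof.
move=> c0; have := mdot_young A B c0; rewrite !mdot_lin (mdotC B A); lra.
Qed.

Lemma mdot_sum_le2 m n (A B : 'M[R]_(m, n)) :
  mdot (A + B) (A + B) <= 2 * mdot A A + 2 * mdot B B.
Proof. by have := mdot_sum_le A B ltr01; rewrite invr1; lra. Qed.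

Lemma mdot_sqrB m n (A B : 'M[R]_(m, n)) :
  mdot (A - B) (A - B) = mdot A A - 2 * mdot B A + mdot B B.
Proof. by rewrite !mdot_lin (mdotC A B); ring. Qed.

Lemma mdot_sqrD m n (A B : 'M[R]_(m, n)) :
  mdot (A + B) (A + B) = mdot A A + 2 * mdot B A + mdot B B.
Proof. by rewrite !mdot_lin (mdotC A B); ring. Qed.

Lemma mdot_cen_le n p (M : 'M[R]_(n, p)) : (0 < n)%N ->
  mdot (cen R n *m M) (cen R n *m M) <= mdot M M.
Proof.
move=> n0; rewrite [leRHS](mdot_pythagoras n0).
by rewrite lerDr mdot_ge0.
Qed.

(** Combining the contraction 1 - b/8 of the noisy step with the factors 1 + b/16
    of the drift of the fixed point and b/50 of the gradient term. *)
Lemma descent_arith (b V F A S X V1 dr : R) :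
  0 < b -> b <= 1 / 16 -> 0 <= V -> 0 <= A -> 0 <= S -> F <= A + b / 50 * V ->
  V1 <= (1 + b / 16) * ((1 - b / 8) * V + F + 2 * S + X) + dr ->
  V1 <= (1 - b / 64) * V + 2 * A + 4 * S + dr + (1 + b / 16) * X.
Proof.
move=> b0 b1 V0 A0 S0 FA V1le; have bV := mulr_ge0 (ltW b0) V0.
have bbV : 0 <= b * (b * V) by rewrite mulr_ge0// ltW.
have b16 : 0 <= 1 + b / 16 by lra.
have k2 := ler_wpM2l b16 FA.
have k3 : b * A <= 1 / 16 * A by rewrite ler_wpM2r.
have k4 : b * (b * V) <= 1 / 16 * (b * V) by rewrite ler_wpM2r.
have k5 : b * S <= 1 / 16 * S by rewrite ler_wpM2r.
move: V1le k2 k3 k4 k5 bV bbV A0 S0; rewrite !mulrDr !mulrDl.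
lra.
Qed.

End Young.

(** * One step of the Lyapunov function *)

Section Lyapunov.
Context {R : realType} {n p : nat} (g b al C om : R) (B : 'M[R]_n).
Local Notation mx := ('M[R]_(n, p)).

(** B q is the deviation of D from its value at the fixed point, so that <q, B q>
    is the squared size of this deviation in the norm of the inverse of B. *)
Definition lyapunov (e q w : mx) : R :=
  mdot (cen R n *m e) (cen R n *m e) + mdot q (B *m q) + om * mdot w w.

(** The values of y and of u = y - H without the gradient noise. *)
Definition y_mean (eta : R) (e q ft : mx) : mx := e - B *m q - eta *: ft.
Definition u_mean (eta : R) (w q ft : mx) : mx := w - B *m q - eta *: ft.

(** The linear part of the next Lyapunov value in the compression noise T. *)
Definition cross_T (y q u : mx) : mx :=
  2 *: (B *m (q + y) - B *m (cen R n *m y - B *m y)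
        - om *: (al *: ((1 - al) *: u - B *m y)
                 + B *m ((1 - al) *: u - B *m y))).

(** The linear part of the next Lyapunov value in the gradient noise S. *)
Definition cross_S (eta : R) (e q w ft : mx) : mx :=
  eta *: (B *m y_mean eta e q ft
     - 2 *: (cen R n *m (cen R n *m y_mean eta e q ft + B *m q))
     - (om * (1 - al / 4) * 2) *: u_mean eta w q ft).

(** A bound for the quadratic part in T. *)
Definition coef_T : R := g ^+ 2 + g + om * (al + g) ^+ 2.

Hypotheses (Bg : gossip g b B) (n0 : (0 < n)%N).
Hypotheses (b0 : 0 < b) (bg : b <= g) (al0 : 0 < al) (al4 : al <= 1 / 4).
Hypotheses (C0 : 0 < C) (gal : g <= al / 4) (alC : al * C <= 1 / 4).
Hypotheses (gC : g * C <= al ^+ 2 / 400) (omE : om * al = 8 * g * C).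

Let g0 : 0 < g. Proof. exact: lt_le_trans b0 bg. Qed.
Let g16 : g <= 1 / 16. Proof. by move: gal al4; lra. Qed.
Let om0 : 0 < om.
Proof. by rewrite -(pmulr_lgt0 _ al0) omE !mulr_gt0. Qed.
Let om_le : om <= al * (8 / 400).
Proof.
by rewrite -(ler_pM2r al0) omE; move: gC; rewrite expr2; lra.
Qed.

(** Expansion in the compression noise. The expectation of |T|^2 is at most
    C |u|^2, so the quadratic part costs at most coef_T C |u|^2 in expectation;
    the choice of om makes this smaller than the decrease, of order om al |u|^2,
    that the update of H brings. *)
Lemma lyapunov_T (y q u T : mx) :
  lyapunov (y - B *m (y + T)) (q + y + T) ((1 - al) *: u - B *m y - (al *: T + B *m T)) <=
  mdot (cen R n *m y + B *m q) (cen R n *m y + B *m q) - mdot (B *m q) (B *m q)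
  + mdot q (B *m q) - 1 / 2 * mdot y (B *m y) + om * (1 - al / 4) * mdot u u
  + coef_T * (mdot T T - C * mdot u u) + mdot T (cross_T y q u).
Proof.
have By2 := gossip_sqr_le Bg y; have By0 := gossip_ge0 Bg b0 y.
have BT2 := gossip_sqr_le Bg T; have BT1 := gossip_le Bg T.
have uu := mdot_ge0 u.
pose P := cen R n *m y - B *m y.
have E1 : mdot (cen R n *m (y - B *m (y + T))) (cen R n *m (y - B *m (y + T))) =
   mdot P P - 2 * mdot T (B *m P) + mdot (B *m T) (B *m T).
  rewrite mulmxBr (cen_gossipM Bg) mulmxDr opprD addrA -/P mdot_sqrB.
  by rewrite (mdot_gossip Bg).
have E2 : mdot (q + y + T) (B *m (q + y + T)) =
   mdot (q + y) (B *m (q + y)) + 2 * mdot T (B *m (q + y)) + mdot T (B *m T).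
  rewrite mulmxDr mdotDl !(mdotDr _ (B *m (q + y))) -(mdot_gossip Bg _ T).
  by rewrite (mdotC (B *m _) T); ring.
have E3 (k : 'M[R]_(n, p)) : mdot (k - (al *: T + B *m T)) (k - (al *: T + B *m T)) =
  mdot k k - 2 * mdot T (al *: k + B *m k)
   + (al ^+ 2 * mdot T T + 2 * al * mdot T (B *m T) + mdot (B *m T) (B *m T)).
  rewrite mdot_sqrB !mdot_lin (mdot_gossip Bg T k) (mdotC (B *m T) T).
  by ring.
pose k := (1 - al) *: u - B *m y.
have E4 : mdot P P + mdot (q + y) (B *m (q + y)) =
   mdot (cen R n *m y + B *m q) (cen R n *m y + B *m q) - mdot (B *m q) (B *m q)
   + mdot q (B *m q) - mdot y (B *m y) + mdot (B *m y) (B *m y).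
  have c1 (M : mx) : mdot (cen R n *m y) (B *m M) = mdot y (B *m M).
    by rewrite mdot_sym ?cen_sym// (cen_gossipM Bg).
  rewrite mdot_sqrB mdot_sqrD mulmxDr !mdot_lin.
  rewrite -(mdot_gossip Bg q y) !(mdotC (B *m _) (cen R n *m y)) !c1.
  by rewrite (mdotC (B *m q) y); ring.
have E5 : mdot k k <= (1 - al) * mdot u u + (5 * g / (4 * al)) * mdot y (B *m y).
  have := mdot_sum_le ((1 - al) *: u) (- (B *m y)) al0.
  rewrite -/k !mdot_lin opprK => /le_trans; apply.
  apply: lerD.
    rewrite !mulrA ler_wpM2r//.
    have al1 : 0 <= 1 - al by move: al4; lra.
    by have := mulr_ge0 (sqr_ge0 al) al1; rewrite expr2; lra.
  apply: (@le_trans _ _ ((1 + al^-1) * (g * mdot y (B *m y)))).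
    by rewrite ler_pM2l// addr_gt0 ?invr_gt0.
  rewrite mulrA ler_wpM2r// (_ : 5 * g / (4 * al) = 5 / 4 * g * al^-1); last first.
    by field; rewrite gt_eqF.
  have a4 : 1 <= al^-1 / 4.
    by rewrite -(ler_pM2l al0) mulr1 mulrA mulfV ?gt_eqF// ; move: al4; lra.
  by have := ler_wpM2l (ltW g0) a4; move: a4; lra.
rewrite /lyapunov E1 E2 -/k E3 /cross_T -/P.
have -> : mdot T (2 *: (B *m (q + y) - B *m P - om *: (al *: k + B *m k))) =
  2 * (mdot T (B *m (q + y)) - mdot T (B *m P) - om * (mdot T (al *: k + B *m k))).
  by rewrite !mdot_lin.
move: E4 E5; set BT := mdot T (B *m T) in BT1 BT2 *.
set bt2 := mdot (B *m T) _ in BT1 BT2 *.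
set TT := mdot T T in BT1 *.
set Y := mdot y (B *m y) in By2 By0 *.
set By := mdot (B *m y) _ in By2 *.
set kk := mdot k k; set U := mdot u u in uu *.
move=> E4 E5.
have TT0 : 0 <= TT := mdot_ge0 T.
have q1 : bt2 + BT + om * (al ^+ 2 * TT + 2 * al * BT + bt2) <= coef_T * TT.
  have bt : bt2 <= g ^+ 2 * TT by apply: le_trans BT2 _; rewrite expr2 -mulrA ler_pM2l.
  have : om * (al ^+ 2 * TT + 2 * al * BT + bt2) <= om * ((al + g) ^+ 2 * TT).
    by rewrite ler_pM2l//; have := ler_wpM2l (ltW al0) BT1; move: bt; lra.
  by rewrite /coef_T; lra.
have q2 : coef_T * C <= om * al * (3 / 4 - 1 / 10).
  have h1 : (g ^+ 2 + g) * C <= om * al * (1 / 8 + 1 / 128).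
    by rewrite omE; have := mulr_gt0 g0 C0; move: g16 g0; nra.
  have h2 : (al + g) ^+ 2 * C <= al * (25 / 64).
    have : (al + g) ^+ 2 <= al ^+ 2 * (25 / 16) by move: gal g0 al0; nra.
    by move=> /(ler_wpM2r (ltW C0))/le_trans; apply; move: alC al0; nra.
  have := ler_wpM2l (ltW om0) h2; rewrite /coef_T; move: om0 al0 (mulr_gt0 om0 al0); lra.
have q3 : om * (5 * g / (4 * al)) <= 1 / 8.
  have : om / al <= 8 / 400.
    by rewrite ler_pdivrMr// mulrC om_le.
  rewrite invfM => h.
  have -> : om * (5 * g * (4^-1 / al)) = (om / al) * (5 * g / 4) by ring.
  by move: h g16 g0 (divr_gt0 om0 al0); nra.
have q4 : om * kk <= om * (1 - al) * U + 1 / 8 * Y.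
  have := ler_wpM2l (ltW om0) E5; have := ler_wpM2r By0 q3; rewrite mulrDr !mulrA.
  by lra.
have q5 := ler_wpM2r uu q2.
have q6 : By <= 1 / 16 * Y by apply: le_trans By2 _; rewrite ler_wpM2r.
have := mulr_ge0 (ltW (mulr_gt0 om0 al0)) uu.
lra.
Qed.

(** Without noise, B q cancels in Pi y + B q = Pi (e - eta ft), so the primal
    error is not affected by the dual one, while the dual error loses |B q|^2,
    which is at least b <q, B q>. The loss <y, B y> / 2 provides the contraction
    of Pi e through the gap. *)
Lemma lyapunov_S (eta : R) (e q w ft S y u : mx) :
  y = y_mean eta e q ft - eta *: S -> u = u_mean eta w q ft - eta *: S ->
  mdot (cen R n *m y + B *m q) (cen R n *m y + B *m q) - mdot (B *m q) (B *m q)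
  + mdot q (B *m q) - 1 / 2 * mdot y (B *m y) + om * (1 - al / 4) * mdot u u <=
  (1 - b / 8) * lyapunov e q w + 10 / b * (eta ^+ 2 * mdot ft ft)
  + 2 * (eta ^+ 2 * mdot S S) + mdot S (cross_S eta e q w ft).
Proof.
move=> yE uE; pose y' := y_mean eta e q ft; pose u' := u_mean eta w q ft.
pose d := B *m q; pose X := cen R n *m y' + d.
have al4' : 0 <= 1 - al / 4 by move: al4; lra.
have om1 : om <= 1 by move: om_le al4; lra.
have E1 : mdot (cen R n *m y + d) (cen R n *m y + d) <=
    mdot X X - 2 * eta * mdot S (cen R n *m X) + eta ^+ 2 * mdot S S.
  have -> : cen R n *m y + d = X - eta *: (cen R n *m S).
    by rewrite /X yE mulmxBr scalemxAr addrAC.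
  rewrite mdot_sqrB 2!mdotZl mdotZr mdot_sym ?cen_sym//.
  have := ler_wpM2l (sqr_ge0 eta) (mdot_cen_le S n0); rewrite expr2; lra.
have E2 : mdot y' (B *m y') - 2 * eta * mdot S (B *m y') <= mdot y (B *m y).
  have -> : mdot y (B *m y) = mdot y' (B *m y') - 2 * eta * mdot S (B *m y')
      + eta ^+ 2 * mdot S (B *m S).
    rewrite yE -/y' mulmxBr -scalemxAr; move: (y') => z.
    by rewrite !mdot_lin -(mdot_gossip Bg z S) (mdotC (B *m z) S); ring.
  by rewrite lerDl mulr_ge0 ?sqr_ge0// (gossip_ge0 Bg b0).
have E3 : mdot u u = mdot u' u' - 2 * eta * mdot S u' + eta ^+ 2 * mdot S S.
  by rewrite uE -/u' mdot_sqrB !mdotZl mdotZr; ring.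
have E4 : mdot u' u' <= (1 + al / 8) * mdot w w
    + (1 + 8 / al) * (2 * mdot d d + 2 * (eta ^+ 2 * mdot ft ft)).
  rewrite /u' /u_mean -addrA; have al8 : 0 < al / 8 by rewrite divr_gt0.
  apply: le_trans (mdot_sum_le w _ al8) _; rewrite invf_div lerD2l.
  rewrite ler_pM2l ?addr_gt0 ?divr_gt0//.
  apply: le_trans (mdot_sum_le2 _ _) _; rewrite !mdotNl !mdotNr !opprK.
  by rewrite mdotZl mdotZr /d; lra.
have E5 : mdot X X <= 2 * mdot (cen R n *m y') (cen R n *m y') + 2 * mdot d d.
  exact: mdot_sum_le2.
have E6 := gossip_gap Bg y'.
have E7 : b * mdot q d <= mdot d d := gossip_sqr_ge Bg b0 q.
have E8 : mdot X X <= (1 + b / 8) * mdot (cen R n *m e) (cen R n *m e)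
    + (1 + 8 / b) * (eta ^+ 2 * mdot ft ft).
  have -> : X = cen R n *m e - eta *: (cen R n *m ft).
    rewrite /X /y' /y_mean !mulmxBr (cen_gossipM Bg) -/d scalemxAr.
    by rewrite addrAC subrK.
  have b8 : 0 < b / 8 by rewrite divr_gt0.
  apply: le_trans (mdot_sum_le _ _ b8) _; rewrite invf_div lerD2l.
  rewrite ler_pM2l ?addr_gt0 ?divr_gt0// mdotNl mdotNr opprK mdotZl mdotZr mulrA -expr2.
  by rewrite ler_wpM2l ?sqr_ge0// mdot_cen_le.
have -> : mdot S (cross_S eta e q w ft) = eta * mdot S (B *m y')
   - 2 * eta * mdot S (cen R n *m X) - om * (1 - al / 4) * 2 * eta * mdot S u'.
  rewrite /cross_S -/y' -/u' -/d -/X mdotZr mdotDr mdotDr !mdotNr.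
  by rewrite mdotZr (mdotZr _ _ (_ * _)); ring.
rewrite /lyapunov -/d E3.
move: E1 E2 E4 E5 E6 E7 E8.
move: (mdot S (cen R n *m X)) (mdot S (B *m y')) (mdot S u') => SX SY SU.
have SS0 := mdot_ge0 S; have ff0 := mdot_ge0 ft; have ww0 := mdot_ge0 w.
have ee0 := mdot_ge0 (cen R n *m e); have XX0 := mdot_ge0 X; have dd0 := mdot_ge0 d.
have qq0 : 0 <= mdot q d := gossip_ge0 Bg b0 q.
move: (mdot S S) (mdot X X) (mdot u' u') (mdot w w) (mdot d d) (mdot q d)
  (mdot (cen R n *m e) (cen R n *m e)) (mdot (cen R n *m y') (cen R n *m y'))
  (mdot y (B *m y)) (mdot y' (B *m y')) (mdot (cen R n *m y + d) (cen R n *m y + d))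
  (mdot ft ft) SS0 ff0 ww0 ee0 XX0 dd0 qq0
  => SS XX UU ww dd qd ee yy yB y'B cyd ff SS0 ff0 ww0 ee0 XX0 dd0 qq0.
move=> E1 E2 E4 E5 E6 E7 E8.
have hf : 0 <= eta ^+ 2 * ff by rewrite mulr_ge0 ?sqr_ge0.
have hS : 0 <= eta ^+ 2 * SS by rewrite mulr_ge0 ?sqr_ge0.
move: (eta ^+ 2 * ff) (eta ^+ 2 * SS) hf hS E1 E4 E8 => F G hf hS E1 E4 E8.
have F1 : om * (1 - al / 4) * UU <= om * (1 - al / 8) * ww + 34 / 100 * (dd + F) .
  have oU := ler_wpM2l (mulr_ge0 (ltW om0) al4') E4.
  have c1 : om * (1 - al / 4) * ((1 + al / 8) * ww) <= om * (1 - al / 8) * ww.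
    rewrite mulrA ler_wpM2r// -mulrA ler_pM2l//.
    by have := sqr_ge0 al; rewrite expr2; lra.
  have c2 : om * (1 - al / 4) * (1 + 8 / al) <= 17 / 100.
    apply: (@le_trans _ _ (om * (1 + 8 / al))).
      apply: ler_wpM2r; first by rewrite addr_ge0 ?divr_ge0 ?ltW.
      by rewrite ger_pMr//; move: al0; lra.
    apply: (@le_trans _ _ (om * (17 / 2 / al))).
      have : 1 <= 1 / 2 / al by rewrite ler_pdivlMr//; move: al4; lra.
      by rewrite ler_pM2l//; lra.
    by rewrite mulrA ler_pdivrMr//; move: om_le al0; lra.
  have dF : 0 <= 2 * dd + 2 * F by lra.
  have := ler_wpM2r dF c2; rewrite -!mulrA in oU c1 *; lra.
have b16 : b <= 1 / 16 by move: bg g16; lra.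
have F2 : (1 - b / 4) * XX <= (1 - b / 8) * ee + 9 / b * F.
  have b4 : 0 <= 1 - b / 4 by move: b16; lra.
  have := ler_wpM2l b4 E8; rewrite mulrDr => /le_trans; apply; apply: lerD.
    by rewrite mulrA ler_wpM2r//; have := sqr_ge0 b; rewrite expr2; lra.
  rewrite mulrA ler_wpM2r//; apply: (@le_trans _ _ (1 + 8 / b)).
    by rewrite ler_piMl ?addr_ge0 ?divr_ge0 ?ltW//; move: b0; lra.
  by rewrite -[9]/(1 + 8 :> R) [leRHS]mulrDl lerD2r ler_pdivlMr//; move: b16; lra.
have F3 : b * XX <= 2 * (b * yy) + 2 * (b * dd).
  by have := ler_wpM2l (ltW b0) E5; lra.
have F4 : b * dd <= 1 / 16 * dd by rewrite ler_wpM2r.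
have F5 : F <= 1 / b * F.
  by rewrite ler_peMl// ler_pdivlMr//; move: b16; lra.
have F6 : om * (1 - al / 8) * ww <= (1 - b / 8) * (om * ww).
  rewrite (mulrC om) -mulrA; apply: ler_wpM2r; first by rewrite mulr_ge0 ?(ltW om0).
  by move: gal bg al0; lra.
have F7 : om * (1 - al / 4) * G <= G.
  rewrite ler_piMl//; apply: le_trans om1; rewrite ger_pMr//; move: al0; lra.
rewrite -[9]/(1 + 8 :> R) -[10]/(1 + 9 :> R) in F2 *.
move: F2; rewrite !mulrDl.
lra.
Qed.

(** The fixed point moves with the stepsize; Young's inequality with weight b/16
    leaves most of the contraction intact. *)
Lemma lyapunov_drift (delta : R) (e q w s : mx) :
  lyapunov e (q + delta *: s) w <=
  (1 + b / 16) * lyapunov e q w + 17 / b * (delta ^+ 2 * mdot s (B *m s)).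
Proof.
have ee0 := mdot_ge0 (cen R n *m e); have ww0 := mdot_ge0 w.
have qq0 := gossip_ge0 Bg b0 q; have ss0 := gossip_ge0 Bg b0 s.
have b16 : 0 < b / 16 by rewrite divr_gt0.
have := gossip_ge0 Bg b0 ((b / 16) *: q - delta *: s).
rewrite /lyapunov !mulmxBr !mulmxDr -!scalemxAr !mdot_lin.
rewrite -(mdot_gossip Bg q s) (mdotC _ s).
move: (mdot s (B *m q)) (mdot s (B *m s)) (mdot q (B *m q)) ss0 qq0.
move: (mdot w w) (mdot (cen R n *m e) (cen R n *m e)) ww0 ee0.
move=> ww ee ww0 ee0 sq ss qq ss0 qq0 h.
have oww := mulr_ge0 (ltW om0) ww0.
have h1 : 2 * delta * sq <= b / 16 * qq + (b / 16)^-1 * (delta ^+ 2 * ss).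
  rewrite -(ler_pM2l b16) mulrDr [X in _ <= _ + X]mulrA mulfV ?gt_eqF// mul1r.
  by move: h; lra.
have h2 : (b / 16)^-1 * (delta ^+ 2 * ss) + delta ^+ 2 * ss <= 17 / b * (delta ^+ 2 * ss).
  have dss : 0 <= delta ^+ 2 * ss by rewrite mulr_ge0 ?sqr_ge0.
  have : 1 <= 1 / b by rewrite ler_pdivlMr//; move: bg g16; lra.
  by move=> /(ler_wpM2r dss); rewrite invf_div; lra.
have h3 := mulr_ge0 (ltW b16) (addr_ge0 ee0 oww).
move: h1 h2 h3; lra.
Qed.

(** The factor of 1 + b / 16 on the right has a nonpositive expectation: the two
    cross terms have mean zero and that of |T|^2 is at most C |u|^2. *)
Lemma lyapunov_descent (L eta delta : R) (e q w ft S T s y u : mx) :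
  0 <= eta -> eta * L <= b / 24 -> 0 <= L ->
  mdot ft ft <= L ^+ 2 * mdot e e ->
  y = y_mean eta e q ft - eta *: S -> u = u_mean eta w q ft - eta *: S ->
  lyapunov (y - B *m (y + T)) (q + y + T + delta *: s)
    ((1 - al) *: u - B *m y - (al *: T + B *m T)) <=
  (1 - b / 64) * lyapunov e q w
  + 20 * L ^+ 2 / b * eta ^+ 2 * mdot (avg R n *m e) (avg R n *m e)
  + 4 * eta ^+ 2 * mdot S S + 17 / b * (delta ^+ 2 * mdot s (B *m s))
  + (1 + b / 16) * (coef_T * (mdot T T - C * mdot u u)
       + mdot T (cross_T y q u) + mdot S (cross_S eta e q w ft)).
Proof.
move=> eta0 etaL L0 ftL yE uE.
apply: le_trans (lyapunov_drift _ _ _ _ _) _.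
have h1 := lyapunov_T y q u T; have h2 := lyapunov_S yE uE.
have V0 : 0 <= lyapunov e q w.
  by rewrite /lyapunov !addr_ge0 ?mdot_ge0 ?(gossip_ge0 Bg b0)// mulr_ge0 ?mdot_ge0// ltW.
have b1 : b <= 1 / 16 := le_trans bg g16.
have ft1 : eta ^+ 2 * mdot ft ft <= eta ^+ 2 * L ^+ 2 * mdot (avg R n *m e) (avg R n *m e)
   + (b / 24) ^+ 2 * lyapunov e q w.
  have := ler_wpM2l (sqr_ge0 eta) ftL => /le_trans; apply.
  rewrite (mdot_pythagoras n0 e) mulrA mulrDr lerD2l -exprMn.
  apply: (@le_trans _ _ ((b / 24) ^+ 2 * mdot (cen R n *m e) (cen R n *m e))).
    by apply: ler_wpM2r; rewrite ?mdot_ge0// ler_sqr ?nnegrE ?mulr_ge0 ?divr_ge0 ?(ltW b0).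
  rewrite ler_wpM2l ?sqr_ge0// /lyapunov -addrA lerDl addr_ge0//.
    exact: (gossip_ge0 Bg b0).
  by rewrite mulr_ge0 ?mdot_ge0// ltW.
have ft2 : 10 / b * (eta ^+ 2 * mdot ft ft) <=
    10 / b * (eta ^+ 2 * L ^+ 2 * mdot (avg R n *m e) (avg R n *m e))
    + b / 50 * lyapunov e q w.
  have := ler_wpM2l (divr_ge0 (ler0n R 10) (ltW b0)) ft1 => /le_trans; apply.
  rewrite mulrDr lerD2l mulrA ler_wpM2r//.
  have -> : 10 / b * (b / 24) ^+ 2 = b * (10 / 24 ^+ 2) by field; rewrite gt_eqF.
  rewrite ler_wpM2l ?(ltW b0)// ler_pdivrMr ?exprn_gt0// mulrC ler_pdivlMr//.
  by rewrite -natrX -!natrM ler_nat.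
have A0 : 0 <= 10 / b * (eta ^+ 2 * L ^+ 2 * mdot (avg R n *m e) (avg R n *m e)).
  by rewrite mulr_ge0 ?divr_ge0 ?(ltW b0)// -exprMn mulr_ge0 ?sqr_ge0 ?mdot_ge0.
have S0 : 0 <= eta ^+ 2 * mdot S S by rewrite mulr_ge0 ?mdot_ge0 ?sqr_ge0.
have := descent_arith b0 b1 V0 A0 S0 ft2 (X := coef_T * (mdot T T - C * mdot u u)
   + mdot T (cross_T y q u) + mdot S (cross_S eta e q w ft)).
rewrite (_ : 2 * (10 / b * _) = 20 * L ^+ 2 / b * eta ^+ 2 * mdot (avg R n *m e) (avg R n *m e));
  last by field; rewrite gt_eqF.
rewrite (_ : 4 * (eta ^+ 2 * _) = 4 * eta ^+ 2 * mdot S S); last by rewrite mulrA.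
apply; rewrite lerD2r ler_wpM2l ?addr_ge0 ?divr_ge0 ?(ltW b0)//.
apply: le_trans h1 _.
have := lerD h2 (lexx (coef_T * (mdot T T - C * mdot u u) + mdot T (cross_T y q u))).
by rewrite !addrA => /le_trans; apply; rewrite -!addrA lerD2l lerD2l lerD2l [leLHS]addrC addrA.
Qed.

End Lyapunov.

(** * One step of the average *)

Section MeanStep.
Context {R : realType} {n p : nat} (n0 : (0 < n)%N).
Local Notation mx := ('M[R]_(n, p)).

(** The linear part of the next average error in the gradient noise. *)
Definition cross_mean (eta : R) (e ft : mx) : mx :=
  - (2 * eta) *: (avg R n *m (avg R n *m e - eta *: (avg R n *m ft))).

(** The gradient is split into phi, evaluated at the consensus point J x, to which
    strong convexity of the average cost applies, and the difference rho, which
    the disagreement controls. Young's inequality with weight eps mu eta keeps the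
    contraction factor arbitrarily close to 1 - 2 mu eta. *)
Lemma mean_descent (mu L eps eta : R) (e phi rho S : mx) :
  0 < mu -> 0 < eta -> 0 < eps -> eps * mu * eta <= 1 ->
  mu * mdot (avg R n *m e) (avg R n *m e) <= mdot (avg R n *m e) phi ->
  mdot phi phi <= L ^+ 2 * mdot (avg R n *m e) (avg R n *m e) ->
  mdot rho rho <= L ^+ 2 * mdot (cen R n *m e) (cen R n *m e) ->
  mdot (avg R n *m e - eta *: (avg R n *m (phi + rho)) - eta *: (avg R n *m S))
       (avg R n *m e - eta *: (avg R n *m (phi + rho)) - eta *: (avg R n *m S)) <=
  (1 - (2 - eps) * mu * eta + 2 * eta ^+ 2 * L ^+ 2)
     * mdot (avg R n *m e) (avg R n *m e)
  + 2 * eta * L ^+ 2 / (eps * mu) * mdot (cen R n *m e) (cen R n *m e)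
  + eta ^+ 2 * mdot (avg R n *m S) (avg R n *m S)
  + mdot S (cross_mean eta e (phi + rho)).
Proof.
move=> mu0 eta0 eps0 etale sc phiL rhoL.
set E := avg R n *m e in sc phiL *; set P := E - eta *: (avg R n *m (phi + rho)).
have avg_le (M : mx) : mdot (avg R n *m M) (avg R n *m M) <= mdot M M.
  by rewrite [leRHS](mdot_pythagoras n0) lerDl mdot_ge0.
rewrite /cross_mean -/E -/P mdot_sqrB !mdotZl !mdotZr (mdot_sym _ _ (avg_sym _ _)).
set ze := eps * mu * eta in etale; have ze0 : 0 < ze by rewrite !mulr_gt0.
have P2 : mdot P P <= (1 + ze) * mdot (E - eta *: (avg R n *m phi)) (E - eta *: (avg R n *m phi))
    + (1 + ze^-1) * (eta ^+ 2 * (L ^+ 2 * mdot (cen R n *m e) (cen R n *m e))).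
  have -> : P = (E - eta *: (avg R n *m phi)) + (- (eta *: (avg R n *m rho))).
    by rewrite /P mulmxDr scalerDr opprD addrA.
  apply: le_trans (mdot_sum_le _ _ ze0) _; rewrite lerD2l.
  rewrite ler_pM2l ?addr_gt0 ?invr_gt0// mdotNl mdotNr opprK mdotZl mdotZr mulrA -expr2.
  by rewrite ler_wpM2l ?sqr_ge0// (le_trans (avg_le _)).
have P1 : mdot (E - eta *: (avg R n *m phi)) (E - eta *: (avg R n *m phi)) <=
    (1 - 2 * eta * mu + eta ^+ 2 * L ^+ 2) * mdot E E.
  rewrite mdot_sqrB mdotZl mdotZl mdotZr (mdot_sym _ _ (avg_sym _ _)).
  have -> : avg R n *m E = E by rewrite /E mulmxA avg_idem.
  have := ler_wpM2l (sqr_ge0 eta) (le_trans (avg_le phi) phiL).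
  have := ler_wpM2l (ltW eta0) sc; rewrite (mdotC phi) expr2; lra.
have EE0 := mdot_ge0 E; have cc0 := mdot_ge0 (cen R n *m e).
have k1 : (1 + ze) * ((1 - 2 * eta * mu + eta ^+ 2 * L ^+ 2) * mdot E E) <=
  (1 - (2 - eps) * mu * eta + 2 * eta ^+ 2 * L ^+ 2) * mdot E E.
  rewrite mulrA ler_wpM2r//.
  have h1 : 0 <= ze * (eta * mu) by rewrite !mulr_ge0 ?ltW.
  have h2 : ze * (eta ^+ 2 * L ^+ 2) <= eta ^+ 2 * L ^+ 2.
    by rewrite ler_piMl// -exprMn sqr_ge0.
  have zeE : ze = eps * mu * eta by [].
  by move: h1 h2; generalize ze zeE => z zE h1 h2; lra.
have k2 : (1 + ze^-1) * (eta ^+ 2 * (L ^+ 2 * mdot (cen R n *m e) (cen R n *m e))) <=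
   2 * eta * L ^+ 2 / (eps * mu) * mdot (cen R n *m e) (cen R n *m e).
  have -> : 2 * eta * L ^+ 2 / (eps * mu) * mdot (cen R n *m e) (cen R n *m e)
    = (2 * ze^-1) * (eta ^+ 2 * (L ^+ 2 * mdot (cen R n *m e) (cen R n *m e))).
    by rewrite /ze; field; rewrite !gt_eqF.
  apply: ler_wpM2r; first by rewrite mulr_ge0 ?sqr_ge0// mulr_ge0 ?sqr_ge0.
  have : 1 <= ze^-1 by rewrite -[leLHS]invr1 lef_pV2 ?posrE.
  by lra.
have ze1 : 0 <= 1 + ze by rewrite addr_ge0// ltW.
have := ler_wpM2l ze1 P1; move: P2 k1 k2; lra.
Qed.

End MeanStep.

(** * Gradients of the costs *)

Section Gradients.
Context {R : realType} {p : nat}.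
Implicit Types (f : 'rV[R]_p -> R) (x v : 'rV[R]_p).

Lemma derive_minimizer f x v :
  (forall z, differentiable f z) -> is_minimizer f x -> 'D_v f x = 0.
Proof.
move=> df fx; pose h (t : R) := f (t *: v + x).
have dh t : derivable h t 1.
  apply/derivable1_diffP; apply: differentiable_comp; last exact: df.
  exact: differentiableD.
have h0 : is_derive (0 : R) 1 h 0.
  apply: (@derive1_at_min R h (-1) 1 0) => //.
  - by rewrite in_itv /= ltrN10 ltr01.
  - by move=> t _; rewrite /h scale0r add0r; exact: fx.
transitivity ('D_1 h 0); last by rewrite derive_val.
rewrite /derive; suff -> : (fun t : R => t^-1 *: ((f \o shift x) (t *: v) - f x)) =
  (fun t : R => t^-1 *: ((h \o shift 0) (t *: 1) - h 0)) by [].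
apply/funext => t; rewrite /h /= scale0r add0r addr0.
by congr (_ *: (f (_ *: _ + _) - _)); rewrite /GRing.scale /= mulr1.
Qed.

Lemma grad_minimizer f x :
  (forall z, differentiable f z) -> is_minimizer f x -> grad f x = 0.
Proof.
by move=> df fx; apply/rowP => j; rewrite !mxE derive_minimizer.
Qed.

Context {n : nat}.
Variable f : 'I_n -> 'rV[R]_p -> R.
Hypothesis df : forall i x, differentiable (f i) x.

Lemma average_costE : average_cost f = n%:R^-1 \*: (\sum_i f i).
Proof. by apply/funext => x; rewrite /average_cost /= fct_sumE. Qed.

Lemma differentiable_average x : differentiable (average_cost f) x.
Proof.
rewrite average_costE; apply: differentiableZ; exact: differentiable_sum.
Qed.

Lemma grad_average x : grad (average_cost f) x = n%:R^-1 *: \sum_i grad (f i) x.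
Proof.
apply/rowP => j; rewrite !mxE average_costE.
have dfj i : derivable (f i) x (delta_mx 0 j) by exact: diff_derivable.
rewrite deriveZ; last exact: derivable_sum.
rewrite derive_sum // summxE; congr (_ * _).
by apply: eq_bigr => i _; rewrite mxE.
Qed.

End Gradients.

Section StackedGradient.
Context {R : realType} {n p : nat}.
Local Notation mx := ('M[R]_(n, p)).

Definition ones (v : 'rV[R]_p) : mx := \matrix_(i < n) v.

Lemma row_ones v i : row i (ones v) = v.
Proof. by rewrite rowK. Qed.

Variable f : 'I_n -> 'rV[R]_p -> R.

Definition stack_grad (x : mx) : mx := \matrix_i grad (f i) (row i x).

Lemma smooth_sqr L i v w : smooth L (f i) ->
  sqnorm (grad (f i) v - grad (f i) w) <= L ^+ 2 * sqnorm (v - w).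
Proof.
move=> [_ /(_ v w) h]; rewrite -!enorm_sq -exprMn.
by rewrite ler_sqr ?nnegrE ?sqrtr_ge0// (le_trans _ h) ?sqrtr_ge0.
Qed.

Lemma stack_grad_lipschitz L (x y : mx) : (forall i, smooth L (f i)) ->
  mdot (stack_grad x - stack_grad y) (stack_grad x - stack_grad y) <=
  L ^+ 2 * mdot (x - y) (x - y).
Proof.
move=> fL; rewrite -!sqnormE sqnorm_rows (sqnorm_rows (x - y)) mulr_sumr.
by apply: ler_sum => i _; rewrite !linearB /= !rowK; exact: smooth_sqr.
Qed.

Hypothesis n0 : (0 < n)%N.
Let nR : (n%:R : R) != 0. Proof. by rewrite pnatr_eq0 -lt0n. Qed.

Lemma sqnorm_dotp (v : 'rV[R]_p) : sqnorm v = dotp v v.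
Proof. by rewrite /sqnorm big_ord1. Qed.

Lemma dotpC (u v : 'rV[R]_p) : dotp u v = dotp v u.
Proof. by apply: eq_bigr => j _; rewrite mulrC. Qed.

Definition mean_row (x : mx) : 'rV[R]_p := n%:R^-1 *: \sum_i row i x.

Lemma avg_ones v : avg R n *m ones v = ones v.
Proof.
apply/matrixP => i j; rewrite !mxE; under eq_bigr do rewrite !mxE.
by rewrite sumr_const card_ord -(mulr_natr (_ * _)) mulrAC mulVf// mul1r.
Qed.

Lemma avgE (x : mx) : avg R n *m x = ones (mean_row x).
Proof.
apply/matrixP => i j; rewrite !mxE summxE mulr_sumr; apply: eq_bigr => k _.
by rewrite !mxE.
Qed.

Lemma gossip_ones g b (B : 'M[R]_n) v : gossip g b B -> B *m ones v = 0.
Proof. by move=> Bg; rewrite -avg_ones mulmxA (gossip_avg Bg) mul0mx. Qed.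

Lemma mean_rowB (x y : mx) : mean_row (x - y) = mean_row x - mean_row y.
Proof.
rewrite /mean_row -scalerBr -sumrB; congr (_ *: _).
by apply: eq_bigr => i _; rewrite linearB.
Qed.

Lemma mean_row_ones v : mean_row (ones v) = v.
Proof.
rewrite /mean_row; under eq_bigr do rewrite row_ones.
by rewrite sumr_const card_ord -(scaler_nat _ v) scalerA mulVf// scale1r.
Qed.

Lemma mdot_ones u (x : mx) : mdot (ones u) x = n%:R * dotp u (mean_row x).
Proof.
rewrite mdotE exchange_big /= /dotp mulr_sumr; apply: eq_bigr => j _.
rewrite !mxE summxE mulrCA mulVKf// mulr_sumr.
by apply: eq_bigr => i _; rewrite !mxE.
Qed.

(** The average of the gradients at a consensus point is the gradient of the
    average cost. *)
Lemma mean_stack_grad v : (forall i x, differentiable (f i) x) ->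
  mean_row (stack_grad (ones v)) = grad (average_cost f) v.
Proof.
move=> df; rewrite grad_average// /mean_row; congr (_ *: _).
by apply: eq_bigr => i _; rewrite rowK row_ones.
Qed.

Variables (L mu : R) (xstar : 'rV[R]_p).
Hypotheses (fL : forall i, smooth L (f i)).
Hypothesis fmu : strongly_convex mu (average_cost f).
Hypothesis fmin : is_minimizer (average_cost f) xstar.

Let df i x : differentiable (f i) x. Proof. exact: (proj1 (fL i)). Qed.

Lemma avg_stack_grad_min : avg R n *m stack_grad (ones xstar) = 0.
Proof.
rewrite avgE mean_stack_grad// grad_minimizer//.
  by apply/matrixP => i j; rewrite !mxE.
exact: differentiable_average.
Qed.

Lemma stack_grad_strongly_convex (x : mx) :
  mu * mdot (avg R n *m (x - ones xstar)) (avg R n *m (x - ones xstar)) <=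
    mdot (avg R n *m (x - ones xstar)) (stack_grad (avg R n *m x) - stack_grad (ones xstar)).
Proof.
set E := _ *m (_ - _); have EE : E = ones (mean_row x - xstar).
  by rewrite /E mulmxBr avg_ones avgE; apply/matrixP => i j; rewrite !mxE.
rewrite EE !mdot_ones.
rewrite mean_row_ones mean_rowB avgE !mean_stack_grad// mulrCA ler_wpM2l//.
have := fmu (mean_row x) xstar; rewrite enorm_sq sqnorm_dotp.
by rewrite [X in _ <= X -> _]dotpC.
Qed.

Lemma stack_grad_mean_smooth (x : mx) :
  mdot (stack_grad (avg R n *m x) - stack_grad (ones xstar))
       (stack_grad (avg R n *m x) - stack_grad (ones xstar)) <=
  L ^+ 2 * mdot (avg R n *m (x - ones xstar)) (avg R n *m (x - ones xstar)).
Proof.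
apply: le_trans (stack_grad_lipschitz _ _ fL) _.
by rewrite mulmxBr avg_ones.
Qed.

(** x and J x differ by Pi x, and Pi annihilates constants. *)
Lemma stack_grad_consensus_smooth (x : mx) :
  mdot (stack_grad x - stack_grad (avg R n *m x))
       (stack_grad x - stack_grad (avg R n *m x)) <=
  L ^+ 2 * mdot (cen R n *m (x - ones xstar)) (cen R n *m (x - ones xstar)).
Proof.
apply: le_trans (stack_grad_lipschitz _ _ fL) _.
rewrite /cen mulmxBl mul1mx mulmxBr avg_ones.
by rewrite opprB addrA subrK.
Qed.

Lemma smooth_ge0 : (0 < p)%N -> 0 <= L.
Proof.
move=> p0; have [_ /(_ (const_mx 1) 0) h] := fL (Ordinal n0).
have : 0 < enorm (const_mx 1 - 0 : 'rV[R]_p).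
  rewrite subr0 sqrtr_gt0 sqnorm_dotp /dotp.
  under eq_bigr do rewrite mxE mulr1.
  by rewrite sumr_const card_ord pmulrn_lgt0.
by move/pmulr_lge0 => <-; apply: le_trans h; exact: sqrtr_ge0.
Qed.

(** Tested on a nonzero vector, strong convexity and the Lipschitz bound for the
    average gradient compare mu with L; such a vector exists in positive
    dimension only. *)
Lemma strongly_convex_smooth_le : (0 < p)%N -> 0 < mu -> mu <= L.
Proof.
move=> p0 mu0; pose v : 'rV[R]_p := const_mx 1.
pose x := ones (v + xstar); pose E := avg R n *m (x - ones xstar).
have xE : x - ones xstar = ones v by apply/matrixP => i j; rewrite !mxE addrK.
have EE : E = ones v by rewrite /E xE avg_ones.
have E0 : 0 < mdot E E.
  rewrite lt_neqAle mdot_ge0 andbT; apply/eqP => /esym/mdot_eq0.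
  rewrite EE => /matrixP/(_ (Ordinal n0) (Ordinal p0)) /eqP.
  by rewrite !mxE oner_eq0.
have h1 := stack_grad_strongly_convex x; have h2 := stack_grad_mean_smooth x.
rewrite /= -/E in h1 h2; move: h1 h2; set phi := _ - _ => h1 h2.
have := mdot_young E phi mu0 => h3.
have muL : mu ^+ 2 <= L ^+ 2.
  rewrite -(ler_pM2r E0); apply: le_trans h2.
  have : mu * mdot E E <= mu^-1 * mdot phi phi by move: h1 h3; lra.
  by move=> /(ler_wpM2l (ltW mu0)); rewrite !mulrA mulfV ?gt_eqF// mul1r.
by move: muL; rewrite ler_sqr ?nnegrE ?(ltW mu0) ?smooth_ge0.
Qed.

End StackedGradient.

(** * Independence of the past and of a fresh sample *)

Section Grouping.
Context {R : realType} {d : measure_display} {Omega : measurableType d}.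
Variable P : probability Omega R.
Context {I : eqType} (G : I -> set (set Omega)).
Hypothesis GI : forall i, setI_closed (G i).
Hypothesis GT : forall i, G i setT.
Hypothesis Gm : forall i, G i `<=` measurable.
Hypothesis Gind : mutually_independent P G.

(** Generates what is known when the sources in A have been observed. *)
Definition events (A : set I) : set (set Omega) := \bigcup_(i in A) G i.

Lemma events_measurable A : <<s events A >> `<=` measurable.
Proof.
apply: smallest_sub; first exact: sigma_algebra_measurable.
by move=> X [i _ /Gm].
Qed.

(* The family of events itself is not stable under intersection, but its finite
   intersections are, and they generate the same sigma-algebra. *)
Let meets (A : set I) : set (set Omega) :=
  [set X | exists s : seq I, exists E : I -> set Omega,
    [/\ uniq s, (forall i, i \in s -> A i), (forall i, i \in s -> G i (E i))
      & X = \bigcap_(i in [set` s]) E i]].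

Let meetsI A : setI_closed (meets A).
Proof.
move=> _ _ [s [E [us sA sE ->]]] [s' [E' [us' s'A s'E' ->]]].
exists (undup (s ++ s')).
exists (fun i => (if i \in s then E i else setT) `&` (if i \in s' then E' i else setT)).
split.
- exact: undup_uniq.
- by move=> i; rewrite mem_undup mem_cat => /orP[/sA|/s'A].
- move=> i _; apply: GI; case: ifP => [|_]; by [exact: sE|exact: s'E'|exact: GT].
- apply/seteqP; split => w.
    move=> [Ew E'w] i _; split; case: ifP => // h; by [exact: Ew|exact: E'w].
  move=> h; split => i /= si.
    by have /= := h i; rewrite mem_undup mem_cat si => /(_ isT) [].
  by have /= := h i; rewrite mem_undup mem_cat si orbT => /(_ isT) [].
Qed.

Let meets_sub A : events A `<=` meets A.
Proof.
move=> X [i Ai GX]; exists [:: i], (fun _ => X); split => //.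
- by move=> j; rewrite inE => /eqP ->.
- by move=> j; rewrite inE => /eqP ->.
- apply/seteqP; split => w; first by move=> Xw j.
  by move=> /(_ i); apply; rewrite /= inE.
Qed.

Let meets_measurable A : meets A `<=` measurable.
Proof.
move=> _ [s [E [us _ sE ->]]]; apply: fin_bigcap_measurable; first exact: finite_seq.
by move=> i /= /sE/Gm.
Qed.

(** Both sides are measures of the event E, and they agree on the finite
    intersections, which form a pi-system. *)
Lemma events_independent (A : set I) (i : I) (E B : set Omega) : ~ A i ->
  <<s events A >> E -> G i B -> P (E `&` B) = (P E * P B)%E.
Proof.
move=> Ai sE GB; have mB := Gm GB.
have fB : P B \is a fin_num by exact: fin_num_measure.
have r0 : 0 <= fine (P B) by exact: fine_ge0.
pose r := NngNum r0.
suff -> : P (E `&` B) = mscale r P E.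
  by rewrite /mscale /= fineK// muleC.
rewrite -[LHS]/(mrestr P mB E).
apply: (@g_sigma_algebra_measure_unique _ _ _ (meets A) _ (fun=> setT)) => //.
- by move=> _; exists [::], (fun _ => setT); split => //; rewrite set_nil bigcap_set0.
- by rewrite bigcup_const.
- move=> _ [s [X [us sA sX ->]]].
  set XX := \bigcap_(j in _) _; rewrite -[LHS]/(P (XX `&` B)) -[RHS]/((fine (P B))%:E * P XX)%E {}/XX.
  have is_ : i \notin s by apply/negP => /sA.
  pose X' j := if j == i then B else X j.
  have sE' : \bigcap_(j in [set` s]) X j = \bigcap_(j in [set` s]) X' j.
    apply: eq_bigcapr => j /= sj; rewrite /X' ifF//.
    by apply/negbTE; apply: contraNneq is_ => <-.
  have h1 := @Gind (i :: s) X'; have h2 := @Gind s X us sX.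
  have -> : \bigcap_(j in [set` s]) X j `&` B = \bigcap_(j in [set` i :: s]) X' j.
    rewrite sE'; apply/seteqP; split => w.
      move=> [Xw Bw] j /=; rewrite inE /X'; case: eqVneq => //= ji js.
      by have /= := Xw j js; rewrite /X' (negPf ji).
    move=> Xw; split; last by have /= := Xw i (mem_head _ _); rewrite /X' eqxx.
    by move=> j /= js; apply: Xw; rewrite /= inE js orbT.
  rewrite h1 /= ?is_ ?us//; last first.
    move=> j; rewrite inE /X'; case: eqVneq => [-> //|_ /= ]; exact: sX.
  rewrite h2 big_cons {1}/X' eqxx EFinM; congr (_ * _%:E)%E.
  apply: eq_big_seq => j sj; rewrite /X' ifF//.
  by apply/negbTE; apply: contraNneq is_ => <-.
- by move=> _; rewrite -[X in (X < _)%E]/(P (setT `&` B)) setTI ltey_eq fB.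
- by move: sE; apply: sub_sigma_algebra2; exact: meets_sub.
Qed.

End Grouping.

Section Freezing.
Context {R : realType} {d dZ : measure_display} {Omega : measurableType d}.
Context {Z : measurableType dZ} (P : probability Omega R).
Variables (F : set (set Omega)) (xi : Omega -> Z).
Hypothesis Fm : <<s F >> `<=` measurable.
Hypothesis mxi : measurable_fun setT xi.
Hypothesis Fxi : forall A B, <<s F >> A -> measurable B ->
  P (A `&` xi @^-1` B) = (P A * P (xi @^-1` B))%E.

Local Notation past := (g_sigma_algebraType F).

(* The whole outcome, seen only through the events of F, plays the role of the
   past; independence says that the law of the pair is a product. *)
Let TZ : measurableType _ := (past * Z)%type.

Let idp : Omega -> past := fun w => w.

Let midp : measurable_fun setT idp.
Proof. by move=> _ A /Fm; rewrite setTI. Qed.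

Let pairp : Omega -> TZ := fun w => (idp w, xi w).

Let mpairp : measurable_fun setT pairp.
Proof. exact: measurable_fun_pair. Qed.

Let id_m := HB.pack_for {mfun Omega >-> past} idp (isMeasurableFun.Build _ _ _ _ _ midp).
Let xi_m := HB.pack_for {mfun Omega >-> Z} xi (isMeasurableFun.Build _ _ _ _ _ mxi).
Let pair_m := HB.pack_for {mfun Omega >-> TZ} pairp (isMeasurableFun.Build _ _ _ _ _ mpairp).

Lemma past_measurable d' (T : measurableType d') (f : Omega -> T) :
  measurable_fun setT (f : past -> T) -> measurable_fun setT f.
Proof. by move=> mf; exact: (measurableT_comp mf midp). Qed.

Let joint X : measurable X ->
  (distribution P id_m \x distribution P xi_m)%E X = distribution P pair_m X.
Proof.
apply: product_measure_unique => A B mA mB.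
exact: (Fxi mA mB).
Qed.

Variable phi : Omega -> Z -> R.
Hypothesis mphi : measurable_fun setT (fun z : TZ => phi z.1 z.2).

(** Tonelli's theorem for the product law of the past and the sample. *)
Lemma freeze_ge0 : (forall w z, 0 <= phi w z) ->
  measurable_fun setT (fun w : past => \int[P]_w' (phi w (xi w'))%:E)%E /\
  (\int[P]_w (phi w (xi w))%:E = \int[P]_w \int[P]_w' (phi w (xi w'))%:E)%E.
Proof.
move=> phi0; pose f (z : TZ) := (phi z.1 z.2)%:E.
have mf : measurable_fun setT f by apply/measurable_EFinP.
have f0 z : (0 <= f z)%E by rewrite lee_fin.
have FE : fubini_F (distribution P xi_m) f =
    (fun w : past => \int[P]_w' (phi w (xi w'))%:E)%E.
  apply/funext => w; rewrite /fubini_F ge0_integral_pushforward//.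
  by apply/measurable_EFinP; apply: measurableT_comp mphi _; exact: pair1_measurable.
have mF := @measurable_fun_fubini_tonelli_F _ _ _ _ _ (distribution P xi_m) f mf f0.
rewrite FE in mF; split => //.
transitivity (\int[distribution P pair_m]_z f z)%E.
  by rewrite ge0_integral_pushforward// => z _; exact: f0.
transitivity (\int[distribution P id_m \x distribution P xi_m]_z f z)%E.
  apply: eq_measure_integral => //= A mA _; exact/esym/joint.
rewrite fubini_tonelli1// FE ge0_integral_pushforward//.
by move=> w _; apply: integral_ge0 => w' _; rewrite lee_fin.
Qed.

Let f (z : TZ) : \bar R := (phi z.1 z.2)%:E.
Let mf : measurable_fun setT f. Proof. by apply/measurable_EFinP. Qed.

Hypothesis iphi : P.-integrable setT (fun w => (phi w (xi w))%:E).

Let iprod : (distribution P id_m \x distribution P xi_m)%E.-integrable setT f.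
Proof.
apply/integrableP; split => //; have /integrableP[_] := iphi; apply: le_lt_trans.
rewrite le_eqVlt; apply/orP; left; apply/eqP.
transitivity (\int[distribution P pair_m]_z `|f z|)%E.
  by apply: eq_measure_integral => //= A mA _; exact: joint.
by rewrite ge0_integral_pushforward//; exact: measurableT_comp.
Qed.

Let integral_law (h : Z -> \bar R) : measurable_fun setT h ->
  (\int[distribution P xi_m]_y h y = \int[P]_w h (xi w))%E.
Proof.
move=> mh; rewrite -[fun w => h (xi w)]/(h \o xi) integralE [RHS]integralE.
have -> : ((h \o xi)^\+ = h^\+ \o xi)%E by rewrite funepos_comp.
have -> : ((h \o xi)^\- = h^\- \o xi)%E by rewrite funeneg_comp.
congr (_ - _)%E.
  rewrite ge0_integral_pushforward//; exact: measurable_funepos.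
rewrite ge0_integral_pushforward//; exact: measurable_funeneg.
Qed.

Let inner (w : past) : fubini_F (distribution P xi_m) f w =
  (\int[P]_w' (phi w (xi w'))%:E)%E.
Proof.
rewrite /fubini_F (integral_law (h := fun y => f (w, y)))//.
by apply: measurableT_comp mf _; exact: pair1_measurable.
Qed.

(** Fubini's theorem for the product law of the past and the sample: given the
    past, an expectation may be taken over the fresh sample alone. *)
Lemma freeze :
  [/\ {ae P, forall w, P.-integrable setT (fun w' => (phi w (xi w'))%:E)},
      measurable_fun setT (fun w : past => \int[P]_w' (phi w (xi w'))%:E)%E,
      P.-integrable setT (fun w => \int[P]_w' (phi w (xi w'))%:E)%E &
  (\int[P]_w (phi w (xi w))%:E = \int[P]_w \int[P]_w' (phi w (xi w'))%:E)%E].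
Proof.
have innerE : fubini_F (distribution P xi_m) f =
    (fun w : past => \int[P]_w' (phi w (xi w'))%:E)%E.
  by apply/funext => w; rewrite inner.
have mF := measurable_fubini_F iprod; have iF := integrable_fubini_F iprod.
rewrite innerE in mF iF.
have iO : P.-integrable setT (fun w => \int[P]_w' (phi w (xi w'))%:E)%E.
  apply/integrableP; split; first exact: (measurableT_comp mF midp).
  have /integrableP[_] := iF; apply: le_lt_trans.
  by rewrite ge0_integral_pushforward//; exact: measurableT_comp.
split => //.
- have [A [mA A0 sA]] := ae_integrable1 iprod.
  exists A; split => //; first exact: Fm.
  apply: subset_trans sA => w /= Nw; apply: contra_not Nw => /integrableP[mw iw].
  apply/integrableP; split.
    apply/measurable_EFinP.
    have mw' : measurable_fun setT (phi w) by apply/measurable_EFinP; exact: mw.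
    exact: (measurableT_comp mw' mxi).
  apply: le_lt_trans iw; rewrite ge0_integral_pushforward//.
  exact: measurableT_comp.
- transitivity (\int[distribution P pair_m]_z f z)%E.
    rewrite integral_pushforward//.
  transitivity (\int[distribution P id_m \x distribution P xi_m]_z f z)%E.
    by apply: eq_measure_integral => //= A mA _; exact/esym/joint.
  rewrite -integral12_prod_meas1// innerE.
  by rewrite (integral_pushforward midp mF iO measurableT).
Qed.

End Freezing.

(** * Square-integrable random variables *)

Section SquareIntegrable.
Context {R : realType} {d : measure_display} {Omega : measurableType d}.
Variable P : probability Omega R.

Definition Ex (X : Omega -> R) : R := \int[P]_w X w.

(** Square-integrability is stable under linear combinations, and products of two
    such variables are integrable; this is what the quadratic Lyapunov functions
    require. *)
Definition sq_integrable (X : Omega -> R) : Prop :=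
  measurable_fun setT X /\ P.-integrable setT (EFin \o (fun w => X w ^+ 2)).

Lemma Ex_ge0 X : (forall w, 0 <= X w) -> 0 <= Ex X.
Proof. by move=> X0; apply: Rintegral_ge0 => w _. Qed.

Lemma ExD X Y : P.-integrable setT (EFin \o X) -> P.-integrable setT (EFin \o Y) ->
  Ex (fun w => X w + Y w) = Ex X + Ex Y.
Proof. by move=> iX iY; rewrite /Ex RintegralD. Qed.

Lemma ExZ c X : P.-integrable setT (EFin \o X) -> Ex (fun w => c * X w) = c * Ex X.
Proof. by move=> iX; rewrite /Ex RintegralZl. Qed.

Lemma Ex_le X Y : P.-integrable setT (EFin \o X) -> P.-integrable setT (EFin \o Y) ->
  (forall w, X w <= Y w) -> Ex X <= Ex Y.
Proof. by move=> iX iY XY; apply: le_Rintegral => // w _. Qed.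

Lemma Ex_cst c : Ex (fun=> c) = c.
Proof. by rewrite /Ex Rintegral_cst//= probability_setT /= mulr1. Qed.

Lemma integrable_cstP (c : R) : P.-integrable setT (EFin \o (fun=> c)).
Proof. exact: finite_measure_integrable_cst. Qed.

Lemma integrable_addP X Y : P.-integrable setT (EFin \o X) ->
  P.-integrable setT (EFin \o Y) -> P.-integrable setT (EFin \o (fun w => X w + Y w)).
Proof.
move=> iX iY; have := integrableD measurableT iX iY.
by apply: eq_integrable => // w _ /=; rewrite EFinD.
Qed.

Lemma integrable_scaleP c X : P.-integrable setT (EFin \o X) ->
  P.-integrable setT (EFin \o (fun w => c * X w)).
Proof.
move=> iX; have := integrableZl measurableT c iX.
by apply: eq_integrable => // w _ /=; rewrite EFinM.
Qed.

Lemma integrable_sumP (I : Type) (s : seq I) (X : I -> Omega -> R) :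
  (forall i, P.-integrable setT (EFin \o X i)) ->
  P.-integrable setT (EFin \o (fun w => \sum_(i <- s) X i w)).
Proof.
move=> iX; elim: s => [|i s IH].
  apply: eq_integrable (integrable_cstP 0) => // w _ /=; by rewrite big_nil.
by apply: eq_integrable (integrable_addP (iX i) IH) => // w _ /=; rewrite big_cons.
Qed.

Lemma Ex_sum (I : Type) (s : seq I) (X : I -> Omega -> R) :
  (forall i, P.-integrable setT (EFin \o X i)) ->
  Ex (fun w => \sum_(i <- s) X i w) = \sum_(i <- s) Ex (X i).
Proof.
move=> iX; elim: s => [|i s IH].
  rewrite big_nil -[RHS](Ex_cst 0); congr Ex; apply/funext => w; by rewrite big_nil.
rewrite big_cons -IH -ExD//; last exact: integrable_sumP.
by congr Ex; apply/funext => w; rewrite big_cons.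
Qed.

(** Serves to take the expectation of a long pointwise inequality in one step. *)
Lemma Ex_lincomb (s : seq (R * (Omega -> R))) :
  foldr (fun t Q => P.-integrable setT (EFin \o t.2) /\ Q) True s ->
  P.-integrable setT (EFin \o (fun w => foldr (fun t r => t.1 * t.2 w + r) 0 s)) /\
  Ex (fun w => foldr (fun t r => t.1 * t.2 w + r) 0 s) =
    foldr (fun t r => t.1 * Ex t.2 + r) 0 s.
Proof.
elim: s => [_|[c X] s IH /= [iX /IH[iS <-]]].
  by split; [exact: integrable_cstP|exact: Ex_cst].
have icX := integrable_scaleP c iX.
by split; [exact: integrable_addP|rewrite ExD// ExZ].
Qed.

Lemma integrable_leP (X Y : Omega -> R) : measurable_fun setT X -> P.-integrable setT (EFin \o Y) ->
  (forall w, `|X w| <= Y w) -> P.-integrable setT (EFin \o X).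
Proof.
move=> mX iY XY; apply: le_integrable iY => //; first exact/measurable_EFinP.
by move=> w _ /=; rewrite lee_fin (le_trans (XY w))// ler_norm.
Qed.

Lemma integrable_normP X : P.-integrable setT (EFin \o X) ->
  P.-integrable setT (EFin \o (fun w => `|X w|)).
Proof. by move=> /integrable_abse; apply: eq_integrable. Qed.

Lemma sq_integrable_cst c : sq_integrable (fun=> c).
Proof.
by split; [exact: measurable_cst | exact: (integrable_cstP (c ^+ 2))].
Qed.

Lemma sq_integrableD X Y : sq_integrable X -> sq_integrable Y ->
  sq_integrable (fun w => X w + Y w).
Proof.
move=> [mX iX] [mY iY]; split; first exact: measurable_funD.
have i2 := integrable_addP (integrable_scaleP 2 iX) (integrable_scaleP 2 iY).
apply: integrable_leP i2 _; first by apply: measurable_funX; exact: measurable_funD.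
by move=> w; rewrite ger0_norm ?sqr_ge0//; have := sqr_ge0 (X w - Y w); rewrite !expr2; lra.
Qed.

Lemma sq_integrableZ c X : sq_integrable X -> sq_integrable (fun w => c * X w).
Proof.
move=> [mX iX]; split; first by apply: measurable_funM.
apply: eq_integrable (integrable_scaleP (c ^+ 2) iX) => // w _ /=.
by rewrite exprMn.
Qed.

Lemma integrable_mulP X Y : sq_integrable X -> sq_integrable Y ->
  P.-integrable setT (EFin \o (fun w => X w * Y w)).
Proof.
move=> [mX iX] [mY iY]; apply: integrable_leP (integrable_addP iX iY) _.
  exact: measurable_funM.
move=> w; rewrite ler_norml; have := sqr_ge0 (X w - Y w); have := sqr_ge0 (X w + Y w).
have := sqr_ge0 (X w); have := sqr_ge0 (Y w).
by rewrite !expr2 => h1 h2 h3 h4; apply/andP; split; lra.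
Qed.

Lemma sq_integrable_integrable X : sq_integrable X -> P.-integrable setT (EFin \o X).
Proof.
move=> sX; have := integrable_mulP sX (sq_integrable_cst 1).
by apply: eq_integrable => // w _ /=; rewrite mulr1.
Qed.

Lemma EFin_Ex X : P.-integrable setT (EFin \o X) ->
  (\int[P]_w (X w)%:E = (Ex X)%:E)%E.
Proof.
by move=> iX; rewrite /Ex /Rintegral fineK//; apply: integrable_fin_num.
Qed.

Lemma integrable_ge0 (X : Omega -> R) (c : R) : measurable_fun setT X -> (forall w, 0 <= X w) ->
  (\int[P]_w (X w)%:E <= c%:E)%E -> P.-integrable setT (EFin \o X) /\ Ex X <= c.
Proof.
move=> mX X0 Xc; have iX : P.-integrable setT (EFin \o X).
  apply/integrableP; split; first exact/measurable_EFinP.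
  apply: le_lt_trans (ltry c); apply: le_trans Xc.
  by under eq_integral do rewrite /= ger0_norm//.
by split => //; move: Xc; rewrite EFin_Ex// lee_fin.
Qed.

End SquareIntegrable.

Section RowMeasurability.
Context {R : realType} {p : nat} {d : measure_display} {T : measurableType d}.

(** The sigma-algebra of row vectors is transported from tuples, which makes
    measurability a coordinatewise notion. *)
Lemma measurable_vecmP (U : T -> @vecm R p) :
  measurable_fun setT U <-> forall j, measurable_fun setT (fun w => (U w : 'rV_p) 0 j).
Proof.
split=> [mU j|mU].
  have m1 : measurable_fun setT (fun v : @vecm R p => tuple_of_row v).
    by move=> _ B mB; rewrite setTI; exists B => //; rewrite setTI.
  have := measurableT_comp (measurable_tnth j) (measurableT_comp m1 mU).
  by congr (measurable_fun _ _); apply/funext => w /=; rewrite tnth_mktuple.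
move=> _ _ [B mB <-]; rewrite setTI setTI.
have m2 : measurable_fun setT (fun w => tuple_of_row (U w)).
  apply/measurable_fun_tnthP => j; have := mU j.
  by congr (measurable_fun _ _); apply/funext => w /=; rewrite tnth_mktuple.
by have := m2 measurableT B mB; rewrite setTI.
Qed.

End RowMeasurability.

(** * Fresh noise is orthogonal to the past *)

Section FreshNoise.
Context {R : realType} {p : nat} {d dZ : measure_display}.
Context {Omega : measurableType d} {Z : measurableType dZ} (P : probability Omega R).
Variables (F : set (set Omega)) (xi : Omega -> Z).
Hypothesis Fm : <<s F >> `<=` measurable.
Hypothesis mxi : measurable_fun setT xi.
Hypothesis Fxi : forall A B, <<s F >> A -> measurable B ->
  P (A `&` xi @^-1` B) = (P A * P (xi @^-1` B))%E.
Local Notation past := (g_sigma_algebraType F).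
Variable g : 'rV[R]_p -> Z -> 'rV[R]_p.
Hypothesis mg : measurable_fun setT
  (fun z : @vecm R p * Z => g z.1 z.2 : @vecm R p).
Variable x : Omega -> 'rV[R]_p.
Hypothesis mx : forall j, measurable_fun setT (fun w : past => x w 0 j).

Let TZ : measurableType _ := (past * Z)%type.

Let mgx : measurable_fun setT (fun z : TZ => g (x z.1) z.2 : @vecm R p).
Proof.
have mxv : measurable_fun setT (x : past -> @vecm R p) by apply/measurable_vecmP.
have m2 : measurable_fun setT (fun z : TZ => (x z.1 : @vecm R p, z.2)).
  by apply: measurable_fun_pair; [exact: measurableT_comp mxv _|].
exact: (measurableT_comp mg m2).
Qed.

Let mgxj j : measurable_fun setT (fun z : TZ => g (x z.1) z.2 0 j).
Proof. by have /measurable_vecmP := mgx. Qed.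

Lemma measurable_fresh j : measurable_fun setT (fun w => g (x w) (xi w) 0 j).
Proof.
have m : measurable_fun setT (fun w : Omega => (w, xi w) : TZ).
  apply: measurable_fun_pair => //; exact: (past_measurable Fm (f := fun w => w : past)).
exact: (measurableT_comp (mgxj j) m).
Qed.

Section Compressor.
Variable C : R.
Hypothesis gC : unbiased_compressor P C g xi.
Hypothesis sx : forall j, sq_integrable P (fun w => x w 0 j).

Let mg_fix (v : 'rV[R]_p) j : measurable_fun setT (fun w => g v (xi w) 0 j).
Proof.
have mv : measurable_fun setT (fun w : Omega => (v : @vecm R p, xi w)).
  exact: measurable_fun_pair.
have : measurable_fun setT (fun w : Omega => g v (xi w) : @vecm R p).
  exact: (measurableT_comp mg mv).
by move=> /measurable_vecmP.
Qed.

Let mdiff j : measurable_fun setT (fun z : TZ => (g (x z.1) z.2 - x z.1) 0 j).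
Proof.
have -> : (fun z : TZ => (g (x z.1) z.2 - x z.1) 0 j) =
    (fun z : TZ => g (x z.1) z.2 0 j) \- (fun z : TZ => x z.1 0 j).
  by apply/funext => z; rewrite !mxE.
by apply: measurable_funB; [exact: mgxj|exact: measurableT_comp (mx j) _].
Qed.

(** Freezing the input of the compressor reduces both claims to the bound for a
    fixed vector. *)
Lemma compressor_noise_bound :
  P.-integrable setT (EFin \o (fun w => sqnorm (g (x w) (xi w) - x w))) /\
  Ex P (fun w => sqnorm (g (x w) (xi w) - x w)) <= C * Ex P (fun w => sqnorm (x w)).
Proof.
have msq : measurable_fun setT (fun z : TZ => sqnorm (g (x z.1) z.2 - x z.1)).
  rewrite /sqnorm; under eq_fun do rewrite big_ord1.
  by apply: measurable_sum => j; apply: measurable_funX; exact: mdiff.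
have isx : P.-integrable setT (EFin \o (fun w => sqnorm (x w))).
  rewrite /sqnorm; under eq_fun do rewrite big_ord1.
  by apply: integrable_sumP => j; have [] := sx j.
apply: integrable_ge0.
- have m : measurable_fun setT (fun w : Omega => (w, xi w) : TZ).
    by apply: measurable_fun_pair => //; exact: (past_measurable Fm (f := fun w => w : past)).
  exact: (measurableT_comp msq m).
- by move=> w; exact: sqnorm_ge0.
have [mi ->] := freeze_ge0 Fm mxi Fxi (phi := fun w z => sqnorm (g (x w) z - x w))
  msq (fun _ _ => sqnorm_ge0 _).
rewrite EFinM -EFin_Ex// -integralZl//.
apply: ge0_le_integral => //.
- by move=> w _; apply: integral_ge0 => w' _; rewrite lee_fin sqnorm_ge0.
- exact: (past_measurable Fm mi).
- by apply: measurable_funeM; have /integrableP[] := isx.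
- move=> w _; have [_ ] := gC (x w).
  by rewrite unlock; under eq_integral do rewrite enorm_sq; rewrite enorm_sq.
Qed.

Lemma compressor_noise_sq_integrable j :
  sq_integrable P (fun w => (g (x w) (xi w) - x w) 0 j).
Proof.
have [isq _] := compressor_noise_bound.
have m : measurable_fun setT (fun w => (g (x w) (xi w) - x w) 0 j).
  under eq_fun do rewrite !mxE.
  apply: measurable_funB; first exact: measurable_fresh.
  by have [] := sx j.
split => //; apply: integrable_leP isq _; first exact: measurable_funX.
move=> w; rewrite ger0_norm ?sqr_ge0// /sqnorm big_ord1 (bigD1 j)//= lerDl.
by apply: sumr_ge0 => k _; exact: sqr_ge0.
Qed.

(** Given the past, the compression is unbiased and Y is a constant. *)
Lemma compressor_noise_orthogonal Y j :
  measurable_fun setT (Y : past -> R) -> sq_integrable P Y ->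
  Ex P (fun w => (g (x w) (xi w) - x w) 0 j * Y w) = 0.
Proof.
move=> mY sY; pose phi w z := (g (x w) z - x w) 0 j * Y w.
have mphi : measurable_fun setT (fun z : TZ => phi z.1 z.2).
  apply: measurable_funM; [exact: mdiff|exact: measurableT_comp mY _].
have iphi : P.-integrable setT (EFin \o (fun w => phi w (xi w))).
  exact: integrable_mulP (compressor_noise_sq_integrable j) sY.
have [_ _ _ e] := freeze Fm mxi Fxi mphi iphi.
rewrite /Ex /Rintegral e integral0_eq// => w _.
have [/(_ j) gx ge] := gC (x w).
have sqg : sq_integrable P (fun w' => g (x w) (xi w') 0 j).
  have ms : measurable_fun setT (fun w' => (g (x w) (xi w') - x w) 0 j).
    under eq_fun do rewrite !mxE; exact: measurable_funB.
  have -> : (fun w' => g (x w) (xi w') 0 j) =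
      (fun w' => (g (x w) (xi w') - x w) 0 j + x w 0 j).
    by apply/funext => w'; rewrite !mxE subrK.
  apply: sq_integrableD; last exact: sq_integrable_cst.
  split => //; move: ge; rewrite unlock; under eq_integral do rewrite enorm_sq.
  move=> ge.
  have msq : measurable_fun setT (fun w' => sqnorm (g (x w) (xi w') - x w)).
    rewrite /sqnorm; under eq_fun do rewrite big_ord1.
    apply: measurable_sum => k; apply: measurable_funX; under eq_fun do rewrite !mxE.
    exact: measurable_funB.
  have [i _] := integrable_ge0 msq (fun w' => sqnorm_ge0 _) ge.
  apply: integrable_leP i _; first exact: measurable_funX.
  move=> w'; rewrite ger0_norm ?sqr_ge0// /sqnorm big_ord1 (bigD1 j)//= lerDl.
  by apply: sumr_ge0 => k _; exact: sqr_ge0.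
have ig := sq_integrable_integrable sqg.
rewrite /phi; under eq_integral do rewrite mulrC EFinM !mxE.
rewrite integralZl//; last first.
  apply: eq_integrable (integrable_addP ig (integrable_cstP P (- x w 0 j))) => // w' _ /=.
under eq_integral do rewrite EFinB.
rewrite integralB//; last exact: (integrable_cstP P (x w 0 j)).
move: gx; rewrite unlock => ->.
by rewrite integral_cst//= probability_setT mule1 subee// mule0.
Qed.

End Compressor.

Section GradientNoise.
Variables (sigma : R) (gradf : 'rV[R]_p -> 'rV[R]_p).
Hypothesis gs : stochastic_gradient P sigma gradf g x xi.

Local Notation sx := (generated_sigma (x : Omega -> @vecm R p)).

Let sxF : <<s sx >> `<=` <<s F >>.
Proof.
apply: smallest_sub; first exact: smallest_sigma_algebra.
have mxv : measurable_fun setT (x : past -> @vecm R p) by apply/measurable_vecmP.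
by move=> _ [B mB <-]; exact: mxv.
Qed.

Let sxx : sx `<=` <<s sx >>. Proof. exact: sub_sigma_algebra. Qed.

Let sxE A : <<s sx >> A -> sx A.
Proof.
apply: (@smallest_sub _ _ sx sx) => //.
exact: sigma_algebra_preimage (sigma_algebra_measurable _).
Qed.

Lemma measurable_gradient j : measurable_fun setT (fun w : past => gradf (x w) 0 j).
Proof.
have [_ _ mZ _] := proj1 gs j.
by move=> _ B mB; rewrite setTI; apply: sxF; apply: sxx; exact: mZ.
Qed.

(** The conditional bound holds almost everywhere for a version of the conditional
    expectation, whose integral over the whole space is that of the noise. *)
Lemma gradient_noise_bound :
  P.-integrable setT
    (EFin \o (fun w => sqnorm (g (x w) (xi w) - gradf (x w)))) /\
  Ex P (fun w => sqnorm (g (x w) (xi w) - gradf (x w))) <= sigma ^+ 2.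
Proof.
have [_ [Y [iX iY _ e] Ys]] := gs.
have iX' : P.-integrable setT
    (EFin \o (fun w => sqnorm (g (x w) (xi w) - gradf (x w)))).
  by apply: eq_integrable iX => // w _ /=; rewrite enorm_sq.
split => //; have eT := e setT; rewrite -lee_fin -EFin_Ex//.
under eq_integral do rewrite -enorm_sq.
rewrite eT; last by exists setT => //; rewrite setTI preimage_setT.
have mY : measurable_fun setT Y by apply/measurable_EFinP; have /integrableP[] := iY.
have iY' : P.-integrable setT (EFin \o (fun w => Num.min (Y w) (sigma ^+ 2))).
  apply: integrable_leP (integrable_addP (integrable_normP iY)
    (integrable_cstP P (sigma ^+ 2))) _; first exact: measurable_minr.
  move=> w; rewrite minEle; case: ifP => _; first by rewrite lerDl sqr_ge0.
  by rewrite ger0_norm ?sqr_ge0// lerDr.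
have -> : (\int[P]_w (Y w)%:E = \int[P]_w (Num.min (Y w) (sigma ^+ 2))%:E)%E.
  apply: ae_eq_integral => //.
  - by apply/measurable_EFinP.
  - by apply/measurable_EFinP; exact: measurable_minr.
  - by apply: filterS Ys => w Yw _ /=; rewrite min_l.
have ic : P.-integrable setT (EFin \o (fun=> sigma ^+ 2)) by exact: integrable_cstP.
apply: (@le_trans _ _ (\int[P]_w (sigma ^+ 2)%:E)%E); last first.
  by rewrite integral_cst//= probability_setT mule1.
apply: (le_integral measurableT iY' ic) => w _ /=.
by rewrite lee_fin ge_min lexx orbT.
Qed.

Lemma gradient_noise_sq_integrable j :
  sq_integrable P (fun w => (g (x w) (xi w) - gradf (x w)) 0 j).
Proof.
have [isq _] := gradient_noise_bound.
have m : measurable_fun setT (fun w => (g (x w) (xi w) - gradf (x w)) 0 j).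
  under eq_fun do rewrite !mxE.
  apply: measurable_funB; first exact: measurable_fresh.
  apply: (past_measurable Fm (f := fun w => gradf (x w) 0 j)).
  exact: measurable_gradient.
split => //; apply: integrable_leP isq _; first exact: measurable_funX.
move=> w; rewrite ger0_norm ?sqr_ge0// /sqnorm big_ord1 (bigD1 j)//= lerDl.
by apply: sumr_ge0 => k _; exact: sqr_ge0.
Qed.

Let n j w z := g (x w) z 0 j - gradf (x w) 0 j.

(** The sample mean of the noise given the query point is a function of the
    query point whose integral over every event of the query point vanishes,
    because the sample is independent of the query point. *)
Lemma gradient_noise_mean0 j :
  {ae P, forall w, P.-integrable setT (fun w' => (n j w (xi w'))%:E) /\
    (\int[P]_w' (n j w (xi w'))%:E = 0)%E}.
Proof.
pose xpast := g_sigma_algebraType sx.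
have mxs k : measurable_fun setT (fun w : xpast => x w 0 k).
  move: k; apply/measurable_vecmP => _ B mB; rewrite setTI.
  by apply: sxx; exists B => //; rewrite setTI.
have sxm : <<s sx >> `<=` measurable := subset_trans sxF Fm.
have sxi A B : <<s sx >> A -> measurable B ->
    P (A `&` xi @^-1` B) = (P A * P (xi @^-1` B))%E by move=> /sxF; exact: Fxi.
pose XZ : measurableType _ := (xpast * Z)%type.
have mn : measurable_fun setT (fun z : XZ => n j z.1 z.2).
  have mxv : measurable_fun setT (x : xpast -> @vecm R p) by apply/measurable_vecmP.
  have m2 : measurable_fun setT (fun z : XZ => (x z.1 : @vecm R p, z.2)).
    by apply: measurable_fun_pair; [exact: measurableT_comp mxv _|].
  have : measurable_fun setT (fun z : XZ => g (x z.1) z.2 : @vecm R p).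
    exact: (measurableT_comp mg m2).
  move=> /measurable_vecmP/(_ j) mgj; apply: measurable_funB => //.
  have mgr : measurable_fun setT (fun w : xpast => gradf (x w) 0 j).
    by move=> _ B mB; rewrite setTI; apply: sxx; have [_ _ + _] := proj1 gs j; apply.
  exact: measurableT_comp mgr _.
have [iX iZ _ e] := proj1 gs j.
have iN : P.-integrable setT (EFin \o (fun w => n j w (xi w))).
  have := integrable_addP iX (integrable_scaleP (-1) iZ).
  by apply: eq_integrable => // w _ /=; rewrite mulN1r.
have [ae1 mh ih _] := freeze sxm mxi sxi mn iN.
pose h := (fun w : xpast => \int[P]_w' (n j w (xi w'))%:E)%E.
have hA A : sx A -> (\int[P]_(w in A) h w = 0)%E.
  move=> sA; have mA' : <<s sx >> A by exact: sxx.
  have mA : measurable A by exact: sxm.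
  have mn1 : measurable_fun setT (fun z : XZ => n j z.1 z.2 * \1_A z.1).
    apply: measurable_funM => //.
    have m1 : measurable_fun setT (\1_A : xpast -> R) by exact: measurable_indic.
    exact: measurableT_comp m1 _.
  have iN1 : P.-integrable setT (EFin \o (fun w => n j w (xi w) * \1_A w)).
    apply: integrable_leP (integrable_normP iN) _.
      apply: measurable_funM; last exact: measurable_indic.
      by apply/measurable_EFinP; have /integrableP[] := iN.
    move=> w; rewrite normrM ler_piMr// indicE; case: (w \in A) => //=.
      by rewrite normr1.
    by rewrite normr0 ler01.
  have [_ _ _ e1] := freeze sxm mxi sxi (phi := fun w z => n j w z * \1_A w) mn1 iN1.
  rewrite integral_mkcond; transitivity (\int[P]_w (n j w (xi w) * \1_A w)%:E)%E.
    rewrite e1; apply: eq_integral => w _; rewrite patchE indicE.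
    by case: (w \in A); under eq_integral do rewrite ?mulr1 ?mulr0//; rewrite ?integral0.
  transitivity (\int[P]_(w in A) ((g (x w) (xi w) 0 j)%:E - (gradf (x w) 0 j)%:E))%E.
    rewrite [RHS]integral_mkcond; apply: eq_integral => w _; rewrite patchE indicE.
    by case: (w \in A); rewrite ?mulr1 ?mulr0.
  rewrite integralB//; [|exact: integrableS iX|exact: integrableS iZ].
  rewrite (e A sA) subee//; apply: integrable_fin_num => //; exact: integrableS iZ.
have : {ae P, forall w, h w = 0%E}.
  have midx : measurable_fun setT (fun w : Omega => w : xpast).
    by move=> _ A /sxm; rewrite setTI.
  pose idm := HB.pack_for {mfun Omega >-> xpast} (fun w : Omega => w : xpast)
     (isMeasurableFun.Build _ _ _ _ _ midx).
  have ihd : (distribution P idm).-integrable setT h.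
    by apply: integrable_pushforward.
  have [A [mA A0 sA]] : ae_eq (distribution P idm) setT h (cst 0%E).
    apply: integral_ae_eq => // E _ mE; rewrite integral0.
    rewrite integral_pushforward//=; first by apply: hA; exact: sxE.
    by apply: integrableS ih => //; exact: sxm.
  exists A; split => //; first exact: sxm.
  by apply: subset_trans sA => w /= hw; apply: contra_not hw => /(_ I).
by move=> ae2; move: ae1 ae2; apply: filterS2.
Qed.

(** The unbiasedness is only assumed given the query point. Independence of the
    sample from the whole past upgrades it to unbiasedness given the past. *)
Lemma gradient_noise_orthogonal Y j :
  measurable_fun setT (Y : past -> R) -> sq_integrable P Y ->
  Ex P (fun w => (g (x w) (xi w) - gradf (x w)) 0 j * Y w) = 0.
Proof.
move=> mY sY; pose phi w z := (g (x w) z - gradf (x w)) 0 j * Y w.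
have mphi : measurable_fun setT (fun z : TZ => phi z.1 z.2).
  apply: measurable_funM; last exact: measurableT_comp mY _.
  under eq_fun do rewrite !mxE.
  apply: measurable_funB; first exact: mgxj.
  exact: measurableT_comp (measurable_gradient j) _.
have iphi : P.-integrable setT (EFin \o (fun w => phi w (xi w))).
  exact: integrable_mulP (gradient_noise_sq_integrable j) sY.
have [_ mh _ e] := freeze Fm mxi Fxi mphi iphi.
rewrite /Ex /Rintegral e.
rewrite (ae_eq_integral (cst 0%E)) ?integral0//; first exact: (past_measurable Fm mh).
have := gradient_noise_mean0 j; apply: filterS => w [iw nw] _ /=.
rewrite /phi; under eq_integral do rewrite mulrC EFinM !mxE.
by rewrite integralZl// nw mule0.
Qed.

End GradientNoise.

End FreshNoise.

(** * Random matrices *)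

Section RandomMatrix.
Context {R : realType} {d : measure_display} {Omega : measurableType d}.
Variable P : probability Omega R.
Implicit Types (F : set (set Omega)).

Definition random_matrix F n p (M : Omega -> 'M[R]_(n, p)) : Prop :=
  forall i j, measurable_fun setT (fun w : g_sigma_algebraType F => M w i j) /\
    sq_integrable P (fun w => M w i j).

Lemma random_matrix_cst F n p (M : 'M[R]_(n, p)) : random_matrix F (fun=> M).
Proof. by move=> i j; split; [exact: measurable_cst|exact: sq_integrable_cst]. Qed.

Lemma random_matrixD F n p (M N : Omega -> 'M[R]_(n, p)) :
  random_matrix F M -> random_matrix F N -> random_matrix F (fun w => M w + N w).
Proof.
move=> rM rN i j; have [mM sM] := rM i j; have [mN sN] := rN i j.
split; under eq_fun do rewrite mxE; last exact: sq_integrableD.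
exact: measurable_funD.
Qed.

Lemma random_matrixZ F n p c (M : Omega -> 'M[R]_(n, p)) :
  random_matrix F M -> random_matrix F (fun w => c *: M w).
Proof.
move=> rM i j; have [mM sM] := rM i j.
split; under eq_fun do rewrite mxE; last exact: sq_integrableZ.
exact: measurable_funM.
Qed.

Lemma random_matrixN F n p (M : Omega -> 'M[R]_(n, p)) :
  random_matrix F M -> random_matrix F (fun w => - M w).
Proof.
by move=> rM; under eq_fun do rewrite -scaleN1r; exact: random_matrixZ.
Qed.

Lemma random_matrixB F n p (M N : Omega -> 'M[R]_(n, p)) :
  random_matrix F M -> random_matrix F N -> random_matrix F (fun w => M w - N w).
Proof. by move=> rM rN; apply: random_matrixD => //; exact: random_matrixN. Qed.

Lemma random_matrix_mul F n m p (A : 'M[R]_(m, n)) (M : Omega -> 'M[R]_(n, p)) :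
  random_matrix F M -> random_matrix F (fun w => A *m M w).
Proof.
move=> rM i j; under eq_fun do rewrite mxE.
split; last first.
  elim: (index_enum _) => [|k s IH].
    by under eq_fun do rewrite big_nil; exact: sq_integrable_cst.
  under eq_fun do rewrite big_cons; apply: sq_integrableD => //.
  by apply: sq_integrableZ; have [] := rM k j.
by apply: measurable_sum => k; apply: measurable_funM => //; have [] := rM k j.
Qed.

Lemma random_matrix_sub F F' n p (M : Omega -> 'M[R]_(n, p)) :
  <<s F >> `<=` <<s F' >> -> random_matrix F M -> random_matrix F' M.
Proof.
move=> FF' rM i j; have [mM sM] := rM i j; split => // _ B mB.
by rewrite setTI; apply: FF'; rewrite -[X in _ X]setTI; exact: mM.
Qed.

Lemma random_matrix_rows F n p (M : Omega -> 'M[R]_(n, p)) :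
  (forall i, random_matrix F (fun w => row i (M w))) -> random_matrix F M.
Proof.
move=> rM i j; have E : (fun w => row i (M w) 0 j) = (fun w => M w i j).
  by apply/funext => w; rewrite mxE.
by have := rM i 0 j; rewrite E.
Qed.

Lemma mdot_integrable F F' n p (M N : Omega -> 'M[R]_(n, p)) :
  random_matrix F M -> random_matrix F' N ->
  P.-integrable setT (EFin \o (fun w => mdot (M w) (N w))).
Proof.
move=> rM rN; under eq_fun do rewrite mdotE.
apply: integrable_sumP => i; apply: integrable_sumP => j.
by apply: integrable_mulP; [have [] := rM i j|have [] := rN i j].
Qed.

Lemma Ex_mdot F F' n p (M N : Omega -> 'M[R]_(n, p)) :
  random_matrix F M -> random_matrix F' N ->
  Ex P (fun w => mdot (M w) (N w)) =
  \sum_i \sum_j Ex P (fun w => M w i j * N w i j).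
Proof.
move=> rM rN; under [in LHS]eq_fun do rewrite mdotE.
have iMN i j : P.-integrable setT (EFin \o (fun w => M w i j * N w i j)).
  by apply: integrable_mulP; [have [] := rM i j|have [] := rN i j].
rewrite Ex_sum; last by move=> i; exact: integrable_sumP.
by apply: eq_bigr => i _; rewrite Ex_sum.
Qed.

End RandomMatrix.

(** * The filtration of the algorithm *)

Lemma cedas_stepE (R : realType) n p (Xi Z : Type) (c : cedas_params R n p Xi Z)
    eta xi zeta s :
  let y := st_x s - eta *: grad_matrix c (st_x s) xi - st_D s in
  let Q := compress_rows c (y - st_H s) zeta in
  let D' := st_D s + (cp_gamma c / 2) *: ((1%:M - cp_W c) *m (st_H s + Q)) in
  cedas_step c eta xi zeta s =
  CedasState (st_x s - eta *: grad_matrix c (st_x s) xi - D') D'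
    (st_H s + cp_alpha c *: Q).
Proof. by case: s. Qed.

Section Process.
Context {R : realType} {n p : nat} {d dXi dZ : measure_display}.
Context {Omega : measurableType d} {Xi : measurableType dXi} {Z : measurableType dZ}.
Variables (P : probability Omega R) (c : cedas_params R n p Xi Z).
Variables (xi : 'I_n -> nat -> Omega -> Xi) (zeta : 'I_n -> nat -> Omega -> Z).
Variables (f : 'I_n -> 'rV[R]_p -> R) (L sigma C : R).
Hypothesis rnd : cedas_randomness P c xi zeta.
Hypothesis fL : forall i, smooth L (f i).
Hypothesis gs : forall i t, stochastic_gradient P sigma (grad (f i)) (cp_grad c i)
  (iterate c xi zeta i t) (xi i t).
Hypothesis cC : forall i k, unbiased_compressor P C (cp_comp c) (zeta i k).

(* the samples xi_{i,t} and, for each iteration, the joint compression seeds *)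
Local Notation source := (('I_n * nat) + nat)%type.

Definition source_events (a : source) : set (set Omega) :=
  match a with
  | inl (i, t) => generated_sigma (xi i t)
  | inr k => <<s \bigcup_i generated_sigma (zeta i k) >>
  end.

Local Notation G := source_events.

Lemma generated_sigmaP d' (T : measurableType d') (X : Omega -> T) :
  sigma_algebra setT (generated_sigma X).
Proof. exact: sigma_algebra_preimage (sigma_algebra_measurable _). Qed.

Let sG a : sigma_algebra setT (G a).
Proof.
by case: a => [[i t]|k]; [exact: generated_sigmaP|exact: smallest_sigma_algebra].
Qed.

Let GI a : setI_closed (G a).
Proof.
move=> A B GA GB; rewrite -(sigma_algebra_id (sG a)).
by apply: (@measurableI _ (g_sigma_algebraType (G a))); exact: sub_sigma_algebra.
Qed.

Let GT a : G a setT.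
Proof. by have [G0 /(_ _ G0)] := sG a; rewrite setD0. Qed.

Let generated_sigma_measurable d' (T : measurableType d') (X : Omega -> T) :
  measurable_fun setT X -> generated_sigma X `<=` measurable.
Proof. by move=> mX _ [B mB <-]; exact: mX. Qed.

Let Gm a : G a `<=` measurable.
Proof.
case: a => [[i t]|k] /=.
  exact: generated_sigma_measurable (sample_measurable rnd i t).
apply: smallest_sub; first exact: sigma_algebra_measurable.
by move=> A [i _]; exact: generated_sigma_measurable (seed_measurable rnd i k) _.
Qed.

Let Gind : mutually_independent P G.
Proof. exact: randomness_independent rnd. Qed.

(** Past k is what the iterate k depends on, and past_sampled k is what is known
    just before the compression of iteration k. The sample index t stands for the
    iteration t - 1, hence the bound t <= k. *)
Definition past (k : nat) : set source :=
  [set a | match a with inl (_, t) => (t <= k)%N | inr k' => (k' < k)%N end].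
Definition past_sampled (k : nat) : set source :=
  [set a | match a with inl (_, t) => (t <= k.+1)%N | inr k' => (k' < k)%N end].

Local Notation F k := (events G (past k)).
Local Notation F' k := (events G (past_sampled k)).

Lemma events_sub (A B : set source) : A `<=` B -> <<s events G A >> `<=` <<s events G B >>.
Proof. by move=> AB; apply: sub_sigma_algebra2 => X [a /AB]; exists a. Qed.

Lemma past_sub k : <<s F k >> `<=` <<s F' k >>.
Proof. by apply: events_sub => -[[i t]|k'] //= tk; exact: leqW. Qed.

Lemma past_sampled_sub k : <<s F' k >> `<=` <<s F k.+1 >>.
Proof. by apply: events_sub => -[[i t]|k'] //= tk; exact: leqW. Qed.

Let Fm A : <<s events G A >> `<=` measurable.
Proof. exact: events_measurable Gm _. Qed.

Let xi_indep (A : set source) i t : ~ A (inl (i, t)) -> forall E B,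
  <<s events G A >> E -> measurable B ->
  P (E `&` xi i t @^-1` B) = (P E * P (xi i t @^-1` B))%E.
Proof.
move=> Ai E B sE mB; apply: (events_independent GI GT Gm Gind Ai sE).
by exists B => //; rewrite setTI.
Qed.

Let zeta_indep (A : set source) i k : ~ A (inr k) -> forall E B,
  <<s events G A >> E -> measurable B ->
  P (E `&` zeta i k @^-1` B) = (P E * P (zeta i k @^-1` B))%E.
Proof.
move=> Ai E B sE mB; apply: (events_independent GI GT Gm Gind Ai sE).
apply: sub_sigma_algebra; exists i => //; exists B => //; by rewrite setTI.
Qed.

Lemma xi_past (A : set source) i t : A (inl (i, t)) ->
  measurable_fun setT (xi i t : g_sigma_algebraType (events G A) -> Xi).
Proof.
move=> Ai _ B mB; apply: sub_sigma_algebra; exists (inl (i, t)) => //=.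
by exists B => //; rewrite setTI.
Qed.

Lemma zeta_past (A : set source) i k : A (inr k) ->
  measurable_fun setT (zeta i k : g_sigma_algebraType (events G A) -> Z).
Proof.
move=> Ai _ B mB; apply: sub_sigma_algebra; exists (inr k) => //=.
by apply: sub_sigma_algebra; exists i => //; exists B => //; rewrite setTI.
Qed.

Lemma random_eval (A : set source) dT (T : measurableType dT)
    (g : 'rV[R]_p -> T -> 'rV[R]_p) (x : Omega -> 'rV[R]_p) (X : Omega -> T) j :
  measurable_fun setT (fun z : @vecm R p * T => g z.1 z.2 : @vecm R p) ->
  (forall j, measurable_fun setT (fun w : g_sigma_algebraType (events G A) => x w 0 j)) ->
  measurable_fun setT (X : g_sigma_algebraType (events G A) -> T) ->
  measurable_fun setT (fun w : g_sigma_algebraType (events G A) => g (x w) (X w) 0 j).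
Proof.
move=> mg mx mX; move: j; apply/measurable_vecmP.
have m2 : measurable_fun setT
    (fun w : g_sigma_algebraType (events G A) => (x w : @vecm R p, X w)).
  by apply: measurable_fun_pair => //; apply/measurable_vecmP.
exact: (measurableT_comp mg m2).
Qed.

Definition state (k : nat) (w : Omega) : cedas_state :=
  cedas c (fun j t => xi j t w) (fun j t => zeta j t w) k.

Definition iter_x k w := st_x (state k w).
Definition iter_D k w := st_D (state k w).
Definition iter_H k w := st_H (state k w).

Definition grad_noise k w : 'M[R]_(n, p) :=
  grad_matrix c (iter_x k w) (fun i => xi i k.+1 w) - stack_grad f (iter_x k w).

Definition iter_y k w : 'M[R]_(n, p) :=
  iter_x k w - cp_eta c k.+1 *: (stack_grad f (iter_x k w) + grad_noise k w)
  - iter_D k w.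

Definition iter_u k w : 'M[R]_(n, p) := iter_y k w - iter_H k w.

Definition comp_noise k w : 'M[R]_(n, p) :=
  compress_rows c (iter_u k w) (fun i => zeta i k w) - iter_u k w.

Definition gossip_mx : 'M[R]_n := (cp_gamma c / 2) *: (1%:M - cp_W c).

Lemma stateS k w :
  [/\ iter_x k.+1 w = iter_y k w - gossip_mx *m (iter_y k w + comp_noise k w),
      iter_D k.+1 w = iter_D k w + gossip_mx *m (iter_y k w + comp_noise k w) &
      iter_H k.+1 w = iter_H k w + cp_alpha c *: (iter_u k w + comp_noise k w)].
Proof.
have yE : st_x (state k w) - cp_eta c k.+1 *:
    grad_matrix c (st_x (state k w)) (fun i => xi i k.+1 w) - st_D (state k w) = iter_y k w.
  by rewrite /iter_y /grad_noise [stack_grad _ _ + _]addrC subrK.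
have QE : compress_rows c (iter_y k w - st_H (state k w)) (fun i => zeta i k w) =
    iter_u k w + comp_noise k w.
  by rewrite /comp_noise [RHS]addrC subrK.
have HQ : st_H (state k w) + (iter_u k w + comp_noise k w) = iter_y k w + comp_noise k w.
  by rewrite addrA; congr (_ + _); rewrite /iter_u addrC subrK.
rewrite /iter_x /iter_D /iter_H /state /= cedas_stepE /= -/(state k w) yE QE HQ.
rewrite /gossip_mx -scalemxAl; split => //.
by rewrite opprD addrA yE.
Qed.

Lemma iterateS k i w : iterate c xi zeta i k.+1 w = row i (iter_x k w).
Proof. by []. Qed.

Lemma row_grad_noise k i w : row i (grad_noise k w) =
  cp_grad c i (iterate c xi zeta i k.+1 w) (xi i k.+1 w)
  - grad (f i) (iterate c xi zeta i k.+1 w).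
Proof. by rewrite iterateS /grad_noise linearB /= !rowK. Qed.

Lemma row_comp_noise k i w : row i (comp_noise k w) =
  cp_comp c (row i (iter_u k w)) (zeta i k w) - row i (iter_u k w).
Proof. by rewrite /comp_noise linearB /= rowK. Qed.

Section Oracle.
Variables (A : set source) (i : 'I_n) (t : nat).
Hypothesis Ait : ~ A (inl (i, t)).
Hypothesis mx : forall j, measurable_fun setT
  (fun w : g_sigma_algebraType (events G A) => iterate c xi zeta i t w 0 j).

Lemma oracle_noise_bound :
  P.-integrable setT (EFin \o (fun w => sqnorm (cp_grad c i (iterate c xi zeta i t w) (xi i t w)
      - grad (f i) (iterate c xi zeta i t w)))) /\
  Ex P (fun w => sqnorm (cp_grad c i (iterate c xi zeta i t w) (xi i t w)
      - grad (f i) (iterate c xi zeta i t w))) <= sigma ^+ 2.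
Proof. exact: gradient_noise_bound (gs i t). Qed.

Lemma oracle_noise_sq_integrable j :
  sq_integrable P (fun w => (cp_grad c i (iterate c xi zeta i t w) (xi i t w)
      - grad (f i) (iterate c xi zeta i t w)) 0 j).
Proof.
exact: (gradient_noise_sq_integrable (@Fm A) (sample_measurable rnd i t)
  (oracle_measurable rnd i) mx (gs i t)).
Qed.

Lemma oracle_noise_orthogonal (Y : Omega -> R) j :
  measurable_fun setT (Y : g_sigma_algebraType (events G A) -> R) -> sq_integrable P Y ->
  Ex P (fun w => (cp_grad c i (iterate c xi zeta i t w) (xi i t w)
      - grad (f i) (iterate c xi zeta i t w)) 0 j * Y w) = 0.
Proof.
exact: (gradient_noise_orthogonal (@Fm A) (sample_measurable rnd i t)
  (xi_indep Ait) (oracle_measurable rnd i) mx (gs i t)).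
Qed.

Lemma grad_measurable j : measurable_fun setT
  (fun w : g_sigma_algebraType (events G A) => grad (f i) (iterate c xi zeta i t w) 0 j).
Proof. exact: (measurable_gradient mx (gs i t)). Qed.

End Oracle.

(** By the Lipschitz bound the gradient grows at most linearly. *)
Lemma sq_integrable_grad (A : set source) i (x : Omega -> 'rV[R]_p) j :
  random_matrix P (events G A) x ->
  measurable_fun setT (fun w : g_sigma_algebraType (events G A) => grad (f i) (x w) 0 j) ->
  sq_integrable P (fun w => grad (f i) (x w) 0 j).
Proof.
move=> rx mgr; have mg : measurable_fun setT (fun w => grad (f i) (x w) 0 j).
  exact: (past_measurable (@Fm A) (f := fun w => grad (f i) (x w) 0 j) mgr).
split => //.
have ix : P.-integrable setT (EFin \o (fun w => mdot (x w) (x w))) by exact: (mdot_integrable rx rx).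
have i2 := integrable_addP (integrable_cstP P (2 * sqnorm (grad (f i) 0)))
   (integrable_scaleP (2 * L ^+ 2) ix).
apply: integrable_leP i2 _; first exact: measurable_funX.
move=> w; rewrite ger0_norm ?sqr_ge0//.
apply: (@le_trans _ _ (sqnorm (grad (f i) (x w)))).
  rewrite /sqnorm big_ord1 (bigD1 j)//= lerDl.
  by apply: sumr_ge0 => k _; exact: sqr_ge0.
rewrite -[grad (f i) (x w)](subrK (grad (f i) 0)) sqnormE.
apply: le_trans (mdot_sum_le2 _ _) _; rewrite addrC -!sqnormE lerD2l.
rewrite -mulrA ler_pM2l//; apply: le_trans (smooth_sqr _ _ (fL i)) _.
by rewrite subr0.
Qed.

Lemma random_stack_grad k : random_matrix P (F k) (iter_x k) ->
  random_matrix P (F k) (fun w => stack_grad f (iter_x k w)).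
Proof.
move=> rx i j.
have rxi : random_matrix P (F k) (fun w => row i (iter_x k w)).
  by move=> i' j'; under eq_fun do rewrite mxE; exact: rx.
have mxi j' : measurable_fun setT (fun w : g_sigma_algebraType (F k) =>
    iterate c xi zeta i k.+1 w 0 j') by have [] := rxi 0 j'.
have mg := grad_measurable mxi j.
under eq_fun do rewrite mxE; split; first exact: mg.
exact: (sq_integrable_grad rxi mg).
Qed.

Lemma grad_noiseE k w i j : grad_noise k w i j =
  (cp_grad c i (iterate c xi zeta i k.+1 w) (xi i k.+1 w)
  - grad (f i) (iterate c xi zeta i k.+1 w)) 0 j.
Proof. by rewrite -row_grad_noise [RHS]mxE. Qed.

Lemma comp_noiseE k w i j : comp_noise k w i j =
  (cp_comp c (row i (iter_u k w)) (zeta i k w) - row i (iter_u k w)) 0 j.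
Proof. by rewrite -row_comp_noise [RHS]mxE. Qed.

Lemma measurable_iterate (A : set source) k i j : past k `<=` A ->
  random_matrix P (F k) (iter_x k) ->
  measurable_fun setT (fun w : g_sigma_algebraType (events G A) =>
    iterate c xi zeta i k.+1 w 0 j).
Proof.
move=> kA rx; under eq_fun do rewrite iterateS mxE.
exact: (random_matrix_sub (events_sub kA) rx i j).1.
Qed.

Lemma measurable_grad_noise (A : set source) k i j : past k `<=` A ->
  A (inl (i, k.+1)) -> random_matrix P (F k) (iter_x k) ->
  measurable_fun setT (fun w : g_sigma_algebraType (events G A) => grad_noise k w i j).
Proof.
move=> kA Ai rx; have mx j' := measurable_iterate i j' kA rx.
under eq_fun do rewrite grad_noiseE mxE [X in _ + X]mxE.
apply: measurable_funB; last exact: (grad_measurable mx).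
apply: random_eval (oracle_measurable rnd i) mx _; exact: xi_past.
Qed.

Lemma random_grad_noise k : random_matrix P (F k) (iter_x k) ->
  random_matrix P (F' k) (grad_noise k).
Proof.
move=> rx i j; split; last first.
  under eq_fun do rewrite grad_noiseE.
  by apply: (@oracle_noise_sq_integrable (past k)) => j'; exact: measurable_iterate.
apply: measurable_grad_noise => //.
- by move=> -[[i' t]|k'] //= tk; exact: leqW.
- by rewrite /past_sampled /=.
Qed.

Lemma random_comp_noise k : random_matrix P (F' k) (iter_u k) ->
  random_matrix P (F k.+1) (comp_noise k).
Proof.
move=> ru; apply: random_matrix_rows => i i' j; rewrite ord1.
have rui : random_matrix P (F' k) (fun w => row i (iter_u k w)).
  by move=> i'' j'; under eq_fun do rewrite mxE; exact: ru.
have rui' := random_matrix_sub (@past_sampled_sub k) rui.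
have nk : ~ past_sampled k (inr k) by rewrite /past_sampled /= ltnn.
split; under eq_fun do rewrite row_comp_noise; last first.
  apply: (compressor_noise_sq_integrable (@Fm _) (seed_measurable rnd i k)
    (@zeta_indep _ i k nk) (compressor_measurable rnd) _ (cC i k)) => j'.
    by have [] := rui 0 j'.
  by have [] := rui 0 j'.
under eq_fun do rewrite mxE [X in _ + X]mxE; apply: measurable_funB; last first.
  exact: (rui' 0 j).1.
apply: random_eval (compressor_measurable rnd) _ _.
  by move=> j'; have [] := rui' 0 j'.
by apply: zeta_past; rewrite /past /=.
Qed.

Lemma random_sampled k : random_matrix P (F k) (iter_x k) ->
  random_matrix P (F k) (iter_D k) -> random_matrix P (F k) (iter_H k) ->
  random_matrix P (F' k) (iter_y k) /\ random_matrix P (F' k) (iter_u k).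
Proof.
move=> rx rD rH; have lift := random_matrix_sub (@past_sub k).
have ry : random_matrix P (F' k) (iter_y k).
  apply: random_matrixB; last exact: lift.
  apply: random_matrixB; first exact: lift.
  apply: random_matrixZ; apply: random_matrixD; last exact: random_grad_noise.
  exact: lift (random_stack_grad rx).
by split=> //; apply: random_matrixB => //; exact: lift.
Qed.

(** The joint induction over an iteration: x, D and H determine the gradients,
    these and the samples determine y and u, and the seeds determine the rest. *)
Lemma random_state k : [/\ random_matrix P (F k) (iter_x k),
  random_matrix P (F k) (iter_D k) & random_matrix P (F k) (iter_H k)].
Proof.
elim: k => [|k [rx rD rH]]; last first.
  have [ry ru] := random_sampled rx rD rH.
  have rT := random_comp_noise ru.
  have lift n' M (rM : random_matrix P (F k) M) : random_matrix P (F k.+1) (M : Omega -> 'M[R]_(n', p)).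
    exact: random_matrix_sub (@past_sampled_sub k) (random_matrix_sub (@past_sub k) rM).
  have ryT : random_matrix P (F k.+1) (fun w => gossip_mx *m (iter_y k w + comp_noise k w)).
    apply: random_matrix_mul; apply: random_matrixD => //.
    exact: random_matrix_sub (@past_sampled_sub k) ry.
  have -> : iter_x k.+1 = (fun w => iter_y k w - gossip_mx *m (iter_y k w + comp_noise k w)).
    by apply/funext => w; have [] := stateS k w.
  have -> : iter_D k.+1 = (fun w => iter_D k w + gossip_mx *m (iter_y k w + comp_noise k w)).
    by apply/funext => w; have [] := stateS k w.
  have -> : iter_H k.+1 = (fun w => iter_H k w + cp_alpha c *: (iter_u k w + comp_noise k w)).
    by apply/funext => w; have [] := stateS k w.
  split.
  - apply: random_matrixB => //; exact: random_matrix_sub (@past_sampled_sub k) ry.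
  - by apply: random_matrixD => //; exact: lift.
  - apply: random_matrixD; first exact: lift.
    apply: random_matrixZ; apply: random_matrixD => //.
    exact: random_matrix_sub (@past_sampled_sub k) ru.
split; [|exact: random_matrix_cst|exact: random_matrix_cst].
rewrite /iter_x /state /=; apply: random_matrixB; first exact: random_matrix_cst.
apply: random_matrixZ => i j; under eq_fun do rewrite mxE.
split.
  apply: random_eval (oracle_measurable rnd i) _ _; first by move=> j'; exact: measurable_cst.
  by apply: xi_past; rewrite /past /=.
have m0 j' : measurable_fun setT
    (fun w : g_sigma_algebraType (events G set0) => iterate c xi zeta i 0 w 0 j').
  exact: (measurable_cst (row i (cp_x c) 0 j')).
have := sq_integrableD (oracle_noise_sq_integrable m0 j)
  (sq_integrable_cst P (grad (f i) (row i (cp_x c)) 0 j)).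
congr sq_integrable; apply/funext => w; rewrite mxE [X in _ + X + _]mxE.
by rewrite subrK.
Qed.

Section Noise.
Variable k : nat.

Let rx := let: And3 rx _ _ := random_state k in rx.
Let ru : random_matrix P (F' k) (iter_u k).
Proof. by have [rx' rD rH] := random_state k; have [] := random_sampled rx' rD rH. Qed.

Lemma Ex_grad_noise_dot (Y : Omega -> 'M[R]_(n, p)) : random_matrix P (F k) Y ->
  Ex P (fun w => mdot (grad_noise k w) (Y w)) = 0.
Proof.
move=> rY; rewrite (Ex_mdot (random_grad_noise rx) rY).
rewrite big1// => i _; rewrite big1// => j _.
under eq_fun do rewrite grad_noiseE.
apply: (@oracle_noise_orthogonal (past k)); last exact: (rY i j).2.
- by rewrite /past /= ltnn.
- by move=> j'; exact: measurable_iterate.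
- exact: (rY i j).1.
Qed.

Lemma Ex_grad_noise_sq :
  Ex P (fun w => mdot (grad_noise k w) (grad_noise k w)) <= n%:R * sigma ^+ 2.
Proof.
under eq_fun do rewrite -sqnormE sqnorm_rows.
rewrite Ex_sum => [|i]; last first.
  by under eq_fun do rewrite row_grad_noise; have [] := oracle_noise_bound i k.+1.
rewrite -[X in X%:R](card_ord n) mulr_natl -sumr_const.
apply: ler_sum => i _; under eq_fun do rewrite row_grad_noise.
by have [] := oracle_noise_bound i k.+1.
Qed.

(** Conditionally on the past and on the sample of agent i', the noise of agent i
    still has mean zero. *)
Lemma Ex_grad_noise_cross i i' j : i != i' ->
  Ex P (fun w => grad_noise k w i j * grad_noise k w i' j) = 0.
Proof.
move=> ii'; pose A : set source := [set a | past_sampled k a /\ a != inl (i, k.+1)].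
have kA : past k `<=` A.
  move=> [[i1 t]|k'] /= tk; split => //; first exact: leqW.
  by apply/eqP => -[_ tE]; move: tk; rewrite tE ltnn.
under eq_fun do rewrite grad_noiseE.
apply: (@oracle_noise_orthogonal A).
- by move=> [_]; rewrite eqxx.
- by move=> j'; exact: measurable_iterate.
- apply: measurable_grad_noise => //; split; rewrite /past_sampled //=.
  by apply/eqP => -[i'i]; rewrite i'i eqxx in ii'.
- exact: (random_grad_noise rx i' j).2.
Qed.

(** The noises of different agents being orthogonal, averaging over the agents
    divides the variance by their number. *)
Lemma Ex_avg_noise_sq : (0 < n)%N ->
  Ex P (fun w => mdot (avg R n *m grad_noise k w) (avg R n *m grad_noise k w)) <= sigma ^+ 2.
Proof.
move=> n0; have rS := random_grad_noise rx.
have nR : (n%:R : R) != 0 by rewrite pnatr_eq0 -lt0n.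
have i2 i i' j : P.-integrable setT (EFin \o (fun w => grad_noise k w i j * grad_noise k w i' j)).
  by apply: integrable_mulP; [exact: (rS i j).2|exact: (rS i' j).2].
have -> : Ex P (fun w => mdot (avg R n *m grad_noise k w) (avg R n *m grad_noise k w)) =
    n%:R^-1 * Ex P (fun w => mdot (grad_noise k w) (grad_noise k w)).
  under eq_fun do rewrite mdot_sym ?avg_sym// mulmxA avg_idem//.
  rewrite (Ex_mdot rS (random_matrix_mul (avg R n) rS)) (Ex_mdot rS rS) mulr_sumr.
  apply: eq_bigr => i _; rewrite mulr_sumr; apply: eq_bigr => j _.
  transitivity (Ex P (fun w => \sum_i' n%:R^-1 * (grad_noise k w i j * grad_noise k w i' j))).
    congr Ex; apply/funext => w; rewrite [X in _ * X]mxE mulr_sumr; apply: eq_bigr => i' _.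
    by rewrite [avg _ _ _ _]mxE mulrCA.
  rewrite Ex_sum => [|i']; last exact: integrable_scaleP.
  rewrite (bigD1 i)//= ExZ// big1 ?addr0// => i' i'i.
  by rewrite ExZ// Ex_grad_noise_cross ?mulr0// eq_sym.
by rewrite -(ler_pM2l (_ : 0 < n%:R)) ?ltr0n// mulrA mulfV// mul1r Ex_grad_noise_sq.
Qed.

Lemma Ex_comp_noise_dot (Y : Omega -> 'M[R]_(n, p)) : random_matrix P (F' k) Y ->
  Ex P (fun w => mdot (comp_noise k w) (Y w)) = 0.
Proof.
move=> rY; rewrite (Ex_mdot (random_comp_noise ru) rY).
rewrite big1// => i _; rewrite big1// => j _.
under eq_fun do rewrite comp_noiseE.
have rui : random_matrix P (F' k) (fun w => row i (iter_u k w)).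
  by move=> i'' j'; under eq_fun do rewrite mxE; exact: ru.
have nk : ~ past_sampled k (inr k) by rewrite /past_sampled /= ltnn.
apply: (compressor_noise_orthogonal (@Fm _) (seed_measurable rnd i k)
    (@zeta_indep _ i k nk) (compressor_measurable rnd) _ (cC i k)).
- by move=> j'; exact: (rui 0 j').1.
- by move=> j'; exact: (rui 0 j').2.
- exact: (rY i j).1.
- exact: (rY i j).2.
Qed.

Lemma Ex_comp_noise_sq : Ex P (fun w => mdot (comp_noise k w) (comp_noise k w)) <=
  C * Ex P (fun w => mdot (iter_u k w) (iter_u k w)).
Proof.
have rui i : random_matrix P (F' k) (fun w => row i (iter_u k w)).
  by move=> i'' j'; under eq_fun do rewrite mxE; exact: ru.
have nk : ~ past_sampled k (inr k) by rewrite /past_sampled /= ltnn.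
have bd i := compressor_noise_bound (@Fm _) (seed_measurable rnd i k)
  (@zeta_indep _ i k nk) (compressor_measurable rnd) (fun j' => (rui i 0 j').1) (cC i k)
  (fun j' => (rui i 0 j').2).
under eq_fun do rewrite -sqnormE sqnorm_rows.
under [X in _ <= _ * Ex _ X]eq_fun do rewrite -sqnormE sqnorm_rows.
rewrite Ex_sum => [|i]; last by under eq_fun do rewrite row_comp_noise; have [] := bd i.
rewrite Ex_sum => [|i]; last first.
  by under eq_fun do rewrite sqnormE; exact: (mdot_integrable (rui i) (rui i)).
rewrite mulr_sumr; apply: ler_sum => i _.
by under eq_fun do rewrite row_comp_noise; have [] := bd i.
Qed.

End Noise.

End Process.

(** * The expected recursions *)

Lemma mdot_sum_le3 (R : realType) m n (A B C : 'M[R]_(m, n)) :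
  mdot (A + B + C) (A + B + C) <= 3 * (mdot A A + mdot B B + mdot C C).
Proof.
have c0 : (0 : R) < 2^-1 by rewrite invr_gt0.
have h1 := mdot_sum_le (A + B) C c0; have h2 := mdot_sum_le2 A B.
by move: h1 h2; rewrite invrK; lra.
Qed.

(* The next lemmas isolate the arithmetic of the estimates below from their large
   contexts. *)
Lemma init_arith (R : realDomainType) (c x d h2 G M w s : R) :
  c <= x -> x <= 2 * d + 2 * (h2 * G) -> h2 * G <= h2 * (3 * M) -> w <= h2 * G ->
  c + s + w <= 2 * d + 9 * h2 * M + s.
Proof. by lra. Qed.

Lemma mean_cancel (R : realDomainType) (a0 a1 a2 s s' t : R) :
  0 <= a2 -> s <= s' -> t = 0 ->
  a0 + (a1 + (a2 * s + (1 * t + 0))) <= a0 + a1 + a2 * s'.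
Proof. by move=> a20 ss ->; have := ler_wpM2l a20 ss; lra. Qed.

Lemma init_regroup (R : comNzRingType) (d h2 N M s : R) :
  2 * d + 9 * h2 * M + s + 9 * h2 * N = 2 * d + 9 * h2 * (N + M) + s.
Proof. by ring. Qed.

Lemma lincomb_regroup (R : realDomainType) (C v v0 c0 c1 c2 c3 c4 c5 x1 x2 x3 x4 x5 x6 : R) :
  v <= c0 * v0 + c1 * x1 + c2 * x2 + c3 + c5 * (c4 * (x3 - C * x4) + x5 + x6) ->
  v <= c0 * v0 + (c1 * x1 + (c2 * x2 + (c3 * 1 + (c5 * c4 * x3
    + (- (c5 * c4 * C) * x4 + (c5 * x5 + (c5 * x6 + 0))))))).
Proof. by lra. Qed.

Lemma noise_cancel (R : realDomainType) (C c5 c4 a0 a1 a2 a3 s s' t u : R) :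
  c5 * c4 * t <= c5 * c4 * (C * u) -> a2 * s <= a2 * s' ->
  a0 + (a1 + (a2 * s + (a3 * 1 + (c5 * c4 * t + (- (c5 * c4 * C) * u
    + (c5 * 0 + (c5 * 0 + 0))))))) <= a0 + a1 + a2 * s' + a3.
Proof. by lra. Qed.

Section Recursions.
Context {R : realType} {n p : nat} {d dXi dZ : measure_display}.
Context {Omega : measurableType d} {Xi : measurableType dXi} {Z : measurableType dZ}.
Variables (P : probability Omega R) (c : cedas_params R n p Xi Z).
Variables (xi : 'I_n -> nat -> Omega -> Xi) (zeta : 'I_n -> nat -> Omega -> Z).
Variables (f : 'I_n -> 'rV[R]_p -> R) (L mu sigma C : R) (xstar : 'rV[R]_p).
Hypothesis rnd : cedas_randomness P c xi zeta.
Hypothesis fL : forall i, smooth L (f i).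
Hypothesis fmu : strongly_convex mu (average_cost f).
Hypothesis fmin : is_minimizer (average_cost f) xstar.
Hypothesis gs : forall i t, stochastic_gradient P sigma (grad (f i)) (cp_grad c i)
  (iterate c xi zeta i t) (xi i t).
Hypothesis cC : forall i k, unbiased_compressor P C (cp_comp c) (zeta i k).

Variables (g b om : R).
Local Notation B := (gossip_mx c).
Local Notation al := (cp_alpha c).
Hypotheses (Bg : gossip g b B) (n0 : (0 < n)%N).
Hypotheses (b0 : 0 < b) (bg : b <= g) (al0 : 0 < al) (al4 : al <= 1 / 4).
Hypotheses (C0 : 0 < C) (gal : g <= al / 4) (alC : al * C <= 1 / 4).
Hypotheses (gC : g * C <= al ^+ 2 / 400) (omE : om * al = 8 * g * C).
Hypotheses (L0 : 0 <= L) (mu0 : 0 < mu).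
Hypothesis eta0 : forall k, 0 < cp_eta c k.+1.
Hypothesis etaL : forall k, cp_eta c k.+1 * L <= b / 24.

Local Notation eta k := (cp_eta c k.+1).
Local Notation X k := (iter_x c xi zeta k).
Local Notation D k := (iter_D c xi zeta k).
Local Notation H k := (iter_H c xi zeta k).
Local Notation S k := (grad_noise c xi zeta f k).
Local Notation T k := (comp_noise c xi zeta f k).
Local Notation U k := (iter_u c xi zeta f k).
Local Notation F k := (events (source_events xi zeta) (@past n k)).
Local Notation F' k := (events (source_events xi zeta) (@past_sampled n k)).

Definition star_grad : 'M[R]_(n, p) := stack_grad f (ones xstar).
(** At the fixed point D is - eta times the image of this matrix under B. *)
Definition star_dual : 'M[R]_(n, p) := @gossip_pinv R n B *m star_grad.

(* the errors with respect to the fixed point, at which all the rows of x and H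
   are xstar and D is - eta times the gradients at xstar *)
Definition err_x k w : 'M[R]_(n, p) := X k w - ones xstar.
Definition err_q k w : 'M[R]_(n, p) := @gossip_pinv R n B *m (D k w + eta k *: star_grad).
Definition err_w k w : 'M[R]_(n, p) := X k w - H k w.
Definition err_grad k w : 'M[R]_(n, p) := stack_grad f (X k w) - star_grad.
Definition err_y k w : 'M[R]_(n, p) :=
  y_mean B (eta k) (err_x k w) (err_q k w) (err_grad k w) - eta k *: S k w.

Let avg_star : avg R n *m star_grad = 0.
Proof. exact: (avg_stack_grad_min fL fmin). Qed.

(** D starts at 0 and only moves in the range of the gossip operator, so that B q
    can represent its error. *)
Lemma avg_D k w : avg R n *m D k w = 0.
Proof.
elim: k => [|k IH]; first by rewrite /iter_D /state /= mulmx0.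
have [_ -> _] := stateS c xi zeta f k w.
by rewrite mulmxDr IH mulmxA (avg_gossip Bg) mul0mx addr0.
Qed.

Lemma gossip_err_q k w : B *m err_q k w = D k w + eta k *: star_grad.
Proof.
rewrite mulmxA (gossipK Bg b0 n0) mulmxBl mul1mx mulmxDr avg_D -scalemxAr avg_star.
by rewrite scaler0 addr0 subr0.
Qed.

Lemma iter_yE k w : iter_y c xi zeta f k w = ones xstar + err_y k w.
Proof.
rewrite /err_y /y_mean gossip_err_q /err_x /err_grad /iter_y.
rewrite -/(X k w) -/(D k w) -/(S k w).
move: (X k w) (D k w) (S k w) (stack_grad f (X k w)) => x dd s gx.
by apply/matrixP => i j; rewrite !mxE; ring.
Qed.

Lemma iter_uE k w :
  U k w = u_mean B (eta k) (err_w k w) (err_q k w) (err_grad k w) - eta k *: S k w.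
Proof.
rewrite /iter_u iter_yE /err_y /y_mean /u_mean /err_w /err_x.
move: (X k w) (H k w) (B *m _) (err_grad k w) (S k w) => x h bq gx s.
by apply/matrixP => i j; rewrite !mxE; ring.
Qed.

Let gossip_shift (M N : 'M[R]_(n, p)) : B *m (ones xstar + M + N) = B *m (M + N).
Proof. by rewrite -addrA mulmxDr (gossip_ones n0 _ Bg) add0r. Qed.

Lemma err_xS k w : err_x k.+1 w = err_y k w - B *m (err_y k w + T k w).
Proof.
rewrite /err_x; have [-> _ _] := stateS c xi zeta f k w.
rewrite iter_yE gossip_shift.
move: (err_y k w) (B *m _) (ones xstar) => y z o.
by apply/matrixP => i j; rewrite !mxE; ring.
Qed.

Lemma err_wS k w : err_w k.+1 w =
  (1 - al) *: U k w - B *m err_y k w - (al *: T k w + B *m T k w).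
Proof.
rewrite /err_w; have [-> _ ->] := stateS c xi zeta f k w.
rewrite [in B *m _]iter_yE gossip_shift mulmxDr.
rewrite /iter_u; move: (B *m err_y k w) (B *m T k w) (T k w) => by_ bt t.
move: (iter_y _ _ _ _ k w) (H k w) => y h.
by apply/matrixP => i j; rewrite !mxE; ring.
Qed.

Lemma err_qS k w : err_q k.+1 w =
  err_q k w + cen R n *m (err_y k w + T k w) + (eta k.+1 - eta k) *: star_dual.
Proof.
rewrite [LHS]/err_q; have [_ -> _] := stateS c xi zeta f k w.
rewrite iter_yE gossip_shift.
have -> : D k w + B *m (err_y k w + T k w) + eta k.+1 *: star_grad =
   (D k w + eta k *: star_grad) + B *m (err_y k w + T k w) + (eta k.+1 - eta k) *: star_grad.
  move: (D k w) (B *m _) (star_grad) => x z s.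
  by apply/matrixP => i j; rewrite !mxE; ring.
rewrite 2!(mulmxDr (@gossip_pinv R n B)) -[V in _ + V = _]scalemxAr.
by rewrite [V in _ + V + _ = _]mulmxA (gossip_pinvK Bg b0 n0).
Qed.

Definition lyap k w : R := lyapunov om B (err_x k w) (err_q k w) (err_w k w).
Definition mean_err k w : R := mdot (avg R n *m err_x k w) (avg R n *m err_x k w).

(** Only B q matters, so the projection of the increment of q may be dropped. *)
Lemma lyapS k w : lyap k.+1 w =
  lyapunov om B (err_y k w - B *m (err_y k w + T k w))
    (err_q k w + err_y k w + T k w + (eta k.+1 - eta k) *: star_dual)
    ((1 - al) *: U k w - B *m err_y k w - (al *: T k w + B *m T k w)).
Proof.
rewrite /lyap /lyapunov err_xS err_wS; congr (_ + _ + _).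
rewrite err_qS.
set qa := _ + _ + _; set qb := (V in _ = mdot V _).
have BB : B *m qa = B *m qb.
  rewrite /qa /qb; move: (err_q k w) (err_y k w) (T k w) (_ *: star_dual) => q y t s.
  by rewrite !mulmxDr !(gossip_cenM Bg) !addrA.
by rewrite BB -(mdot_gossip Bg) BB (mdot_gossip Bg).
Qed.

Let random_err k :
  [/\ random_matrix P (F k) (err_x k), random_matrix P (F k) (err_q k),
      random_matrix P (F k) (err_w k) & random_matrix P (F k) (err_grad k)].
Proof.
have [rx rD rH] := random_state rnd fL gs cC k; split.
- by apply: random_matrixB => //; exact: random_matrix_cst.
- apply: random_matrix_mul; apply: random_matrixD => //; exact: random_matrix_cst.
- exact: random_matrixB.
- apply: random_matrixB; last exact: random_matrix_cst.
  exact: (random_stack_grad rnd fL gs rx).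
Qed.

Let lift k (M : Omega -> 'M[R]_(n, p)) :
  random_matrix P (F k) M -> random_matrix P (F' k) M.
Proof. by apply: random_matrix_sub; exact: past_sub. Qed.

Let random_S k : random_matrix P (F' k) (S k).
Proof.
by have [rx _ _] := random_state rnd fL gs cC k; exact: (random_grad_noise rnd gs rx).
Qed.

Let random_U k : random_matrix P (F' k) (U k).
Proof.
have [rx rD rH] := random_state rnd fL gs cC k.
by have [] := random_sampled rnd fL gs rx rD rH.
Qed.

Let random_T k : random_matrix P (F k.+1) (T k).
Proof. exact: (random_comp_noise rnd cC (random_U k)). Qed.

Let random_y_mean k : random_matrix P (F k)
  (fun w => y_mean B (eta k) (err_x k w) (err_q k w) (err_grad k w)).
Proof.
have [re rq rw rg] := random_err k; rewrite /y_mean.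
apply: random_matrixB; last exact: random_matrixZ.
by apply: random_matrixB => //; exact: random_matrix_mul.
Qed.

Let random_y k : random_matrix P (F' k) (err_y k).
Proof.
have h : random_matrix P (F' k) (fun w =>
    y_mean B (eta k) (err_x k w) (err_q k w) (err_grad k w) - eta k *: S k w).
  apply: random_matrixB; last by apply: random_matrixZ.
  exact: lift (random_y_mean k).
exact: h.
Qed.

Lemma lyap_integrable k : P.-integrable setT (EFin \o lyap k).
Proof.
have [re rq rw _] := random_err k; rewrite /lyap /lyapunov.
apply: integrable_addP; last first.
  by apply: integrable_scaleP; exact: (mdot_integrable rw rw).
apply: integrable_addP; last exact: (mdot_integrable rq (random_matrix_mul B rq)).
exact: (mdot_integrable (random_matrix_mul (cen R n) re) (random_matrix_mul (cen R n) re)).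
Qed.

Lemma mean_err_integrable k : P.-integrable setT (EFin \o mean_err k).
Proof.
have [re _ _ _] := random_err k.
exact: (mdot_integrable (random_matrix_mul (avg R n) re) (random_matrix_mul (avg R n) re)).
Qed.

Let coef_T_ge0 : 0 <= coef_T g al om.
Proof.
have g0 : 0 < g := lt_le_trans b0 bg.
have om0 : 0 < om by rewrite -(pmulr_lgt0 _ al0) omE !mulr_gt0.
apply: addr_ge0; first by rewrite addr_ge0 ?sqr_ge0 ?(ltW g0).
by apply: mulr_ge0; [exact: ltW|exact: sqr_ge0].
Qed.

Let om_gt0 : 0 < om.
Proof.
have g0 : 0 < g := lt_le_trans b0 bg.
by rewrite -(pmulr_lgt0 _ al0) omE !mulr_gt0.
Qed.

Lemma lyap_step k w : lyap k.+1 w <= (1 - b / 64) * lyap k w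
  + 20 * L ^+ 2 / b * eta k ^+ 2 * mean_err k w
  + 4 * eta k ^+ 2 * mdot (S k w) (S k w)
  + 17 / b * ((eta k.+1 - eta k) ^+ 2 * mdot star_dual (B *m star_dual))
  + (1 + b / 16) * (coef_T g al om * (mdot (T k w) (T k w) - C * mdot (U k w) (U k w))
    + mdot (T k w) (cross_T al om B (err_y k w) (err_q k w) (U k w))
    + mdot (S k w) (cross_S al om B (eta k) (err_x k w) (err_q k w) (err_w k w) (err_grad k w))).
Proof.
have ftL : mdot (err_grad k w) (err_grad k w) <= L ^+ 2 * mdot (err_x k w) (err_x k w).
  exact: stack_grad_lipschitz.
have yE : err_y k w =
  y_mean B (eta k) (err_x k w) (err_q k w) (err_grad k w) - eta k *: S k w by [].
have uE := iter_uE k w; rewrite lyapS.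
exact: (lyapunov_descent Bg n0 b0 bg al0 al4 C0 gal alC gC omE
    (eta k.+1 - eta k) (T k w) star_dual (ltW (eta0 k)) (etaL k) L0 ftL yE uE).
Qed.

Lemma Ex_lyap_step k : Ex P (lyap k.+1) <= (1 - b / 64) * Ex P (lyap k)
  + 20 * L ^+ 2 / b * eta k ^+ 2 * Ex P (mean_err k)
  + 4 * eta k ^+ 2 * (n%:R * sigma ^+ 2)
  + 17 / b * ((eta k.+1 - eta k) ^+ 2 * mdot star_dual (B *m star_dual)).
Proof.
have [re rq rw rg] := random_err k.
pose Z1 w := cross_T al om B (err_y k w) (err_q k w) (U k w).
pose Z2 w := cross_S al om B (eta k) (err_x k w) (err_q k w) (err_w k w) (err_grad k w).
have rZ1 : random_matrix P (F' k) Z1.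
  have ry := random_y k; have rU := random_U k; have rq' := lift rq.
  rewrite /Z1 /cross_T.
  have rk : random_matrix P (F' k) (fun w => (1 - al) *: U k w - B *m err_y k w).
    by apply: random_matrixB; [exact: random_matrixZ|exact: random_matrix_mul].
  apply: random_matrixZ; apply: random_matrixB.
    apply: random_matrixB; apply: random_matrix_mul; first exact: random_matrixD.
    by apply: random_matrixB; exact: random_matrix_mul.
  apply: random_matrixZ; apply: random_matrixD; first exact: random_matrixZ.
  exact: random_matrix_mul.
have rZ2 : random_matrix P (F k) Z2.
  have rym := random_y_mean k; rewrite /Z2 /cross_S /u_mean.
  apply: random_matrixZ; apply: random_matrixB.
    apply: random_matrixB; first exact: random_matrix_mul.
    apply: random_matrixZ; apply: random_matrix_mul; apply: random_matrixD;
    exact: random_matrix_mul.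
  apply: random_matrixZ; apply: random_matrixB; last exact: random_matrixZ.
  by apply: random_matrixB => //; exact: random_matrix_mul.
pose c5 := 1 + b / 16.
have c50 : 0 <= c5 by rewrite /c5; move: b0; lra.
pose rhs : seq (R * (Omega -> R)) := [:: (1 - b / 64, lyap k);
  (20 * L ^+ 2 / b * eta k ^+ 2, mean_err k);
  (4 * eta k ^+ 2, fun w => mdot (S k w) (S k w));
  (17 / b * ((eta k.+1 - eta k) ^+ 2 * mdot star_dual (B *m star_dual)), fun=> 1);
  (c5 * coef_T g al om, fun w => mdot (T k w) (T k w));
  (- (c5 * coef_T g al om * C), fun w => mdot (U k w) (U k w));
  (c5, fun w => mdot (T k w) (Z1 w)); (c5, fun w => mdot (S k w) (Z2 w))].
have [irhs Erhs] : P.-integrable setT (EFin \o (fun w => foldr (fun t r => t.1 * t.2 w + r) 0 rhs)) /\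
  Ex P (fun w => foldr (fun t r => t.1 * t.2 w + r) 0 rhs) =
    foldr (fun t r => t.1 * Ex P t.2 + r) 0 rhs.
  apply: Ex_lincomb; do !split => //.
  - exact: lyap_integrable.
  - exact: mean_err_integrable.
  - exact: (mdot_integrable (random_S k) (random_S k)).
  - exact: integrable_cstP.
  - exact: (mdot_integrable (random_T k) (random_T k)).
  - exact: (mdot_integrable (random_U k) (random_U k)).
  - exact: (mdot_integrable (random_T k) rZ1).
  - exact: (mdot_integrable (random_S k) rZ2).
have := Ex_le (lyap_integrable k.+1) irhs _.
rewrite Erhs /= => /(_ _)/le_trans; apply.
  by move=> w; apply: lincomb_regroup; exact: lyap_step.
rewrite Ex_cst (Ex_comp_noise_dot rnd fL gs cC rZ1) (Ex_grad_noise_dot rnd fL gs cC rZ2).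
have h1 := ler_wpM2l (mulr_ge0 c50 coef_T_ge0) (Ex_comp_noise_sq rnd fL gs cC k).
have h2 := ler_wpM2l (_ : 0 <= 4 * eta k ^+ 2) (Ex_grad_noise_sq gs k).
have {}h2 := h2 (mulr_ge0 (ler0n _ 4) (sqr_ge0 _)).
exact: noise_cancel h1 h2.
Qed.

Lemma avg_err_xS k w : avg R n *m err_x k.+1 w =
  avg R n *m err_x k w - eta k *: (avg R n *m err_grad k w) - eta k *: (avg R n *m S k w).
Proof.
rewrite err_xS mulmxBr mulmxA (avg_gossip Bg) mul0mx subr0 /err_y /y_mean.
move: (err_x k w) (err_grad k w) (err_q k w) (S k w) => x z v s.
rewrite !mulmxBr -!scalemxAr mulmxA (avg_gossip Bg) mul0mx subr0 //.
Qed.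

Lemma mean_step (eps : R) k w : 0 < eps -> eps * mu * eta k <= 1 ->
  mean_err k.+1 w <= (1 - (2 - eps) * mu * eta k + 2 * eta k ^+ 2 * L ^+ 2) * mean_err k w
  + 2 * eta k * L ^+ 2 / (eps * mu) * mdot (cen R n *m err_x k w) (cen R n *m err_x k w)
  + eta k ^+ 2 * mdot (avg R n *m S k w) (avg R n *m S k w)
  + mdot (S k w) (cross_mean (eta k) (err_x k w) (err_grad k w)).
Proof.
move=> eps0 epse.
pose phi := stack_grad f (avg R n *m X k w) - star_grad.
pose rho := stack_grad f (X k w) - stack_grad f (avg R n *m X k w).
have gE : err_grad k w = phi + rho by rewrite /phi /rho addrC addrA subrK.
rewrite /mean_err avg_err_xS gE.
apply: (mean_descent n0 _ mu0 (eta0 k) eps0 epse).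
- exact: (stack_grad_strongly_convex n0 _ fL fmu).
- exact: (stack_grad_mean_smooth n0 _ fL).
- exact: (stack_grad_consensus_smooth n0 _ fL).
Qed.

(** The disagreement is one of the terms of the Lyapunov function. *)
Lemma Ex_mean_step (eps : R) k : 0 < eps -> eps * mu * eta k <= 1 ->
  Ex P (mean_err k.+1) <=
  (1 - (2 - eps) * mu * eta k + 2 * eta k ^+ 2 * L ^+ 2) * Ex P (mean_err k)
  + 2 * eta k * L ^+ 2 / (eps * mu) * Ex P (lyap k) + eta k ^+ 2 * sigma ^+ 2.
Proof.
move=> eps0 epse; have [re rq rw rg] := random_err k.
pose Z3 w := cross_mean (eta k) (err_x k w) (err_grad k w).
have rZ3 : random_matrix P (F k) Z3.
  rewrite /Z3 /cross_mean; apply: random_matrixZ; apply: random_matrix_mul.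
  apply: random_matrixB; first exact: random_matrix_mul.
  by apply: random_matrixZ; exact: random_matrix_mul.
have rA := random_matrix_mul (avg R n) (random_S k).
pose rhs : seq (R * (Omega -> R)) :=
  [:: (1 - (2 - eps) * mu * eta k + 2 * eta k ^+ 2 * L ^+ 2, mean_err k);
  (2 * eta k * L ^+ 2 / (eps * mu), lyap k);
  (eta k ^+ 2, fun w => mdot (avg R n *m S k w) (avg R n *m S k w));
  (1, fun w => mdot (S k w) (Z3 w))].
have [irhs Erhs] : P.-integrable setT (EFin \o (fun w => foldr (fun t r => t.1 * t.2 w + r) 0 rhs)) /\
  Ex P (fun w => foldr (fun t r => t.1 * t.2 w + r) 0 rhs) =
    foldr (fun t r => t.1 * Ex P t.2 + r) 0 rhs.
  apply: Ex_lincomb; do !split => //.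
  - exact: mean_err_integrable.
  - exact: lyap_integrable.
  - exact: (mdot_integrable rA rA).
  - exact: (mdot_integrable (random_S k) rZ3).
have := Ex_le (mean_err_integrable k.+1) irhs _.
rewrite Erhs /= => /(_ _)/le_trans; apply.
  move=> w; apply: le_trans (mean_step w eps0 epse) _.
  rewrite addr0 mul1r 2!addrA lerD2r lerD2r lerD2l; apply: ler_wpM2l.
    rewrite mulr_ge0 ?invr_ge0 ?mulr_ge0 ?sqr_ge0 ?(ltW eps0) ?(ltW mu0)//.
    exact: ltW.
  rewrite /lyap /lyapunov -addrA lerDl addr_ge0 ?(gossip_ge0 Bg b0)//.
  by rewrite mulr_ge0 ?mdot_ge0 ?(ltW om_gt0).
apply: mean_cancel (sqr_ge0 _) (Ex_avg_noise_sq rnd fL gs cC k n0) _.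
exact: (Ex_grad_noise_dot rnd fL gs cC rZ3).
Qed.

Hypothesis HX : cp_H c = cp_x c.

Local Notation h := (cp_eta c 0).
Local Notation D0 := (mdot (cp_x c - ones xstar) (cp_x c - ones xstar)).

Definition init_noise w : 'M[R]_(n, p) :=
  grad_matrix c (cp_x c) (fun i => xi i 0%N w) - stack_grad f (cp_x c).

(** The first gradient step, from the common initial value of x and H, is part of
    the initialization; its size enters through the stepsize of index 0. *)
Definition init_bound : R :=
  2 * D0 + 9 * h ^+ 2 * (n%:R * sigma ^+ 2 + L ^+ 2 * D0 + mdot star_grad star_grad)
  + eta 0 ^+ 2 * mdot star_dual (B *m star_dual).

Lemma init_noise_bound :
  P.-integrable setT (EFin \o (fun w => mdot (init_noise w) (init_noise w))) /\
  Ex P (fun w => mdot (init_noise w) (init_noise w)) <= n%:R * sigma ^+ 2.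
Proof.
have E w : mdot (init_noise w) (init_noise w) = \sum_i sqnorm
    (cp_grad c i (iterate c xi zeta i 0 w) (xi i 0%N w)
      - grad (f i) (iterate c xi zeta i 0 w)).
  rewrite -sqnormE sqnorm_rows; apply: eq_bigr => i _.
  by rewrite /init_noise linearB /= !rowK.
under eq_fun do rewrite E.
split; first by apply: integrable_sumP => i; have [] := oracle_noise_bound gs i 0.
rewrite Ex_sum => [|i]; last by have [] := oracle_noise_bound gs i 0.
rewrite -[V in V%:R](card_ord n) mulr_natl -sumr_const.
by apply: ler_sum => i _; have [] := oracle_noise_bound gs i 0.
Qed.

Let om1 : om <= 1.
Proof.
rewrite -(ler_pM2r al0) omE mul1r; move: gC al4 al0; rewrite expr2 => h1 h2 h3.
have := ler_wpM2l (ltW al0) al4; move: h1 h2 h3; lra.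
Qed.

Lemma init_step w :
  mdot (err_x 0 w) (err_x 0 w) <= 2 * D0 + 6 * h ^+ 2 *
    (mdot (init_noise w) (init_noise w) + L ^+ 2 * D0 + mdot star_grad star_grad) /\
  lyap 0 w <= 2 * D0 + 9 * h ^+ 2 *
    (mdot (init_noise w) (init_noise w) + L ^+ 2 * D0 + mdot star_grad star_grad)
    + eta 0 ^+ 2 * mdot star_dual (B *m star_dual).
Proof.
pose G := init_noise w + (stack_grad f (cp_x c) - star_grad) + star_grad.
have GE : grad_matrix c (cp_x c) (fun i => xi i 0%N w) = G.
  by rewrite /G addrA 2!subrK.
have xE : err_x 0 w = (cp_x c - ones xstar) - h *: G.
  by rewrite /err_x /iter_x /state /= GE addrAC.
have wE : err_w 0 w = - (h *: G).
  rewrite /err_w /iter_x /iter_H /state /= GE HX.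
  by rewrite addrAC subrr add0r.
have qE : err_q 0 w = eta 0 *: star_dual.
  by rewrite /err_q /iter_D /state /= add0r -scalemxAr.
have GG : mdot G G <= 3 * (mdot (init_noise w) (init_noise w) + L ^+ 2 * D0
    + mdot star_grad star_grad).
  have hL : mdot (stack_grad f (cp_x c) - star_grad) (stack_grad f (cp_x c) - star_grad)
      <= L ^+ 2 * D0 by exact: stack_grad_lipschitz.
  apply: le_trans (mdot_sum_le3 _ _ _) _.
  by rewrite ler_pM2l// lerD2r lerD2l.
have hG : h ^+ 2 * mdot G G <= h ^+ 2 * (3 * (mdot (init_noise w) (init_noise w) + L ^+ 2 * D0
    + mdot star_grad star_grad)) by rewrite ler_wpM2l ?sqr_ge0.
have hx : mdot (err_x 0 w) (err_x 0 w) <= 2 * D0 + 2 * (h ^+ 2 * mdot G G).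
  rewrite xE; apply: le_trans (mdot_sum_le2 _ _) _.
  by rewrite mdotNl mdotNr opprK mdotZl mdotZr [h ^+ 2]expr2 !mulrA.
have hw : om * mdot (err_w 0 w) (err_w 0 w) <= h ^+ 2 * mdot G G.
  rewrite wE mdotNl mdotNr opprK mdotZl mdotZr [h * (h * _)]mulrA -expr2.
  by apply: ler_piMl om1; rewrite mulr_ge0 ?sqr_ge0 ?mdot_ge0.
split.
  apply: le_trans hx _; apply: le_trans (lerD (lexx _) (ler_wpM2l (ler0n R 2) hG)) _.
  by rewrite lerD2l; set V := _ + _ + _; rewrite le_eqVlt; apply/orP; left; apply/eqP; ring.
rewrite /lyap /lyapunov qE -scalemxAr mdotZl mdotZr [eta 0 * (_ * _)]mulrA -expr2.
have hc := mdot_cen_le (err_x 0 w) n0; move: hc hx hG hw.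
exact: init_arith.
Qed.

Lemma Ex_init : Ex P (mean_err 0) <= init_bound /\ Ex P (lyap 0) <= init_bound.
Proof.
have [iN EN] := init_noise_bound.
pose s0 := eta 0 ^+ 2 * mdot star_dual (B *m star_dual).
have s00 : 0 <= s0 by rewrite mulr_ge0 ?sqr_ge0// (gossip_ge0 Bg b0).
pose c0 := 2 * D0 + 9 * h ^+ 2 * (L ^+ 2 * D0 + mdot star_grad star_grad) + s0.
pose ub w := c0 + 9 * h ^+ 2 * mdot (init_noise w) (init_noise w).
have i2 := integrable_scaleP (9 * h ^+ 2) iN.
have iu : P.-integrable setT (EFin \o ub) := integrable_addP (integrable_cstP P c0) i2.
have h0 : 0 <= h ^+ 2 := sqr_ge0 _.
have Eu : Ex P ub <= init_bound.
  rewrite /ub (ExD (integrable_cstP P c0) i2) ExZ// Ex_cst.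
  rewrite /init_bound -/s0 -[_ + _ + mdot star_grad _]addrA /c0.
  rewrite init_regroup lerD2r lerD2l; apply: ler_wpM2l; last by rewrite lerD2r.
  exact: mulr_ge0 (ler0n R 9) h0.
have ub_lyap w : lyap 0 w <= ub w.
  have [_ hl] := init_step w; apply: le_trans hl _.
  by rewrite /ub /c0 -/s0 -[_ + _ + mdot star_grad _]addrA; rewrite init_regroup.
have ub_mean w : mean_err 0 w <= ub w.
  have [hx _] := init_step w.
  apply: (@le_trans _ _ (mdot (err_x 0 w) (err_x 0 w))).
    by rewrite (mdot_pythagoras n0 (err_x 0 w)) lerDl mdot_ge0.
  apply: le_trans hx _; rewrite /ub /c0 -[_ + _ + mdot star_grad _]addrA.
  apply: (@le_trans _ _ (2 * D0 + 9 * h ^+ 2 * (mdot (init_noise w) (init_noise w) +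
      (L ^+ 2 * D0 + mdot star_grad star_grad)) + 0)); last first.
    by rewrite init_regroup lerD2l.
  rewrite addr0 lerD2l; apply: ler_wpM2r; last by rewrite ler_wpM2r// ler_nat.
  by rewrite !addr_ge0 ?mdot_ge0// mulr_ge0 ?mdot_ge0 ?sqr_ge0.
split; apply: le_trans Eu.
  by apply: Ex_le => //; exact: mean_err_integrable.
by apply: Ex_le => //; exact: lyap_integrable.
Qed.

Lemma lyap_ge0 k w : 0 <= lyap k w.
Proof.
rewrite /lyap /lyapunov !addr_ge0 ?mdot_ge0 ?(gossip_ge0 Bg b0)//.
by rewrite mulr_ge0 ?mdot_ge0 ?(ltW om_gt0).
Qed.

(** The inverse of the gossip operator has norm at most 1/b. *)
Lemma star_dual_le : mdot star_dual (B *m star_dual) <= b^-1 * mdot star_grad star_grad.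
Proof. exact: (gossip_pinv_le Bg b0 n0 avg_star). Qed.

(** The error splits orthogonally into its average and its disagreement. *)
Lemma mean_square_error_le k : (mean_square_error P c xi zeta xstar k <=
  (n%:R^-1 * (Ex P (mean_err k) + Ex P (lyap k)))%:E)%E.
Proof.
have [re _ _ _] := random_err k.
have rei i : random_matrix P (F k) (fun w => row i (err_x k w)).
  by move=> i' j; under eq_fun do rewrite mxE; exact: re.
have ii i : P.-integrable setT (EFin \o (fun w => sqnorm (row i (err_x k w)))).
  by under eq_fun do rewrite sqnormE; exact: (mdot_integrable (rei i) (rei i)).
have Ei i : ('E_P[fun w => (enorm (iterate c xi zeta i k.+1 w - xstar) ^+ 2)%R] =
    (Ex P (fun w => sqnorm (row i (err_x k w))))%:E)%E.
  rewrite unlock -EFin_Ex//; apply: eq_integral => w _; congr (_%:E).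
  by rewrite enorm_sq iterateS /err_x linearB /= row_ones.
rewrite /mean_square_error; under eq_bigr do rewrite Ei.
rewrite sumEFin -EFinM lee_fin ler_wpM2l ?invr_ge0// -Ex_sum//.
rewrite -ExD; [|exact: mean_err_integrable|exact: lyap_integrable].
apply: Ex_le; first exact: integrable_sumP.
  by apply: integrable_addP; [exact: mean_err_integrable|exact: lyap_integrable].
move=> w; rewrite -sqnorm_rows sqnormE (mdot_pythagoras n0) lerD2l.
rewrite /lyap /lyapunov -addrA lerDl addr_ge0 ?(gossip_ge0 Bg b0)//.
by rewrite mulr_ge0 ?mdot_ge0 ?(ltW om_gt0).
Qed.

End Recursions.

(** * The coupled scalar recursions *)

Section Recursion.
Variable R : realType.

Section Envelope.
Variables (n m c E r : R).
Hypotheses (n1 : 1 <= n) (m1 : 1 <= m) (c0 : 0 <= c) (E0 : 0 <= E) (r4 : 4 <= r).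

(** The three terms are the statistical rate, the transient caused by the
    heterogeneity of the agents, and the initial error. The factor expR c makes up
    for the exponential, which equals expR (- c) at the starting time t = m. *)
Definition envelope (t : R) : R :=
  expR (- (c * m / t)) *
    (t^-1 + (n * m) ^+ 3 / t ^+ 4 + expR c * E * (m / t) `^ r).

Let n0 : 0 <= n. Proof. exact: le_trans n1. Qed.
Let m0 : 0 <= m. Proof. exact: le_trans m1. Qed.

Let brk (t : R) := t^-1 + (n * m) ^+ 3 / t ^+ 4 + expR c * E * (m / t) `^ r.

Let brk_ge0 t : 0 < t -> 0 <= brk t.
Proof.
move=> t0; rewrite /brk !addr_ge0 ?invr_ge0 ?(ltW t0)//.
  by rewrite divr_ge0 ?exprn_ge0 ?mulr_ge0 ?(ltW t0).
by rewrite !mulr_ge0 ?expR_ge0 ?powR_ge0.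
Qed.

Lemma envelope_ge0 t : 0 < t -> 0 <= envelope t.
Proof. by move=> t0; rewrite mulr_ge0 ?expR_ge0//; exact: brk_ge0. Qed.

(** Each of the three terms decreases at most like t ^ (- r), since r >= 4, and
    the exponential increases by the relative amount c m / (t (t + 1)). *)
Lemma envelope_step t : m <= t ->
  (1 - r / t + c * m / (2 * t ^+ 2)) * envelope t <= envelope (t + 1).
Proof.
move=> mt; have t1 : 1 <= t by move: m1 mt; lra.
have t0 : 0 < t by lra.
have t10 : 0 < t + 1 by lra.
have tn0 : t != 0 by rewrite gt_eqF.
have t1n0 : t + 1 != 0 by rewrite gt_eqF.
pose rho := t / (t + 1); have rho0 : 0 < rho by rewrite divr_gt0.
have rho1 : rho <= 1 by rewrite ler_pdivrMr//; lra.
have rhoE : expR (- t^-1) <= rho.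
  rewrite /rho expRN -(invf_div (t + 1) t) lef_pV2 ?posrE ?expR_gt0 ?divr_gt0//.
  by rewrite mulrDl mulfV// div1r expR_ge1Dx.
have rhor : expR (- (r / t)) <= rho `^ r.
  have -> : - (r / t) = r * (- t^-1) by rewrite mulrN.
  rewrite mulrC expRM.
  by apply: ge0_ler_powR; rewrite ?nnegrE ?expR_ge0 ?(ltW rho0)// (le_trans _ r4).
have rho_n k : (k <= 4)%N -> rho `^ r <= rho ^+ k.
  move=> k4; rewrite -powR_mulrn ?(ltW rho0)//; apply: ger_powR => //.
    by rewrite rho0.
  by apply: le_trans r4; rewrite ler_nat.
have bstep : rho `^ r * brk t <= brk (t + 1).
  rewrite /brk !mulrDr; apply: lerD; first apply: lerD.
  - have -> : (t + 1)^-1 = rho ^+ 1 * t^-1 by rewrite /rho; field; rewrite tn0.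
    by rewrite ler_wpM2r ?rho_n// invr_ge0 ltW.
  - have -> : (n * m) ^+ 3 / (t + 1) ^+ 4 = rho ^+ 4 * ((n * m) ^+ 3 / t ^+ 4).
      by rewrite /rho; field; rewrite tn0.
    by rewrite ler_wpM2r ?rho_n// divr_ge0 ?exprn_ge0 ?mulr_ge0 ?(ltW t0).
  - have -> : m / (t + 1) = rho * (m / t) by rewrite /rho; field; rewrite tn0.
    rewrite [in leRHS]powRM ?(ltW rho0) ?divr_ge0 ?(ltW t0)//.
    by rewrite [leLHS]mulrCA.
have b0 := brk_ge0 t0.
rewrite /envelope -/(brk t) -/(brk (t + 1)).
apply: (@le_trans _ _ (expR (- (c * m / (t + 1))) * (expR (- (r / t)) * brk t))); last first.
  rewrite ler_wpM2l ?expR_ge0//; apply: le_trans bstep; exact: ler_wpM2r.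
rewrite !mulrA; apply: ler_wpM2r => //.
have -> : expR (- (c * m / (t + 1))) * expR (- (r / t)) =
    expR (c * m / (t * (t + 1)) - r / t) * expR (- (c * m / t)).
  by rewrite -!expRD; congr expR; field; rewrite tn0.
rewrite ler_wpM2r ?expR_ge0//; apply: le_trans (expR_ge1Dx _).
suff : c * m / (2 * t ^+ 2) <= c * m / (t * (t + 1)) by lra.
rewrite ler_wpM2l ?mulr_ge0//.
rewrite lef_pV2 ?posrE ?mulr_gt0 ?exprn_gt0// expr2 mulrDr mulr1.
by have := ler_wpM2l (ltW t0) t1; lra.
Qed.

Lemma envelope_lb t : m <= t ->
  (1 + (n * m / t) ^+ 3) / t <= expR c * envelope t.
Proof.
move=> mt; have t0 : 0 < t by move: m1 mt; lra.
rewrite /envelope mulrA -expRD.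
have e1 : 1 <= expR (c - c * m / t).
  rewrite -expR0 ler_expR subr_ge0 -mulrA ler_piMr// ler_pdivrMr// mul1r//.
have -> : (1 + (n * m / t) ^+ 3) / t = t^-1 + (n * m) ^+ 3 / t ^+ 4.
  by field; rewrite gt_eqF.
have h0 : 0 <= t^-1 + (n * m) ^+ 3 / t ^+ 4.
  by rewrite addr_ge0 ?invr_ge0 ?divr_ge0 ?exprn_ge0 ?mulr_ge0 ?(ltW t0).
apply: le_trans (ler_wpM2l (expR_ge0 _) (_ : t^-1 + (n * m) ^+ 3 / t ^+ 4 <= _)).
  by rewrite ler_peMl.
by rewrite lerDl !mulr_ge0 ?expR_ge0 ?powR_ge0.
Qed.

Lemma envelope_ub t : m <= t ->
  envelope t <= expR c * (t^-1 + (n * m) ^+ 3 / t ^+ 4 + E * (m / t) `^ r).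
Proof.
move=> mt; have t0 : 0 < t by move: m1 mt; lra.
have b0 := brk_ge0 t0.
apply: (@le_trans _ _ (brk t)).
  rewrite /envelope -/(brk t) ler_piMl// -expR0 ler_expR oppr_le0.
  by rewrite !mulr_ge0 ?invr_ge0 ?(ltW t0).
have ec : 1 <= expR c by rewrite -expR0 ler_expR.
rewrite /brk mulrDr mulrA lerD2r ler_peMl//.
by rewrite addr_ge0 ?invr_ge0 ?divr_ge0 ?exprn_ge0 ?mulr_ge0 ?(ltW t0).
Qed.

Lemma envelope_start : E <= envelope m.
Proof.
have m00 : 0 < m by move: m1; lra.
rewrite /envelope mulfK ?gt_eqF// mulfV ?gt_eqF// powR1 mulr1.
rewrite mulrDr [X in _ + X]mulrA -expRD addNr.
rewrite expR0 mul1r lerDr mulr_ge0 ?expR_ge0//.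
by rewrite addr_ge0 ?invr_ge0 ?divr_ge0 ?exprn_ge0 ?mulr_ge0.
Qed.

End Envelope.

End Recursion.

Section StepArithmetic.
Variable R : realFieldType.
Implicit Types (a b c m n s t x v f : R).

(** The slack c m / (2 t^2) of the envelope absorbs the terms of relative size
    m / t^2, and the gap r - r1 those of relative size 1 / t. *)
Lemma slow_step (r r1 c A4 A5 A6 K al be ec : R) m t f f' x v x' :
  0 <= A4 -> 0 <= A5 -> 0 <= A6 -> 0 <= K -> 1 <= m -> m <= t -> r <= m ->
  1 <= al -> 0 <= f -> t^-1 <= ec * f -> 2 * (A4 + A5 * K) <= c ->
  A5 * be + A6 * ec <= al * (r - r1) ->
  (1 - r1 / t + c * m / (2 * t ^+ 2)) * f <= f' ->
  x <= al * f -> v <= (be + K * al * (m / t)) * f ->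
  x' <= (1 - r / t + A4 / t ^+ 2) * x + A5 / t * v + A6 / t ^+ 2 ->
  x' <= al * f'.
Proof.
move=> A40 A50 A60 K0 m1 mt rm al1 f0 i1 h6 h5 fS ak Vk /le_trans; apply.
have t0 : 0 < t by apply: lt_le_trans mt; apply: lt_le_trans m1.
have it0 : 0 < t^-1 by rewrite invr_gt0.
have c1 : 0 <= 1 - r / t + A4 / t ^+ 2.
  rewrite addr_ge0 ?divr_ge0 ?exprn_ge0 ?(ltW t0)//.
  by rewrite subr_ge0 ler_pdivrMr// mul1r (le_trans rm).
have h1 := ler_wpM2l c1 ak.
have h2 := ler_wpM2l (divr_ge0 A50 (ltW t0)) Vk.
have h3 : A6 / t ^+ 2 <= t^-1 * (A6 * ec * f).
  have := ler_wpM2l (mulr_ge0 A60 (ltW it0)) i1.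
  have -> : A6 / t ^+ 2 = A6 * t^-1 * t^-1 by rewrite expr2 invfM mulrA.
  by move/le_trans; apply; rewrite le_eqVlt; apply/orP; left; apply/eqP; ring.
have h4 := ler_wpM2l (le_trans ler01 al1) fS.
have h6' : A4 + A5 * K * m <= c / 2 * m.
  have m0 : 0 <= m := le_trans ler01 m1.
  apply: (@le_trans _ _ ((A4 + A5 * K) * m)); first by rewrite mulrDl lerD2r ler_peMr.
  by rewrite ler_wpM2r// ler_pdivlMr// mulrC.
have it2 : 0 <= t^-1 * t^-1 * (al * f).
  by rewrite !mulr_ge0 ?(ltW it0)// (le_trans ler01).
have h7 := ler_wpM2l (mulr_ge0 (ltW it0) f0) h5.
have h8 := ler_wpM2l it2 h6'.
move: h1 h2 h3 h4 h7 h8; rewrite !expr2 !invfM; move: (t^-1) => s.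
by clear - R; lra.
Qed.

(** From q s <= X s^2 / 4 + q^2 / X for q = r + 1 and X = c m; the hypothesis on c
   makes the last term at most b / 128. *)
Lemma decay_bound (r b c m M0 s : R) :
  0 <= r -> 0 < b -> 0 < M0 -> 0 <= m -> M0 <= b * m ->
  128 * (r + 1) ^+ 2 / M0 <= c ->
  (r + 1) * s <= c * m * s ^+ 2 / 4 + b / 128.
Proof.
move=> r0 b0 M00 m0 bm Qc; have q0 : 0 < r + 1 by rewrite ltr_wpDl.
move: (r + 1) q0 Qc => q q0 Qc; pose Q := 128 * q ^+ 2 / M0.
have Q0 : 0 <= Q by rewrite divr_ge0 ?(ltW M00)// mulr_ge0 ?ler0n ?sqr_ge0.
have q2 : 128 * q ^+ 2 <= b * (c * m).
  have -> : 128 * q ^+ 2 = M0 * Q by rewrite /Q [RHS]mulrC divfK ?gt_eqF.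
  have -> : b * (c * m) = b * m * c by ring.
  by apply: ler_pM => //; exact: ltW.
have X0 : 0 < c * m.
  by rewrite -(pmulr_rgt0 _ b0); apply: lt_le_trans q2; rewrite mulr_gt0 ?exprn_gt0.
rewrite -(ler_pM2l X0); move: q2 (sqr_ge0 (c * m * s / 2 - q)).
by move: (c * m) => X; clear - R; rewrite !expr2; lra.
Qed.

(** The product of the envelope and m / t, which loses a further factor 1 - s,
    decays in one step by a factor of at least 1 - b / 128, hence more slowly than
    the fast sequence contracts. *)
Lemma decay_step (r b X s f f' : R) :
  0 <= r -> 0 <= X -> s <= 1 / 2 -> 0 <= f ->
  (r + 1) * s <= X * s ^+ 2 / 4 + b / 128 ->
  (1 - r * s + X * s ^+ 2 / 2) * f <= f' ->
  (1 - b / 128) * f <= (1 - s) * f'.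
Proof.
move=> r0 X0 s2 f0 qs fS.
have s10 : 0 <= 1 - s by move: s2; clear - R; lra.
apply: le_trans (ler_wpM2l s10 fS); rewrite mulrA ler_wpM2r//.
have hs : 0 <= X * s ^+ 2 * (1 / 2 - s).
  by rewrite mulr_ge0 ?subr_ge0// mulr_ge0 ?sqr_ge0.
have := mulr_ge0 r0 (sqr_ge0 s); move: qs hs.
by clear - R; rewrite expr2; lra.
Qed.

(* The following three lemmas bound the coupling and the two source terms of the
   fast sequence by b times the envelope, using 1 / m <= b / M0. *)
Lemma coupling_bound (b m t M0 A1 K al f : R) :
  0 < b -> 0 < m -> m <= t -> 0 < M0 -> M0 <= b * m -> 0 <= A1 -> 0 <= al -> 0 <= f ->
  K = 128 * A1 / M0 ^+ 2 ->
  A1 / (b * t ^+ 2) * (al * f) <= b / 128 * (K * al * (m / t)) * f.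
Proof.
move=> b0 m0 mt M00 bm A10 al0 f0 ->.
have t0 : 0 < t := lt_le_trans m0 mt.
have -> : A1 / (b * t ^+ 2) * (al * f) = (A1 * al * f * t^-1 * b^-1) * t^-1.
  by field; rewrite !gt_eqF.
have -> : b / 128 * (128 * A1 / M0 ^+ 2 * al * (m / t)) * f =
    (A1 * al * f * t^-1 * b^-1) * (b ^+ 2 * m / M0 ^+ 2).
  by field; rewrite !gt_eqF.
apply: ler_wpM2l.
  by do ![apply: mulr_ge0 => //]; rewrite ?invr_ge0 ltW.
rewrite ler_pdivlMr ?exprn_gt0//; apply: (@le_trans _ _ (t^-1 * (b * m) ^+ 2)).
  by rewrite ler_wpM2l ?invr_ge0 ?(ltW t0)// ler_sqr ?nnegrE ?mulr_ge0 ?(ltW M00) ?(ltW b0) ?(ltW m0).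
have -> : t^-1 * (b * m) ^+ 2 = b ^+ 2 * m * (m / t) by ring.
by rewrite ger_pMr ?mulr_gt0 ?exprn_gt0// ler_pdivrMr// mul1r.
Qed.

Lemma source_bound2 (b m t M0 A2 n w : R) :
  0 < b -> 0 < m -> m <= t -> 0 < M0 -> M0 <= b * m -> 0 <= A2 -> 0 <= n ->
  (1 + (n * m / t) ^+ 3) / t <= w ->
  A2 * n / t ^+ 2 <= A2 / M0 * (b * w).
Proof.
move=> b0 m0 mt M00 bm A20 n0 FL; have t0 : 0 < t := lt_le_trans m0 mt.
pose z := n * m / t; have z0 : 0 <= z by rewrite divr_ge0 ?mulr_ge0 ?(ltW m0) ?(ltW t0).
have -> : A2 * n / t ^+ 2 = A2 * (m^-1 * (z / t)).
  by rewrite /z; field; rewrite !gt_eqF.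
have -> : A2 / M0 * (b * w) = A2 * (b / M0 * w) by ring.
have z3 : z <= 1 + z ^+ 3.
  have [z1|z1] := leP z 1; first by rewrite (le_trans z1)// lerDl exprn_ge0.
  by rewrite (le_trans (ler_eXnr (n := 3) isT (ltW z1)))// lerDr.
rewrite ler_wpM2l//; apply: ler_pM.
- by rewrite invr_ge0 ltW.
- by rewrite divr_ge0 ?(ltW t0).
- by rewrite ler_pdivlMr// mulrC ler_pdivrMr.
- by apply: le_trans FL; rewrite ler_wpM2r ?invr_ge0 ?(ltW t0).
Qed.

Lemma source_bound3 (b m t M0 A3 n w : R) :
  0 < b -> 0 < m -> m <= t -> 0 < M0 -> M0 <= b * m -> 0 <= A3 -> 0 <= n ->
  (1 + (n * m / t) ^+ 3) / t <= w ->
  A3 * n ^+ 3 / (b ^+ 2 * t ^+ 4) <= A3 / M0 ^+ 3 * (b * w).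
Proof.
move=> b0 m0 mt M00 bm A30 n0 FL; have t0 : 0 < t := lt_le_trans m0 mt.
pose z := n * m / t; have z0 : 0 <= z by rewrite divr_ge0 ?mulr_ge0 ?(ltW m0) ?(ltW t0).
have -> : A3 * n ^+ 3 / (b ^+ 2 * t ^+ 4) = A3 * ((b * (b * m) ^- 3) * (z ^+ 3 / t)).
  by rewrite /z; field; rewrite !gt_eqF.
have -> : A3 / M0 ^+ 3 * (b * w) = A3 * ((b * M0 ^- 3) * w) by ring.
rewrite ler_wpM2l//; apply: ler_pM.
- by rewrite mulr_ge0 ?(ltW b0)// invr_ge0 exprn_ge0// mulr_ge0 ?(ltW b0) ?(ltW m0).
- by rewrite divr_ge0 ?exprn_ge0 ?(ltW t0).
- rewrite ler_pM2l// lef_pV2 ?posrE ?exprn_gt0 ?mulr_gt0//.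
  by rewrite lerXn2r ?nnegrE ?mulr_ge0 ?(ltW M00) ?(ltW b0) ?(ltW m0).
- by apply: le_trans FL; rewrite ler_wpM2r ?invr_ge0 ?(ltW t0)// lerDr.
Qed.

(** The contraction b / 64 is twice the decay b / 128 of the envelope; the
    difference pays for the coupling and the sources. *)
Lemma fast_step (r c A1 A2 A3 K al be ec M0 b : R) m n t f f' x v v' :
  0 <= r -> r <= t -> 0 <= c -> 0 < b -> b <= 1 -> 0 < M0 -> 2 <= m -> m <= t ->
  M0 <= b * m -> 0 <= A1 -> 0 <= A2 -> 0 <= A3 -> 0 <= n -> 0 <= al -> 1 <= be ->
  0 <= f -> K = 128 * A1 / M0 ^+ 2 -> 128 * (r + 1) ^+ 2 / M0 <= c ->
  be = 128 * ec * (A2 / M0 + A3 / M0 ^+ 3) + 1 ->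
  (1 + (n * m / t) ^+ 3) / t <= ec * f ->
  (1 - r / t + c * m / (2 * t ^+ 2)) * f <= f' ->
  x <= al * f -> v <= (be + K * al * (m / t)) * f ->
  v' <= (1 - b / 64) * v + A1 / (b * t ^+ 2) * x + A2 * n / t ^+ 2
     + A3 * n ^+ 3 / (b ^+ 2 * t ^+ 4) ->
  v' <= (be + K * al * (m / (t + 1))) * f'.
Proof.
move=> r0 rt c0 b0 b1 M00 m2 mt bm A10 A20 A30 n0 al0 be1 f0 KE Qc beE FL fS xk vk.
move=> /le_trans; apply.
have m0 : 0 < m by apply: lt_le_trans m2.
have t0 : 0 < t := lt_le_trans m0 mt.
have K0 : 0 <= K by rewrite KE divr_ge0 ?mulr_ge0 ?exprn_ge0 ?(ltW M00).
have Kal0 : 0 <= K * al by rewrite mulr_ge0.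
pose s := t^-1; have s0 : 0 < s by rewrite invr_gt0.
have s2 : s <= 1 / 2.
  by rewrite /s div1r lef_pV2 ?posrE// (le_trans m2).
have cm0 : 0 <= c * m by rewrite mulr_ge0 // ltW.
pose Bc := be + K * al * (m / t).
have Bc0 : 0 <= Bc.
  apply: addr_ge0; first exact: le_trans be1.
  by apply: mulr_ge0 => //; rewrite divr_ge0 ?(ltW m0) ?(ltW t0).
have fS' : (1 - r * s + c * m * s ^+ 2 / 2) * f <= f'.
  rewrite (_ : c * m * s ^+ 2 / 2 = c * m / (2 * t ^+ 2))//.
  by rewrite /s; field; rewrite gt_eqF.
have f'0 : 0 <= f'.
  apply: le_trans fS; rewrite mulr_ge0// addr_ge0 ?subr_ge0//.
    by rewrite ler_pdivrMr// mul1r.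
  by rewrite divr_ge0// mulr_ge0// exprn_ge0// ltW.
have D0 : (1 - b / 128) * f <= (1 - s) * f'.
  apply: decay_step fS' => //; apply: decay_bound bm Qc => //; exact: ltW.
have hC : m / t * (1 - s) <= m / (t + 1).
  rewrite -mulrA ler_pM2l// -[leRHS]div1r ler_pdivlMr ?ltr_wpDr//.
  have -> : t^-1 * (1 - s) * (t + 1) = 1 - s ^+ 2 by rewrite /s; field; rewrite gt_eqF.
  by rewrite gerBl sqr_ge0.
have Bstep : Bc * ((1 - b / 128) * f) <= (be + K * al * (m / (t + 1))) * f'.
  apply: le_trans (ler_wpM2l Bc0 D0) _; rewrite [leLHS]mulrA ler_wpM2r//.
  rewrite /Bc mulrDl lerD//; last by rewrite -[leLHS]mulrA ler_wpM2l.
  by rewrite ger_pMr ?(lt_le_trans ltr01)// gerBl ltW.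
apply: le_trans Bstep.
have w0 : 0 <= 1 - b / 64.
  by rewrite subr_ge0 ler_pdivrMr// mul1r (le_trans b1)// ler1n.
have k1 := ler_wpM2l w0 vk.
have k2 : A1 / (b * t ^+ 2) * x <= b / 128 * (K * al * (m / t)) * f.
  apply: le_trans (coupling_bound b0 m0 mt M00 bm A10 al0 f0 KE).
  by rewrite ler_wpM2l// divr_ge0// mulr_ge0 ?sqr_ge0// ltW.
have k3 := source_bound2 b0 m0 mt M00 bm A20 n0 FL.
have k4 := source_bound3 b0 m0 mt M00 bm A30 n0 FL.
have bf0 : 0 <= b * f by rewrite mulr_ge0// ltW.
have k5 : A2 / M0 * (b * (ec * f)) + A3 / M0 ^+ 3 * (b * (ec * f)) <= b / 128 * be * f.
  by rewrite beE; move: bf0; clear - R; lra.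
by move: k1 k2 k3 k4 k5; rewrite /Bc; clear - R; lra.
Qed.

End StepArithmetic.

Section CoupledRecursion.
Variable R : realType.

(** Both sequences stay below multiples of the envelope. The correction
    exp(- c m / t), which only varies by a constant factor, creates a slack of
    relative size m / t^2 in each step. That slack pays for the coupling of the
    two sequences while t is of order m, before the asymptotic rates apply. *)
Lemma coupled_recursion_bound (A1 A2 A3 A4 A5 A6 M0 r r1 : R) :
  0 <= A1 -> 0 <= A2 -> 0 <= A3 -> 0 <= A4 -> 0 <= A5 -> 0 <= A6 -> 0 < M0 ->
  4 <= r1 -> r1 < r ->
  exists2 Gam : R, 0 < Gam &
  forall (n m b E : R) (a V : nat -> R),
  1 <= n -> 2 <= m -> r <= m -> 0 < b -> b <= 1 -> M0 <= b * m -> 0 <= E ->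
  a 0%N <= E -> V 0%N <= E ->
  (forall k, 0 <= V k) ->
  (forall k, a k.+1 <= (1 - r / (k%:R + m) + A4 / (k%:R + m) ^+ 2) * a k
     + A5 / (k%:R + m) * V k + A6 / (k%:R + m) ^+ 2) ->
  (forall k, V k.+1 <= (1 - b / 64) * V k + A1 / (b * (k%:R + m) ^+ 2) * a k
     + A2 * n / (k%:R + m) ^+ 2 + A3 * n ^+ 3 / (b ^+ 2 * (k%:R + m) ^+ 4)) ->
  forall k, a k + V k <= Gam * ((k%:R + m)^-1 + (n * m) ^+ 3 / (k%:R + m) ^+ 4
     + E * (m / (k%:R + m)) `^ r1).
Proof.
move=> A10 A20 A30 A40 A50 A60 M00 r14 r1r.
pose K := 128 * A1 / M0 ^+ 2.
pose c := 128 * (r1 + 1) ^+ 2 / M0 + 2 * (A4 + A5 * K).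
pose be := 128 * expR c * (A2 / M0 + A3 / M0 ^+ 3) + 1.
pose al := (A5 * be + A6 * expR c) / (r - r1) + 1.
have r10 : 0 <= r1 by lra.
have M0k k : 0 <= M0 ^- k by rewrite invr_ge0 exprn_ge0 ?ltW.
have M01 : 0 <= M0^-1 by rewrite invr_ge0 ltW.
have K0 : 0 <= K by rewrite /K !mulr_ge0.
have c0 : 0 <= c.
  apply: addr_ge0; last by apply: mulr_ge0 => //; apply: addr_ge0 => //; exact: mulr_ge0.
  by apply: mulr_ge0 => //; apply: mulr_ge0 => //; exact: sqr_ge0.
have be1 : 1 <= be.
  by rewrite /be lerDr mulr_ge0 ?mulr_ge0 ?expR_ge0// addr_ge0// mulr_ge0.
have rr : 0 < r - r1 by lra.
have al1 : 1 <= al.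
  rewrite /al lerDr divr_ge0 ?(ltW rr)// addr_ge0 ?mulr_ge0 ?expR_ge0//.
  exact: le_trans be1.
have Kal0 : 0 <= K * al by rewrite mulr_ge0//; lra.
exists ((al + be + K * al) * expR c).
  by rewrite mulr_gt0 ?expR_gt0//; lra.
move=> n m b E a V n1 m2 rm b0 b1 bm E0 a0 V0 Vge aS VS.
have m1 : 1 <= m by lra.
have m0 : 0 < m by lra.
pose F k := envelope n m c E r1 (k%:R + m).
have mt k : m <= k%:R + m by rewrite lerDr.
have t0 k : 0 < k%:R + m := lt_le_trans m0 (mt k).
have tS k : k.+1%:R + m = k%:R + m + 1 by rewrite -natr1 addrAC.
have F0 k : 0 <= F k by apply: envelope_ge0.
have FS k : (1 - r1 / (k%:R + m) + c * m / (2 * (k%:R + m) ^+ 2)) * F k <= F k.+1.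
  rewrite /F tS; exact: envelope_step.
have FL k : (1 + (n * m / (k%:R + m)) ^+ 3) / (k%:R + m) <= expR c * F k.
  exact: envelope_lb.
have i1 k : (k%:R + m)^-1 <= expR c * F k.
  apply: le_trans (FL k); rewrite ler_pMl ?invr_gt0// lerDl.
  by rewrite exprn_ge0// divr_ge0 ?(ltW (t0 k))// mulr_ge0 ?(le_trans ler01) ?(ltW m0).
have c2 : 2 * (A4 + A5 * K) <= c.
  rewrite /c lerDr; apply: mulr_ge0 => //; apply: mulr_ge0 => //; exact: sqr_ge0.
have h5 : A5 * be + A6 * expR c <= al * (r - r1).
  by rewrite /al mulrDl mulfVK ?gt_eqF// mul1r lerDl ltW.
have c3 : 128 * (r1 + 1) ^+ 2 / M0 <= c.
  by rewrite /c lerDl mulr_ge0// addr_ge0// mulr_ge0.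
have aStep k : a k <= al * F k -> V k <= (be + K * al * (m / (k%:R + m))) * F k ->
    a k.+1 <= al * F k.+1.
  move=> ak Vk.
  exact: (slow_step A40 A50 A60 K0 m1 (mt k) rm al1 (F0 k) (i1 k) c2 h5 (FS k) ak Vk (aS k)).
have VStep k : a k <= al * F k -> V k <= (be + K * al * (m / (k%:R + m))) * F k ->
    V k.+1 <= (be + K * al * (m / (k.+1%:R + m))) * F k.+1.
  move=> ak Vk; rewrite tS.
  apply: (fast_step r10 (le_trans (ltW r1r) (le_trans rm (mt k))) c0 b0 b1 M00 m2 (mt k)
    bm A10 A20 A30 (le_trans ler01 n1) (le_trans ler01 al1) be1 (F0 k) (erefl K) c3
    (erefl be) (FL k) (FS k) ak Vk (VS k)).
have both k : a k <= al * F k /\ V k <= (be + K * al * (m / (k%:R + m))) * F k.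
  elim: k => [|k [ak Vk]]; last by split; [exact: aStep|exact: VStep].
  have Fm : E <= F 0%N by rewrite /F add0r; exact: envelope_start.
  split; first by apply: le_trans a0 (le_trans Fm _); rewrite ler_peMl.
  apply: le_trans V0 (le_trans Fm _); rewrite ler_peMl//.
  by rewrite add0r mulfV ?gt_eqF// mulr1; lra.
move=> k; have [ak Vk] := both k.
have FB : F k <= expR c * ((k%:R + m)^-1 + (n * m) ^+ 3 / (k%:R + m) ^+ 4
    + E * (m / (k%:R + m)) `^ r1) by exact: envelope_ub.
move: FB; set B := _ + _ + _ => FB.
have mt1 : m / (k%:R + m) <= 1 by rewrite ler_pdivrMr ?mul1r.
apply: (@le_trans _ _ ((al + be + K * al) * F k)).
  rewrite -addrA mulrDl; apply: lerD => //; apply: le_trans Vk _.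
  by rewrite ler_wpM2r// lerD2l ler_piMr.
by rewrite -mulrA ler_wpM2l//; lra.
Qed.

End CoupledRecursion.

(** * Orders of magnitude *)

Ltac nonneg := by do ?[by [] | exact: sqr_ge0 | apply: addr_ge0 | apply: mulr_ge0].

Section Orders.
Variable R : realType.

(** The stepsizes are at most of order 1 / m, and 1 / (m b) is at most 1 / M0. *)
Lemma init_bound_order (n m b M0 h t D D' G aG S sigma L : R) :
  1 <= n -> 1 <= m -> 0 < b -> 0 < M0 -> M0 <= b * m -> 0 <= h -> h <= 2 * (t / m) ->
  0 <= t -> 0 <= D' -> 0 <= aG -> 0 <= G ->
  D <= D' * n ^+ 2 -> G <= aG * n ^+ 3 -> S <= b^-1 * G ->
  2 * D + 9 * h ^+ 2 * (n * sigma ^+ 2 + L ^+ 2 * D + G) + (t / m) ^+ 2 * S <=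
  (2 * D' + 36 * t ^+ 2 * (sigma ^+ 2 + L ^+ 2 * D' + aG) + t ^+ 2 * aG / M0)
    * (n ^+ 2 + n ^+ 3 / m).
Proof.
move=> n1 m1 b0 M00 bm h0 ht t0 D'0 aG0 G0 DD GG SG.
have m0 : 0 < m := lt_le_trans ltr01 m1.
have n0 : 0 <= n := le_trans ler01 n1.
pose u := m^-1; have u0 : 0 <= u by rewrite invr_ge0 ltW.
have u1 : u <= 1 by rewrite invf_le1.
have ub : u * b^-1 <= M0^-1.
  by rewrite -invfM lef_pV2 ?posrE ?mulr_gt0// mulrC.
have h2 : h ^+ 2 <= 4 * t ^+ 2 * u ^+ 2.
  have -> : 4 * t ^+ 2 * u ^+ 2 = (2 * (t / m)) ^+ 2 by rewrite /u; ring.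
  by rewrite ler_sqr ?nnegrE// mulr_ge0// divr_ge0// ltW.
pose N2 := n ^+ 2; pose N3 := n ^+ 3.
have N20 : 0 <= N2 by exact: sqr_ge0.
have N30 : 0 <= N3 by exact: exprn_ge0.
have nN2 : n <= N2 by rewrite /N2 expr2 ler_peMl.
have s20 : 0 <= sigma ^+ 2 := sqr_ge0 _.
have L20 : 0 <= L ^+ 2 := sqr_ge0 _.
have t20 : 0 <= t ^+ 2 := sqr_ge0 _.
pose M := N2 * sigma ^+ 2 + L ^+ 2 * (D' * N2) + aG * N3.
have M_ge0 : 0 <= M by rewrite /M; nonneg.
have hM : n * sigma ^+ 2 + L ^+ 2 * D + G <= M.
  by rewrite /M !lerD//; [rewrite ler_wpM2r|rewrite ler_wpM2l].
have k1 : h ^+ 2 * (n * sigma ^+ 2 + L ^+ 2 * D + G) <= 4 * t ^+ 2 * u ^+ 2 * M.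
  apply: (@le_trans _ _ (h ^+ 2 * M)); first by rewrite ler_wpM2l ?sqr_ge0.
  by rewrite ler_wpM2r.
have uu : u ^+ 2 <= u by rewrite expr2 ler_piMl.
have k2 : u ^+ 2 * M <= N2 * sigma ^+ 2 + L ^+ 2 * (D' * N2) + aG * N3 * u.
  rewrite /M mulrDr; apply: lerD.
    by apply: ler_piMl; [nonneg | exact: le_trans u1].
  by rewrite mulrC; apply: ler_wpM2l uu; nonneg.
have k3 : (t / m) ^+ 2 * S <= t ^+ 2 * (aG * (N3 * u) / M0).
  rewrite exprMn -[leLHS]mulrA ler_wpM2l//; apply: (@le_trans _ _ (u ^+ 2 * (b^-1 * (aG * N3)))).
    rewrite ler_wpM2l ?sqr_ge0//; apply: le_trans SG _.
    by rewrite ler_wpM2l ?invr_ge0 ?(ltW b0).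
  have -> : u ^+ 2 * (b^-1 * (aG * N3)) = aG * (N3 * u) * (u * b^-1) by ring.
  by apply: ler_wpM2l ub; nonneg.
have k4 := ler_wpM2l (mulr_ge0 (ler0n R 36) t20) k2.
have p1 : 0 <= D' * (N3 * u) by nonneg.
have p2 : 0 <= t ^+ 2 * ((sigma ^+ 2 + L ^+ 2 * D') * (N3 * u)). by nonneg.
have p3 : 0 <= t ^+ 2 * (aG * N2) by nonneg.
have p4 : 0 <= t ^+ 2 * (aG * N2 / M0).
  have iM0 : 0 <= M0^-1 by rewrite invr_ge0 ltW.
  nonneg.
rewrite -/N2 -/N3 -/u -[9 * _ * _]mulrA.
move: k1 k3 k4 DD p1 p2 p3 p4; rewrite -/N2.
move: (h ^+ 2 * (_ + _ + G)) ((t / m) ^+ 2 * S) => x1 x2.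
move: (u ^+ 2) (L ^+ 2) (sigma ^+ 2) (t ^+ 2) (M0^-1) => v l s t2 w.
clear - R; lra.
Qed.

(** After n m iterations m / k <= 1 / n, so that (m / k) ^ r1 is at most m / k times
    n ^ (1 - r1), which beats the order n^2 m + n^3 of E m by a power of n. *)
Lemma init_error_negligible (n m k E cE cC q r1 s : R) :
  1 <= n -> 1 <= m -> n * m <= k -> 0 <= cE ->
  E <= cE * (n ^+ 2 + n ^+ 3 / m) -> m <= cC * n `^ (2 * q) -> 0 <= cC ->
  2 * q + 3 + s <= r1 -> 4 + s <= r1 -> 1 <= r1 -> cE * (cC + 1) <= n `^ s ->
  E * (m / (k + m)) `^ r1 <= k^-1.
Proof.
move=> n1 m1 nmk cE0 hE hm cC0 hr1 hr2 r11 hN.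
have n0 : 0 < n := lt_le_trans ltr01 n1.
have m0 : 0 < m := lt_le_trans ltr01 m1.
have k0 : 0 < k by apply: lt_le_trans nmk; exact: mulr_gt0.
have r0 : 0 <= r1 - 1 by rewrite subr_ge0.
have Np r : 0 < n `^ r by rewrite powR_gt0.
pose x := m / (k + m).
have x0 : 0 <= x by rewrite divr_ge0 ?addr_ge0 ?ltW.
have xk : x <= m / k.
  by rewrite ler_wpM2l ?(ltW m0)// lef_pV2 ?posrE ?addr_gt0// lerDl ltW.
have xn : x <= n^-1.
  by apply: le_trans xk _; rewrite ler_pdivrMr// mulrC ler_pdivlMr// mulrC.
have xr : x `^ r1 <= m / k * n `^ (- (r1 - 1)).
  have -> : x `^ r1 = x * x `^ (r1 - 1).
    rewrite -[X in X * _]powRr1// -powRD; last by rewrite subrKC gt_eqF// (lt_le_trans ltr01).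
    by rewrite subrKC.
  apply: ler_pM => //; first exact: powR_ge0.
  rewrite -[V in n `^ V]mulN1r powRrM powR_inv1 ?(ltW n0)//.
  by apply: ge0_ler_powR; rewrite ?nnegrE ?invr_ge0// ltW.
have Em : E * m <= n `^ (r1 - 1).
  have h1 : E * m <= cE * (n ^+ 2 * m + n ^+ 3).
    have := ler_wpM2r (ltW m0) hE; rewrite -mulrA mulrDl divfK ?gt_eqF//.
  have h2 : n ^+ 2 * m <= cC * n `^ (r1 - 1 - s).
    apply: (@le_trans _ _ (n ^+ 2 * (cC * n `^ (2 * q)))).
      by rewrite ler_wpM2l ?sqr_ge0.
    rewrite mulrCA ler_wpM2l// -powR_mulrn ?(ltW n0)// -powRD; last by rewrite (gt_eqF n0) implybT.
    by rewrite ler_powR//; lra.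
  have h3 : n ^+ 3 <= n `^ (r1 - 1 - s).
    by rewrite -powR_mulrn ?(ltW n0)// ler_powR//; lra.
  apply: (le_trans h1); apply: (@le_trans _ _ (cE * ((cC + 1) * n `^ (r1 - 1 - s)))).
    by rewrite ler_wpM2l// mulrDl mul1r lerD.
  rewrite mulrA; apply: (@le_trans _ _ (n `^ s * n `^ (r1 - 1 - s))).
    by rewrite ler_wpM2r ?(ltW (Np _)).
  by rewrite -powRD ?subrKC// (gt_eqF n0) implybT.
have [E0|E0] := lerP 0 E; last first.
  apply: (@le_trans _ _ 0); last by rewrite invr_ge0 ltW.
  by rewrite mulr_le0_ge0 ?powR_ge0// ltW.
apply: le_trans (ler_wpM2l E0 xr) _.
have -> : E * (m / k * n `^ (- (r1 - 1))) = k^-1 * (E * m * n `^ (- (r1 - 1))) by ring.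
rewrite ger_pMr ?invr_gt0// powRN ler_pdivrMr ?mul1r//.
Qed.

Lemma powR_large (s Y : R) : 0 < s -> exists N : nat,
  forall n : nat, (N <= n)%N -> (1 <= n)%N -> Y <= n%:R `^ s.
Proof.
move=> s0; exists (Num.truncn (`|Y| `^ s^-1)).+1 => n Nn n1.
apply: (le_trans (ler_norm Y)).
have -> : `|Y| = (`|Y| `^ s^-1) `^ s by rewrite -powRrM mulVf ?gt_eqF// powRr1.
apply: ge0_ler_powR; rewrite ?nnegrE ?powR_ge0 ?ler0n ?(ltW s0)//.
apply: ltW; apply: lt_le_trans (truncnS_gt _) _.
by rewrite ler_nat.
Qed.

End Orders.

Section Rate.
Variable R : realType.

Lemma slow_recursion_scale (L mu sigma theta eps r t e a V a' : R) :
  0 < mu -> 0 < eps -> 0 < t -> e = theta / (mu * t) -> r = (2 - eps) * theta ->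
  a' <= (1 - (2 - eps) * mu * e + 2 * e ^+ 2 * L ^+ 2) * a
    + 2 * e * L ^+ 2 / (eps * mu) * V + e ^+ 2 * sigma ^+ 2 ->
  a' <= (1 - r / t + 2 * (L / mu) ^+ 2 * theta ^+ 2 / t ^+ 2) * a
    + 2 * (L / mu) ^+ 2 * theta / eps / t * V + sigma ^+ 2 * (theta / mu) ^+ 2 / t ^+ 2.
Proof.
move=> mu0 eps0 t0 -> -> /le_trans; apply; rewrite le_eqVlt; apply/orP; left.
by apply/eqP; field; rewrite !gt_eqF.
Qed.

(** The stepsize changes by at most theta / (mu t^2) in one step. *)
Lemma fast_recursion_scale (L mu sigma theta aG n b G S t e e' a V V' : R) :
  0 < mu -> 0 < t -> 0 < b -> 0 <= theta -> 0 <= G -> 0 <= n -> 0 <= aG ->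
  e = theta / (mu * t) -> e' = theta / (mu * (t + 1)) ->
  S <= b^-1 * G -> G <= aG * n ^+ 3 -> 1 <= t ->
  V' <= (1 - b / 64) * V + 20 * L ^+ 2 / b * e ^+ 2 * a
    + 4 * e ^+ 2 * (n * sigma ^+ 2) + 17 / b * ((e' - e) ^+ 2 * S) ->
  V' <= (1 - b / 64) * V + 20 * L ^+ 2 * (theta / mu) ^+ 2 / (b * t ^+ 2) * a
    + 4 * sigma ^+ 2 * (theta / mu) ^+ 2 * n / t ^+ 2
    + 17 * aG * (theta / mu) ^+ 2 * n ^+ 3 / (b ^+ 2 * t ^+ 4).
Proof.
move=> mu0 t0 b0 th0 G0 n0 aG0 eE e'E SG GG t1 /le_trans; apply.
apply: lerD.
  rewrite le_eqVlt; apply/orP; left; rewrite eE.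
  by apply/eqP; field; rewrite !gt_eqF.
have t10 : 0 < t + 1 by rewrite addr_gt0.
have dE : (e' - e) ^+ 2 = (theta / mu) ^+ 2 * (t * (t + 1)) ^- 2.
  by rewrite eE e'E; field; rewrite !gt_eqF.
have d1 : (t * (t + 1)) ^- 2 <= t ^- 4.
  rewrite lef_pV2 ?posrE ?exprn_gt0 ?mulr_gt0//.
  have -> : t ^+ 4 = (t * t) ^+ 2 by ring.
  rewrite ler_sqr ?nnegrE ?mulr_ge0 ?(ltW t0) ?(ltW t10)//.
  by rewrite ler_pM2l// lerDl.
have hS : S <= b^-1 * (aG * n ^+ 3).
  by apply: le_trans SG _; rewrite ler_pM2l ?invr_gt0.
have K0 : 0 <= b^-1 * (aG * n ^+ 3).
  by rewrite mulr_ge0 ?invr_ge0 ?(ltW b0)// mulr_ge0 ?exprn_ge0.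
apply: (@le_trans _ _ (17 / b * ((theta / mu) ^+ 2 * t ^- 4 * (b^-1 * (aG * n ^+ 3))))).
  rewrite ler_wpM2l ?divr_ge0 ?(ltW b0)//; rewrite dE.
  apply: (@le_trans _ _ ((theta / mu) ^+ 2 * (t * (t + 1)) ^- 2 * (b^-1 * (aG * n ^+ 3)))).
    by rewrite ler_wpM2l// mulr_ge0 ?sqr_ge0// invr_ge0 exprn_ge0// mulr_ge0 ?(ltW t0) ?(ltW t10).
  by rewrite ler_wpM2r// ler_wpM2l ?sqr_ge0.
by rewrite le_eqVlt; apply/orP; left; apply/eqP; field; rewrite !gt_eqF.
Qed.

(** The exponents are spaced evenly: rho = max (2 q + 3, 4) < r1 < r < 2 theta with
    steps s. The gap between r1 and r lets the recursion absorb its constants, and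
    that between rho and r1 makes the initial error negligible. *)
Lemma cedas_rate (L mu sigma theta q aG D' : R) :
  0 < mu -> mu <= L -> 20 <= theta -> 0 < q -> q + 3 / 2 < theta ->
  0 <= aG -> 0 <= D' ->
  exists Gam s cE : R, [/\ 0 < Gam, 0 < s, 0 <= cE &
  forall (n m b h D G S cC : R) (e a V : nat -> R),
  1 <= n -> 0 < b -> b <= 1 / 4 -> 24 * theta * (L / mu) <= b * m ->
  (forall k, e k = theta / (mu * (k%:R + m))) -> h = theta / (mu * (m - 1)) ->
  0 <= G -> D <= D' * n ^+ 2 -> G <= aG * n ^+ 3 -> S <= b^-1 * G ->
  (forall k, 0 <= V k) ->
  a 0%N <= 2 * D + 9 * h ^+ 2 * (n * sigma ^+ 2 + L ^+ 2 * D + G) + e 0%N ^+ 2 * S ->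
  V 0%N <= 2 * D + 9 * h ^+ 2 * (n * sigma ^+ 2 + L ^+ 2 * D + G) + e 0%N ^+ 2 * S ->
  (forall eps k, 0 < eps -> eps * mu * e k <= 1 ->
    a k.+1 <= (1 - (2 - eps) * mu * e k + 2 * e k ^+ 2 * L ^+ 2) * a k
    + 2 * e k * L ^+ 2 / (eps * mu) * V k + e k ^+ 2 * sigma ^+ 2) ->
  (forall k, V k.+1 <= (1 - b / 64) * V k + 20 * L ^+ 2 / b * e k ^+ 2 * a k
    + 4 * e k ^+ 2 * (n * sigma ^+ 2) + 17 / b * ((e k.+1 - e k) ^+ 2 * S)) ->
  0 <= cC -> m <= cC * n `^ (2 * q) -> cE * (cC + 1) <= n `^ s ->
  forall k, n * m <= k%:R -> a k + V k <= Gam / k%:R].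
Proof.
move=> mu0 muL th20 q0 qth aG0 D'0.
have th0 : 0 < theta by apply: lt_le_trans th20.
have L0 : 0 < L := lt_le_trans mu0 muL.
pose kap := L / mu; have kap1 : 1 <= kap by rewrite ler_pdivlMr// mul1r.
pose t := theta / mu; have t0 : 0 < t by rewrite divr_gt0.
pose rho := Num.max (2 * q + 3) 4.
have rho1 : 2 * q + 3 <= rho by rewrite le_max lexx.
have rho2 : 4 <= rho by rewrite le_max lexx orbT.
have rho3 : rho < 2 * theta by rewrite gt_max; apply/andP; split; lra.
pose s := (2 * theta - rho) / 3; have s0 : 0 < s by rewrite /s; lra.
pose r1 := rho + s; pose r := rho + 2 * s.
pose eps := s / theta; have eps0 : 0 < eps by rewrite divr_gt0.
have rE : r = (2 - eps) * theta.
  by rewrite mulrBl /eps divfK ?gt_eqF// /r /s; field.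
have r14 : 4 <= r1 by rewrite /r1; lra.
have r1r : r1 < r by rewrite /r1 /r; lra.
pose M0 := 24 * theta * kap.
have M00 : 0 < M0.
  rewrite /M0; apply: mulr_gt0; last exact: lt_le_trans kap1.
  exact: mulr_gt0 (ltr0n R 24) th0.
have kap0 : 0 <= kap := le_trans ler01 kap1.
have A10 : 0 <= 20 * L ^+ 2 * t ^+ 2 by nonneg.
have A20 : 0 <= 4 * sigma ^+ 2 * t ^+ 2 by nonneg.
have A30 : 0 <= 17 * aG * t ^+ 2 by nonneg.
have A40 : 0 <= 2 * kap ^+ 2 * theta ^+ 2 by nonneg.
have A50 : 0 <= 2 * kap ^+ 2 * theta / eps.
  by have th1 := ltW th0; apply: divr_ge0; [nonneg|exact: ltW].
have A60 : 0 <= sigma ^+ 2 * t ^+ 2 by nonneg.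
have s2 : s <= theta by rewrite /s; move: rho2 th0; lra.
have r1q : 2 * q + 3 + s <= r1 by rewrite /r1 lerD2r.
have r1s : 4 + s <= r1 by rewrite /r1 lerD2r.
have r11 : 1 <= r1 by apply: le_trans r14; rewrite ler1n.
have [Gam Gam0 bound] :=
  coupled_recursion_bound A10 A20 A30 A40 A50 A60 M00 r14 r1r.
pose cE := 2 * D' + 36 * t ^+ 2 * (sigma ^+ 2 + L ^+ 2 * D' + aG) + t ^+ 2 * aG / M0.
have cE0 : 0 <= cE.
  have i0 : 0 <= M0^-1 by rewrite invr_ge0 ltW.
  have := sqr_ge0 t; have := sqr_ge0 sigma; have := sqr_ge0 L.
  rewrite /cE; move: (t ^+ 2) (sigma ^+ 2) (L ^+ 2) => x y z x0 y0 z0.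
  nonneg.
exists (3 * Gam), s, cE; split => //; first by rewrite mulr_gt0.
move=> n m b h D G S cC e a V n1 b0 b4 bm eE hE G0 DD GG SG V0 a0 Vi aS VS cC0 mC hN k nmk.
have M0m : M0 <= b * m := bm.
have m0 : 0 < m by rewrite -(pmulr_rgt0 _ b0); exact: lt_le_trans M0m.
have b1 : b <= 1 by apply: le_trans b4 _; rewrite ler_pdivrMr ?mul1r ?ler1n.
have m2th : 2 * theta <= m.
  apply: (@le_trans _ _ M0); first by rewrite /M0 -mulrA ler_pM ?(ltW th0)//;
    [rewrite ler_nat|rewrite ler_peMr// ltW].
  by apply: le_trans M0m _; rewrite ger_pMl.
have m2 : 2 <= m.
  by apply: le_trans m2th; rewrite ler_peMr// (le_trans _ th20)// ler1n.
have rm : r <= m.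
  by apply: le_trans m2th; rewrite rE ler_wpM2r ?(ltW th0)// gerBl ltW.
have m1 : 1 <= m by apply: le_trans m2; rewrite ler1n.
have n0 : 0 < n := lt_le_trans ltr01 n1.
have k0 : 0 < k%:R :> R by apply: lt_le_trans nmk; rewrite mulr_gt0.
have tau0 j : 0 < j%:R + m by rewrite ltr_wpDl.
have m10 : 0 < m - 1 by rewrite subr_gt0; apply: lt_le_trans m2; rewrite ltr1n.
have hE' : h = t * (m - 1)^-1 by rewrite hE invfM mulrA.
have h0 : 0 <= h by rewrite hE' divr_ge0 ?(ltW t0)// ltW.
have ht : h <= 2 * (t / m).
  rewrite hE' [leRHS]mulrCA ler_pM2l// ler_pdivlMr// mulrC ler_pdivrMr//.
  by rewrite mulrBr mulr1 lerBrDr (mulr_natl m 2) mulr2n lerD2l.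
have e0E : e 0%N = t / m by rewrite eE add0r invfM mulrA.
pose E := cE * (n ^+ 2 + n ^+ 3 / m).
have E0 : 0 <= E.
  by rewrite mulr_ge0// addr_ge0 ?divr_ge0 ?exprn_ge0// ltW.
have IE : 2 * D + 9 * h ^+ 2 * (n * sigma ^+ 2 + L ^+ 2 * D + G) + e 0%N ^+ 2 * S <= E.
  rewrite e0E; exact: (init_bound_order _ _ n1 m1 b0 M00 M0m h0 ht (ltW t0) D'0 aG0 G0 DD GG SG).
have aS' j : a j.+1 <= (1 - r / (j%:R + m) + 2 * kap ^+ 2 * theta ^+ 2 / (j%:R + m) ^+ 2) * a j
    + 2 * kap ^+ 2 * theta / eps / (j%:R + m) * V j + sigma ^+ 2 * t ^+ 2 / (j%:R + m) ^+ 2.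
  apply: (slow_recursion_scale mu0 eps0 (tau0 j) (eE j) rE); apply: aS => //.
  have -> : eps * mu * e j = s / (j%:R + m).
    by rewrite eE /eps; field; rewrite !gt_eqF.
  rewrite ler_pdivrMr// mul1r; apply: (@le_trans _ _ m); last by rewrite lerDr.
  apply: le_trans m2th; apply: le_trans s2 _; rewrite ler_pMl// ler1n//.
have VS' j : V j.+1 <= (1 - b / 64) * V j + 20 * L ^+ 2 * t ^+ 2 / (b * (j%:R + m) ^+ 2) * a j
    + 4 * sigma ^+ 2 * t ^+ 2 * n / (j%:R + m) ^+ 2
    + 17 * aG * t ^+ 2 * n ^+ 3 / (b ^+ 2 * (j%:R + m) ^+ 4).
  apply: (fast_recursion_scale mu0 (tau0 j) b0 (ltW th0) G0 (ltW n0) aG0 (eE j) _ SG GG _ (VS j)).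
    by rewrite eE -natr1 addrAC.
  by apply: le_trans m1 _; rewrite lerDr.
apply: le_trans (bound n m b E a V n1 m2 rm b0 b1 M0m E0 (le_trans a0 IE) (le_trans Vi IE)
  V0 aS' VS' k) _.
have -> : 3 * Gam / k%:R = Gam * (k%:R^-1 + k%:R^-1 + k%:R^-1) by ring.
rewrite ler_pM2l//; apply: lerD; first apply: lerD.
- by rewrite lef_pV2 ?posrE// lerDl ltW.
- rewrite ler_pdivrMr ?exprn_gt0//; apply: (@le_trans _ _ (k%:R ^+ 3)).
    by rewrite lerXn2r ?nnegrE ?mulr_ge0 ?(ltW n0) ?(ltW m0) ?(ltW k0).
  apply: (@le_trans _ _ (k%:R^-1 * k%:R ^+ 4)).
    by rewrite exprS mulKf ?gt_eqF.
  rewrite ler_wpM2l ?invr_ge0 ?(ltW k0)// lerXn2r ?nnegrE ?(ltW k0) ?(ltW (tau0 k))//.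
  by rewrite lerDl ltW.
- exact: (init_error_negligible n1 m1 nmk cE0 (lexx _) mC cC0 r1q r1s r11 hN).
Qed.

End Rate.

Lemma enorm_row0 (R : realType) p (v : 'rV[R]_p) : p = 0%N -> enorm v = 0.
Proof.
by move=> p0; subst p; rewrite /enorm /sqnorm big_ord1 big_ord0 sqrtr0.
Qed.

Lemma star_grad_sq (R : realType) n p (f : 'I_n -> 'rV[R]_p -> R) x :
  mdot (star_grad f x) (star_grad f x) = \sum_i enorm (grad (f i) x) ^+ 2.
Proof.
rewrite -sqnormE sqnorm_rows; apply: eq_bigr => i _.
by rewrite enorm_sq /star_grad /stack_grad rowK row_ones.
Qed.

Lemma init_dist_sq (R : realType) n p (M : 'M[R]_(n, p)) (x : 'rV[R]_p) (A B : R) :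
  (0 < n)%N -> enorm M ^+ 2 <= A * n%:R ^+ 2 -> enorm x ^+ 2 <= B ->
  mdot (M - ones x) (M - ones x) <= (2 * `|A| + 2 * `|B|) * n%:R ^+ 2.
Proof.
move=> n0 MA xB; apply: le_trans (mdot_sum_le2 _ _) _.
have onesE : mdot (ones x) (ones x : 'M[R]_(n, p)) = n%:R * enorm x ^+ 2.
  rewrite -sqnormE sqnorm_rows (eq_bigr (fun=> sqnorm x)) => [|i _]; last by rewrite row_ones.
  by rewrite sumr_const card_ord enorm_sq mulr_natl.
rewrite mdotNl mdotNr opprK onesE -sqnormE -enorm_sq [leRHS]mulrDl -![in leRHS]mulrA.
apply: lerD; rewrite ler_pM2l//.
  by apply: le_trans MA _; rewrite ler_wpM2r ?sqr_ge0 ?ler_norm.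
rewrite mulrC; apply: ler_pM; rewrite ?sqr_ge0 ?(le_trans xB (ler_norm _))//.
by rewrite expr2 ler_peMl// ler1n.
Qed.

Lemma transient_time_le (R : realType) n p d dXi dZ (Omega : measurableType d)
    (Xi : measurableType dXi) (Z : measurableType dZ) (P : probability Omega R)
    (c : cedas_params R n p Xi Z) xi zeta xstar (c0 : R) (K : nat) (B : R) :
  (0 < K)%N ->
  (forall k, (K <= k)%N ->
    (mean_square_error P c xi zeta xstar k <= (c0 / (n%:R * k%:R))%:E)%E) ->
  K%:R <= B -> (transient_time P c xi zeta xstar c0 <= B%:E)%E.
Proof.
move=> K0 hK KB; apply: (@le_trans _ _ (K%:R%:E)); last by rewrite lee_fin.
by apply: ereal_inf_lbound; exists K.
Qed.

(** * The transient time *)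

Section StepParameters.
Variable R : realType.

Lemma gap_scale (C alpha gamma de be : R) :
  0 < C -> 0 < de -> 0 < be -> alpha = 1 / (4 * (C + 1)) ->
  gamma = alpha ^+ 2 * de / (be * C) ->
  (gamma * de)^-1 = 16 * be * C * (C + 1) ^+ 2 / de ^+ 2.
Proof.
move=> C0 de0 be0 -> ->; have C1 : 0 < C + 1 by rewrite addr_gt0.
by field; rewrite !gt_eqF.
Qed.

(** Since alpha (C + 1) = 1/4, the compression error alpha C stays below 1/4, and
    gamma C is at most alpha^2 / be. *)
Lemma compression_parameters (C alpha gamma de be : R) :
  0 < C -> 0 < de -> de <= 1 -> 0 < be -> 200 <= be -> alpha = 1 / (4 * (C + 1)) ->
  gamma = alpha ^+ 2 * de / (be * C) -> gamma <= alpha / 2 ->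
  [/\ 0 < alpha, alpha <= 1 / 4, alpha * C <= 1 / 4 &
   [/\ 0 < gamma, gamma / 2 <= alpha / 4 & gamma / 2 * C <= alpha ^+ 2 / 400]].
Proof.
move=> C0 de0 de1 be0 be200 alE gaE ga2.
have C1 : 0 < C + 1 by rewrite addr_gt0.
have al0 : 0 < alpha by rewrite alE divr_gt0// mulr_gt0.
have al4E : alpha * (C + 1) = 1 / 4 by rewrite alE; field; rewrite gt_eqF.
have ga0 : 0 < gamma by rewrite gaE divr_gt0 ?mulr_gt0 ?exprn_gt0.
have alC : alpha * C <= 1 / 4 by rewrite -al4E ler_pM2l// lerDl.
split => //; first by rewrite -al4E ler_peMr ?(ltW al0)// lerDr ltW.
split => //; first by move: ga2; clear - R; lra.
have -> : gamma / 2 * C = alpha ^+ 2 * (de / (2 * be)).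
  by rewrite gaE; field; rewrite !gt_eqF.
have i0 : 0 <= (2 * be)^-1 by rewrite invr_ge0 mulr_ge0// ltW.
rewrite ler_pM2l ?exprn_gt0//; apply: le_trans (ler_piMl i0 de1) _.
have h2 : 2 * 200 <= 2 * be by rewrite ler_pM2l.
have h4 : (0 : R) < 400 by rewrite ltr0n.
rewrite lef_pV2 ?posrE//; last exact: mulr_gt0.
by apply: le_trans h2; rewrite -natrM.
Qed.

End StepParameters.

Theorem corollary5 (R : realType) (p : nat)
  (L mu sigma theta q : R)
  (hmu : 0 < mu) (hsigma : 0 < sigma) (htheta : 20 <= theta) (hq : 0 < q)
  (hqtheta : q + 3 / 2 < theta)
  (* constants hidden in the O(.) of the assumptions *)
  (a_grad a_init a_gap a_m a_star Cmin : R) (hCmin : 0 < Cmin) :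
  exists c0 c1 : R, 0 < c0 /\ 0 < c1 /\
  forall C : R, Cmin <= C ->
  exists N : nat,
  forall (n : nat) (hn : (2 <= n)%N) (hN : (N <= n)%N)
    (f : 'I_n -> 'rV[R]_p -> R) (xstar : 'rV[R]_p)
    (e : rel 'I_n) (W : 'M[R]_n) (lam : seq R)
    (alpha gamma m : R) (xinit : 'M[R]_(n, p))
    (d dXi dZ : measure_display) (Omega : measurableType d)
    (Xi : measurableType dXi) (Z : measurableType dZ)
    (P : probability Omega R)
    (g : 'I_n -> 'rV[R]_p -> Xi -> 'rV[R]_p)
    (comp : 'rV[R]_p -> Z -> 'rV[R]_p)
    (xi : 'I_n -> nat -> Omega -> Xi) (zeta : 'I_n -> nat -> Omega -> Z),
  let lambda2 := lam`_1 in
  let kappa := L / mu in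
  let beta0 : R := 15876 in
  let eta (t : nat) : R := theta / (mu * (t%:R - 1 + m)) in
  let run := CedasParams W alpha gamma eta g comp xinit xinit in
  (* costs *)
  (forall i, smooth L (f i)) ->
  strongly_convex mu (average_cost f) ->
  is_minimizer (average_cost f) xstar ->
  (* network *)
  mixing_matrix e W ->
  ordered_spectrum W lam ->
  (* randomness, gradient oracle and compressor *)
  cedas_randomness P run xi zeta ->
  (forall i t, stochastic_gradient P sigma (grad (f i)) (g i)
                 (iterate run xi zeta i t) (xi i t)) ->
  (forall i k, unbiased_compressor P C comp (zeta i k)) ->
  (* parameters *)
  alpha = 1 / (4 * (C + 1)) ->
  gamma = alpha ^+ 2 * (1 - lambda2) / (beta0 * C) ->
  gamma <= Num.min (1 / 2)
             (Num.min (alpha ^+ 2 * (1 - lambda2) / (15876 * C)) (alpha / 2)) ->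
  48 * theta * kappa / (gamma * (1 - lambda2)) <= m ->
  m <= a_m * (48 * theta * kappa / (gamma * (1 - lambda2))) ->
  (* orders of magnitude *)
  \sum_i enorm (grad (f i) xstar) ^+ 2 <= a_grad * n%:R ^+ 3 ->
  enorm xinit ^+ 2 <= a_init * n%:R ^+ 2 ->
  1 / (1 - lambda2) <= a_gap * n%:R `^ q ->
  enorm xstar ^+ 2 <= a_star ->
  (transient_time P run xi zeta xstar c0
     <= (c1 * (n%:R * C ^+ 3 / (1 - lambda2) ^+ 2))%:E)%E.
Proof.
have [p0|p0] := posnP p.
  (* In dimension 0 the error vanishes and K = 1 qualifies; the bound is at least 1
     because C >= Cmin and 1 - lambda2 <= 1. *)
  exists 1, (Cmin ^- 3); split=> //; split; first by rewrite invr_gt0 exprn_gt0.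
  move=> C CC; exists 0%N => n hn _ f xstar e W lam alpha gamma m xinit d dXi dZ.
  move=> Omega Xi Z P g comp xi zeta lambda2 kappa beta0 eta run _ _ _ We lamW.
  move=> *; apply: (@transient_time_le _ _ _ _ _ _ _ _ _ _ _ _ _ _ _ 1%N) => //.
    move=> k _; rewrite /mean_square_error big1 => [|i _].
      by rewrite mule0 lee_fin divr_ge0// mulr_ge0.
    rewrite (_ : (fun w => _) = cst 0) ?expectation_cst//.
    by apply/funext => w; rewrite enorm_row0// expr0n.
  have de0 : 0 < 1 - lam`_1 by rewrite subr_gt0; exact: (lambda2_lt1 We lamW hn).
  have de1 : 1 - lam`_1 <= 1 by rewrite gerBl; exact: (lambda2_ge0 We lamW hn).
  rewrite mulrC ler_pdivlMr ?exprn_gt0// mul1r ler_pdivlMr ?exprn_gt0//.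
  apply: (@le_trans _ _ (Cmin ^+ 3)).
    by rewrite ler_piMr ?exprn_ge0 ?(ltW hCmin)// exprn_ile1 ?(ltW de0).
  apply: (@le_trans _ _ (C ^+ 3)).
    by rewrite lerXn2r ?nnegrE ?(ltW hCmin)// (le_trans _ CC)// ltW.
  apply: ler_peMl; last by rewrite ler1n ltnW.
  by apply: exprn_ge0; apply: le_trans CC; exact: ltW.
have [muL|Lmu] := leP mu L; last first.
  (* no cost satisfies the hypotheses when L < mu *)
  exists 1, 1; split=> //; split=> //.
  move=> C CC; exists 0%N => n hn _ f xstar e W lam alpha gamma m xinit d dXi dZ.
  move=> Omega Xi Z P g comp xi zeta lambda2 kappa beta0 eta run fL fmu _ _ _ _ _ _.
  have := strongly_convex_smooth_le (ltnW hn) xstar fL fmu p0 hmu.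
  by rewrite leNgt Lmu.
pose D' := 2 * `|a_init| + 2 * `|a_star|.
have D'0 : 0 <= D' by rewrite addr_ge0 ?mulr_ge0.
have [Gam [s [cE [Gam0 s0 cE0 rate]]]] :=
  cedas_rate sigma hmu muL htheta hq hqtheta (normr_ge0 a_grad) D'0.
have th0 : 0 < theta by apply: lt_le_trans htheta.
have kap0 : 0 < L / mu by rewrite divr_gt0// (lt_le_trans hmu).
(* The numeral 15876 is kept abstract, since it is computed in unary; only the
   lower bound 200 matters. *)
have [be [be0 be200 beE]] : exists be : R,
    [/\ 0 < be, 200 <= be & forall x y z : R, x = y / (15876 * z) -> x = y / (be * z)].
  exists 15876; split; last by move=> x y z; exact.
    by rewrite ltr0n.
  by rewrite ler_nat.
pose A := `|a_m| * (48 * theta * (L / mu)) * (16 * be).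
have A0 : 0 <= A.
  have [[th1 kap1] be1] := (ltW th0, ltW kap0, ltW be0); rewrite /A.
  exact: (mulr_ge0 (mulr_ge0 (normr_ge0 _) (mulr_ge0 (mulr_ge0 (ler0n R 48) th1) kap1))
    (mulr_ge0 (ler0n R 16) be1)).
pose c1 := 2 * (A * (1 + Cmin^-1) ^+ 2) + 1.
have c10 : 0 < c1.
  rewrite ltr_pwDr// mulr_ge0 ?ler0n//; exact: mulr_ge0 A0 (sqr_ge0 _).
exists Gam, c1; split=> //; split=> // C CC.
have C0 : 0 < C := lt_le_trans hCmin CC.
pose cC := A * C * (C + 1) ^+ 2 * a_gap ^+ 2.
have cC0 : 0 <= cC.
  exact: (mulr_ge0 (mulr_ge0 (mulr_ge0 A0 (ltW C0)) (sqr_ge0 _)) (sqr_ge0 _)).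
have [N hlarge] := powR_large (cE * (cC + 1)) s0.
exists N => n hn hN f xstar e W lam alpha gamma m xinit d dXi dZ.
move=> Omega Xi Z P g comp xi zeta lambda2 kappa beta0 eta run fL fmu fmin We lamW.
move=> rnd gs cmp alE gaE gale mge mle hgrad hinit hgap hstar.
have n0 : (0 < n)%N := ltnW hn.
have n1 : 1 <= n%:R :> R by rewrite ler1n.
have nR0 : 0 < n%:R :> R by rewrite ltr0n.
pose de := 1 - lambda2.
have de0 : 0 < de by rewrite subr_gt0; exact: (lambda2_lt1 We lamW hn).
have de1 : de <= 1 by rewrite gerBl; exact: (lambda2_ge0 We lamW hn).
have gaE' : gamma = alpha ^+ 2 * de / (be * C) by exact: (beE _ _ _ gaE).
have ga2 : gamma <= alpha / 2.
  by move: gale; rewrite !le_min => /andP[_ /andP[_]].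
have [al0 al4 alC [ga0 gal gC]] := compression_parameters C0 de0 de1 be0 be200 alE gaE' ga2.
have scale := gap_scale C0 de0 be0 alE gaE'.
have g0 : 0 < gamma / 2 by rewrite divr_gt0.
pose b := gamma / 2 * de; have b0 : 0 < b by rewrite mulr_gt0.
have bg : b <= gamma / 2 by rewrite /b ler_piMr// ltW.
have Bg : gossip (gamma / 2) b (gossip_mx run) := mixing_gossip We lamW hn g0.
have b4 : b <= 1 / 4.
  apply: (le_trans bg); apply: (le_trans gal); rewrite ler_pM2r ?invr_gt0//.
  by apply: (le_trans al4); rewrite ler_pdivrMr// mul1r ler1n.
have gade0 : 0 < gamma * de by rewrite mulr_gt0.
have bm : 24 * theta * (L / mu) <= b * m.
  have hm : 48 * theta * (L / mu) <= m * (gamma * de) by rewrite -ler_pdivrMr.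
  rewrite -(ler_pM2l (_ : 0 < 2)) ?ltr0n//.
  have -> : 2 * (24 * theta * (L / mu)) = 48 * theta * (L / mu) by ring.
  by have -> : 2 * (b * m) = m * (gamma * de) by rewrite /b; field.
pose om := 8 * (gamma / 2) * C / alpha.
have omE : om * alpha = 8 * (gamma / 2) * C by rewrite divfK ?gt_eqF.
have L0 : 0 <= L := le_trans (ltW hmu) muL.
have m0 : 0 < m.
  rewrite -(pmulr_rgt0 _ b0); apply: lt_le_trans bm.
  by rewrite mulr_gt0// mulr_gt0.
have tau0 k : 0 < k%:R + m by rewrite ltr_wpDl.
have etaE k : eta k.+1 = theta / (mu * (k%:R + m)) by rewrite /eta -natr1 addrK.
have eta0 k : 0 < cp_eta run k.+1 by rewrite [cp_eta _ _]etaE divr_gt0// mulr_gt0.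
have etaL k : cp_eta run k.+1 * L <= b / 24.
  rewrite [cp_eta _ _]etaE.
  have -> : theta / (mu * (k%:R + m)) * L = theta * (L / mu) / (k%:R + m).
    by field; rewrite !gt_eqF.
  rewrite ler_pdivrMr// [leRHS]mulrAC ler_pdivlMr// [leLHS]mulrC [leLHS]mulrA.
  by apply: (le_trans bm); rewrite ler_pM2l// lerDr.
have hD := init_dist_sq n0 hinit hstar.
have hG : mdot (star_grad f xstar) (star_grad f xstar) <= `|a_grad| * n%:R ^+ 3.
  rewrite star_grad_sq; apply: (le_trans hgrad).
  by rewrite ler_wpM2r ?exprn_ge0// ler_norm.
have hS := star_dual_le fL fmin Bg n0 b0.
have [a0 V0] := Ex_init xstar rnd fL gs cmp Bg n0 b0 al0 al4 gC omE erefl.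
have mean_step := Ex_mean_step rnd fL fmu fmin gs cmp Bg n0 b0 bg al0 C0 omE L0 hmu eta0.
have lyap_step := Ex_lyap_step rnd fL fmin gs cmp Bg n0 b0 bg al0 al4 C0 gal alC gC omE L0 eta0 etaL.
have lyap_pos k : 0 <= Ex P (lyap run xi zeta f xstar om k).
  by apply: Ex_ge0 => w; exact: (lyap_ge0 _ _ _ _ Bg b0 bg al0 C0 omE).
have hE : eta 0%N = theta / (mu * (m - 1)) by rewrite /eta sub0r [- 1 + m]addrC.
have m_scale : 48 * theta * (L / mu) / (gamma * de) =
    48 * theta * (L / mu) * (16 * be) * (C * (C + 1) ^+ 2) * (1 / de) ^+ 2.
  by rewrite scale div1r exprVn !mulrA.
have Cp0 : 0 <= C * (C + 1) ^+ 2 by rewrite mulr_ge0 ?sqr_ge0// ltW.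
have m_le : m <= A * (C * (C + 1) ^+ 2) * (1 / de) ^+ 2.
  apply: (le_trans mle).
  apply: (@le_trans _ _ (`|a_m| * (48 * theta * (L / mu) / (gamma * de)))).
    rewrite ler_wpM2r ?ler_norm// divr_ge0 ?(ltW gade0)//.
    by rewrite mulr_ge0 ?(ltW kap0)// mulr_ge0 ?(ltW th0).
  by rewrite m_scale /A !mulrA.
have m_pow : m <= cC * n%:R `^ (2 * q).
  apply: (le_trans m_le).
  have -> : cC * n%:R `^ (2 * q) = A * (C * (C + 1) ^+ 2) * (a_gap * n%:R `^ q) ^+ 2.
    by rewrite exprMn -[(_ `^ q) ^+ 2]powR_mulrn ?powR_ge0// -powRrM [q * _]mulrC /cC !mulrA.
  apply: ler_wpM2l; first exact: mulr_ge0.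
  by rewrite lerXn2r ?nnegrE ?(le_trans _ hgap)// divr_ge0 ?(ltW de0).
have err_le := rate n%:R m b (eta 0%N) _ _ _ cC (fun k => eta k.+1) _ _ n1 b0 b4 bm etaE hE
  (mdot_ge0 _) hD hG hS lyap_pos a0 V0 mean_step lyap_step cC0 m_pow (hlarge n hN n0).
(* the first integer above n m *)
pose K := (Num.truncn (n%:R * m)).+1.
have nm0 : 0 < n%:R * m by rewrite mulr_gt0.
have nmK k : (K <= k)%N -> n%:R * m <= k%:R.
  move=> Kk; apply: ltW; apply: lt_le_trans (truncnS_gt _) _.
  by rewrite ler_nat.
apply: (@transient_time_le _ _ _ _ _ _ _ _ _ _ _ _ _ _ _ K) => //.
  move=> k Kk.
  apply: le_trans (mean_square_error_le xstar rnd fL gs cmp Bg n0 b0 bg al0 C0 omE k) _.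
  rewrite lee_fin invfM mulrCA ler_pM2l ?invr_gt0//.
  exact: err_le (nmK k Kk).
have m1 : 1 <= m.
  have b1 : b <= 1 by apply: (le_trans b4); rewrite ler_pdivrMr// mul1r ler1n.
  apply: (@le_trans _ _ (b * m)); last by rewrite ler_piMl// ltW.
  apply: le_trans bm; rewrite -mulrA mulr_ege1 ?ler1n// mulr_ege1//.
    by apply: le_trans htheta; rewrite ler1n.
  by rewrite ler_pdivlMr// mul1r.
have nm1 : 1 <= n%:R * m by rewrite mulr_ege1.
have K2 : K%:R <= 2 * (n%:R * m).
  rewrite /K -[leLHS]natr1 [2 * _]mulr_natl mulr2n; apply: lerD => //.
  by rewrite truncn_le ltW.
apply: (le_trans K2).
have C1 : C + 1 <= C * (1 + Cmin^-1).
  by rewrite mulrDr mulr1 lerD2l ler_pdivlMr// mul1r.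
have C3 : C * (C + 1) ^+ 2 <= C ^+ 3 * (1 + Cmin^-1) ^+ 2.
  rewrite (exprS C 2) -[leRHS]mulrA -exprMn ler_pM2l// lerXn2r ?nnegrE ?addr_ge0 ?(ltW C0)//.
  by rewrite mulr_ge0 ?addr_ge0 ?invr_ge0 ?(ltW C0) ?(ltW hCmin).
have X0 : 0 <= n%:R * C ^+ 3 / de ^+ 2.
  by rewrite divr_ge0 ?sqr_ge0// mulr_ge0 ?exprn_ge0 ?(ltW C0).
rewrite /c1 [leRHS]mulrDl mul1r; apply: ler_wpDr => //.
rewrite -[leRHS]mulrA ler_pM2l//.
have -> : A * (1 + Cmin^-1) ^+ 2 * (n%:R * C ^+ 3 / de ^+ 2) =
    n%:R * (A * (C ^+ 3 * (1 + Cmin^-1) ^+ 2) * (1 / de) ^+ 2).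
  by rewrite div1r exprVn; ring.
rewrite ler_pM2l//; apply: (le_trans m_le).
by rewrite ler_wpM2r ?sqr_ge0// ler_wpM2l.
Qed.
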